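(* Let $r>0$ and $T>0$. The positive occupation time $A_T=\int_0^T 1_{[0,\infty)}(W^r_t)\,dt$ of reset Brownian motion with reset rate $r$ has density (with respect to Lebesgue measure) $$p^A_r(a)=r\,e^{-rT}\,W\big(r\sqrt{a(T-a)}\,\big),\qquad a\in(0,T),$$ where, for $x\in(0,\infty)$, $$W(x)=\frac1x\sum_{j=0}^\infty\frac{x^j}{\Gamma(\frac{j+1}{2})^2}=I_0(2x)+\frac{1}{x\pi}\,{}_1F_2\big(\{1\},\{\tfrac12,\tfrac12\},x^2\big),$$ with $I_0$ the modified Bessel function of the first kind with index $0$ and ${}_1F_2(\{a\},\{b,c\},y)$ the generalized hypergeometric function.
   Context: Reset Brownian motion (rBM): given a Poisson process on $[0,\infty)$ of intensity $r>0$, the process $(W^r_t)_{t\ge 0}$ starts at $0$, evolves as a standard Brownian motion on $\mathbb{R}$, and at each Poisson point is placed back at $0$, from where it continues as a fresh standard Brownian motion started at $0$; the successive Brownian pieces are independent of each other and of the Poisson process. $\mathbb{P}_r$ denotes probability for rBM with rate $r$, and $p^A_r(a)=\mathbb{P}_r(A_T\in da)/da$ for $a\in(0,T)$. The generalized hypergeometric function is ${}_1F_2(\{a\},\{b,c\},y)=\sum_{m\ge0}\frac{(a)_m}{(b)_m(c)_m}\frac{y^m}{m!}$ with $(\cdot)_m$ the rising factorial. *)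

(* Defs.v *)
From HB Require Import structures.
From mathcomp Require Import all_boot all_order all_algebra finmap.
From mathcomp Require Import all_classical all_reals all_analysis.
Import Order.TTheory GRing.Theory Num.Theory.
Import numFieldNormedType.Exports.

Set Implicit Arguments.
Unset Strict Implicit.
Unset Printing Implicit Defensive.

Local Open Scope classical_set_scope.
Local Open Scope ring_scope.

Section independence.
Context {d : measure_display} {Omega : measurableType d} {R : realType}.

(* The sigma-algebra sigma(X_i : i in D). *)
Definition sigma_of (I : Type) (D : set I) (X : I -> Omega -> R) :
    set (set Omega) :=
  <<s \bigcup_(i in D) preimage_set_system setT (X i) measurable >>.

Definition mutually_independent (P : probability Omega R) (I : choiceType)
    (F : I -> set (set Omega)) : Prop :=
  forall (J : {fset I}) (A : I -> set Omega),
    (forall i, i \in J -> F i (A i)) ->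
    P (\bigcap_(i in [set` J]) A i) = (\prod_(i <- J) P (A i))%E.

Definition independent_variables (P : probability Omega R) (I : choiceType)
    (X : I -> Omega -> R) : Prop :=
  mutually_independent P (fun i => sigma_of [set i] X).

End independence.

Section reset_brownian.
Context {d : measure_display} {Omega : measurableType d} {R : realType}.
Variable P : probability Omega R.

(* Only the times t >= 0 are relevant. *)
Definition standard_brownian_motion (B : R -> {RV P >-> R}) : Prop :=
  [/\ forall w, B 0 w = 0,
      forall w, {within `[0, +oo[, continuous (fun t => B t w)},
      forall s t, 0 <= s -> s < t ->
        forall Y, measurable Y ->
        P ((fun w => B t w - B s w) @^-1` Y) = normal_prob 0 (Num.sqrt (t - s)) Y
    & forall t : nat -> R, 0 <= t 0%N -> nondecreasing_seq t ->
        independent_variables P (fun i w => B (t i.+1) w - B (t i) w)].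

(* S 0 = 0 is the origin of time and S 1, S 2, ... are the points of the
   process, with independent exponential gaps of mean r^-1. *)
Definition poisson_process (r : R) (S : nat -> {RV P >-> R}) : Prop :=
  [/\ forall w, S 0%N w = 0,
      forall k Y, measurable Y ->
        P ((fun w => S k.+1 w - S k w) @^-1` Y) = exponential_prob r Y
    & independent_variables P (fun k w => S k.+1 w - S k w)].

(* The number k of Poisson points in ]0, t], characterized by
   S k <= t < S k.+1; the value is 0 if the points do not go past t,
   an event of probability zero. *)
Definition resets (S : nat -> {RV P >-> R}) (t : R) (w : Omega) : nat :=
  match pselect (exists k : nat, t < S k.+1 w) with
  | left h => ex_minn h
  | right _ => 0%N
  end.

(* B k is the Brownian piece run after the k-th reset (B 0 from time 0 on).
   The index None stands for the Poisson process, Some k for the piece B k. *)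
Definition reset_brownian_motion (r : R) (W : R -> Omega -> R) : Prop :=
  exists (S : nat -> {RV P >-> R}) (B : nat -> R -> {RV P >-> R}),
    [/\ poisson_process r S,
        forall k, standard_brownian_motion (B k),
        mutually_independent P (fun i : option nat =>
          match i with
          | None => sigma_of setT (fun k => S k : Omega -> R)
          | Some k => sigma_of `[0, +oo[ (fun t => B k t : Omega -> R)
          end)
      & forall t w, 0 <= t ->
          W t w = B (resets S t w) (t - S (resets S t w) w) w].

Definition occupation_time (W : R -> Omega -> R) (T : R) (w : Omega) : R :=
  \int[lebesgue_measure]_(t in `[0, T]) \1_(`[0, +oo[%classic : set R) (W t w).

(* The law of X is carried by D, with Lebesgue density f there. *)
Definition has_density_on (X : Omega -> R) (D : set R) (f : R -> R) : Prop :=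
  [/\ measurable_fun setT X,
      measurable_fun D f,
      forall a, D a -> 0 <= f a
    & forall Y, measurable Y ->
        P (X @^-1` Y) = (\int[lebesgue_measure]_(a in Y `&` D) (f a)%:E)%E].

End reset_brownian.

Section special_functions.
Context {R : realType}.

Definition Gamma (z : R) : R :=
  \int[lebesgue_measure]_(t in `]0, +oo[) (t `^ (z - 1) * expR (- t)).

Definition rising_factorial (a : R) (m : nat) : R := \prod_(i < m) (a + i%:R).

(* Modified Bessel function of the first kind, of integer index n. *)
Definition besselI (n : nat) (x : R) : R :=
  limn (series (fun m => (x / 2) ^+ (m.*2 + n) / ((m`!)%:R * ((m + n)`!)%:R))).

Definition hypergeometric_1F2 (a b c y : R) : R :=
  limn (series (fun m => rising_factorial a m /
    (rising_factorial b m * rising_factorial c m) * (y ^+ m / (m`!)%:R))).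

Definition W_coeff (x : R) (j : nat) : R := x ^+ j / Gamma (j.+1%:R / 2) ^+ 2.

Definition W_fun (x : R) : R := x^-1 * limn (series (W_coeff x)).

End special_functions.

(* Main.v *)
Require Import Defs.
From HB Require Import structures.
From mathcomp Require Import all_boot all_order all_algebra finmap.
From mathcomp Require Import all_classical all_reals all_analysis.
From mathcomp Require Import measurable_realfun ring lra.
Import Order.TTheory GRing.Theory Num.Theory.
Import numFieldNormedType.Exports.

Set Implicit Arguments.
Unset Strict Implicit.
Unset Printing Implicit Defensive.

Local Open Scope classical_set_scope.
Local Open Scope ring_scope.

(** Between resets the process runs independent Brownian pieces, and everything
rests on one fact about a single piece: by Lévy's arcsine law, the time that a
Brownian path spends in [0, +oo[ during [0, l] has density
kappa / sqrt (t (l - t)).  Multiplied by the exponential density r exp (- r l)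
of the length of a piece, this factors as g t * g (l - t), where
g t = sqrt (kappa r / t) exp (- r t) is the Gamma density of shape 1/2 and
rate r.  So over a complete piece the positive and the negative times are
independent with law g ([ge0_integral_gap_split]), and before the n-th reset
the two accumulated times are independent, each with the n-fold convolution
power of g ([ge0_integral_occ_state]).

Let N be the number of resets before T.  On {N = n}, the positive time A_T is
the one accumulated in n complete pieces plus the one of the current piece,
which is censored at T: the factor exp (- r l) for being longer than l
is again (up to 1/r) the exponential density.  Hence
P (A_T in da, N = n) = (1/r) g_n(a) g_n(T - a) da with g_n the Gamma density of
shape (n+1)/2 ([occ_law_at_reset_count]), and the sum over n is
r exp (- r T) W (r sqrt (a (T - a))), each term giving one coefficient
1 / Gamma((n+1)/2)^2 of the series.

Lévy's law is obtained by discretization.  The numbers of nonnegative values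
of the path on a regular grid follow the discrete arcsine law u_k u_{n-k},
with u_k = binomial(2k, k) / 4^k ([grid_count_law]).  This is Sparre
Andersen's theorem for random walks with symmetric atomless steps; it follows
from a Wiener-Hopf factorization, proved by induction with convolutions of
measures restricted to half-lines ([sparre_andersen_law]).  The discrete laws
converge to the arcsine density because k u_k^2 increases to a constant kappa
([discrete_arcsine_cvg]), and the proportions of positive grid points converge
almost surely to the occupation time, since almost surely the path vanishes
only on a null set of times ([levy_arcsine]).

The constants come for free from total masses.  The arcsine density integrates
to 1 as a limit of probabilities, hence so do g and all the g_n; the latter
says that the coefficients of the g_n are the inverses of the values of Gamma
at half-integers ([Gamma_half]).  Finally kappa = 1/pi by writing the Gaussian
integral as an integral over the levels of its integrand
([integral_gauss_half_gamma]), and separating even and odd indices in W gives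
the hypergeometric and the Bessel series ([W_funE]). *)

(** * Central binomial weights *)

Section arcsine_sequence.
Context {R : realType}.

(** u_n = binomial(2n, n) / 4^n, the n-th coefficient of (1 - x)^(-1/2); the ratio
    of consecutive terms is what the estimates below use. *)
Fixpoint arcsine_seq (n : nat) : R :=
  if n is m.+1 then arcsine_seq m * (m.*2.+1%:R / m.*2.+2%:R) else 1.

Local Notation u := arcsine_seq.

Lemma arcsine_seqS n : n.+1%:R * u n.+1 *+ 2 = n.*2.+1%:R * u n.
Proof.
rewrite /=; have -> : n.*2.+2%:R = n.+1%:R *+ 2 :> R.
  by rewrite -doubleS -mul2n natrM mulr_natl.
field.
by rewrite nat1r pnatr_eq0.
Qed.

Lemma arcsine_seq_gt0 n : 0 < u n.
Proof. by elim: n => //= n ih; rewrite mulr_gt0// divr_gt0// ltr0n. Qed.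

Arguments arcsine_seq : simpl never.

(** The square of (1 - x)^(-1/2) is 1/(1 - x).  Without power series: if s_n is the
    sum, the symmetry i <-> n - i gives 2 sum_i i u_i u_(n-i) = n s_n, and the
    recurrence of u turns this for n + 1 into (n+1) s_(n+1) = (n+1) s_n. *)
Lemma arcsine_seq_conv n : \sum_(i < n.+1) u i * u (n - i) = 1.
Proof.
elim: n => [|n ih]; first by rewrite big_ord1 mul1r.
set s := (X in X = _).
have E (m : nat) : \sum_(i < m.+1) (i%:R * (u i * u (m - i))) =
    \sum_(i < m.+1) ((m - i)%:R * (u i * u (m - i))).
  rewrite [LHS](reindex_inj rev_ord_inj)/=; apply: eq_bigr => i _.
  by rewrite subSS subKn ?(mulrC (u i))// -ltnS.
have E1 (m : nat) : (\sum_(i < m.+1) (i%:R * (u i * u (m - i)))) *+ 2 =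
    m%:R * \sum_(i < m.+1) (u i * u (m - i)).
  transitivity (\sum_(i < m.+1) (i%:R * (u i * u (m - i))) + \sum_(i < m.+1) ((m - i)%:R * (u i * u (m - i)))).
    by rewrite -E mulr2n.
  rewrite -big_split/= mulr_sumr; apply: eq_bigr => i _.
  by rewrite -mulrDl -natrD subnKC// -ltnS.
(* the shift i -> i + 1 and the recurrence of u: (2i + 2) u_(i+1) = (2i + 1) u_i *)
have : n.+1%:R * s = n.+1%:R * \sum_(i < n.+1) u i * u (n - i).
  rewrite -E1 big_ord_recl/= mul0r add0r.
  rewrite -sumrMnl.
  transitivity ((\sum_(i < n.+1) (i%:R * (u i * u (n - i)))) *+ 2 + \sum_(i < n.+1) (u i * u (n - i))); last first.
    by rewrite E1 -[X in _ + X]mul1r -mulrDl -natr1.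
  rewrite -sumrMnl -big_split/=; apply: eq_bigr => i _.
  rewrite /bump/= add1n subSS.
  rewrite mulrA -mulrnAl arcsine_seqS.
  rewrite -natr1 -muln2 natrM; ring.
by rewrite ih mulr1 => /eqP; rewrite -subr_eq0 -{2}[n.+1%:R]mulr1 -mulrBr mulf_eq0 pnatr_eq0/= subr_eq0 => /eqP.
Qed.

(** A power series with nonnegative coefficients is determined by its square:
    the coefficient of index n + 1 of the square is 2 v_0 v_(n+1) plus a function
    of the earlier coefficients. *)
Lemma arcsine_seq_unique (v : nat -> R) :
  (forall n, 0 <= v n) -> (forall n, \sum_(i < n.+1) v i * v (n - i)%N = 1) ->
  forall n, v n = u n.
Proof.
move=> v0 vE n.
have v1 : v 0 = 1.
  have := vE 0; rewrite big_ord1/= subnn => /eqP; rewrite -expr2 sqrf_eq1 => /orP[/eqP//|/eqP vN].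
  by have := v0 0; rewrite vN oppr_ge0 ler10.
elim/ltn_ind: n => -[//|n] ih.
have := vE n.+1; rewrite -(arcsine_seq_conv n.+1).
rewrite big_ord_recl/= big_ord_recr/= [RHS]big_ord_recl/= [X in _ = _ + X]big_ord_recr/=.
rewrite /bump/= add1n subnn v1 !subn0.
under eq_bigr => i _.
  rewrite (ih (bump 0 i)) ?ltnS; last by rewrite /bump/= add1n.
  rewrite (ih (n.+1 - bump 0 i)%N) ?ltnS; last first.
    by rewrite /bump/= add1n subSS leq_subr.
  over.
rewrite [u 0]/(1) !mul1r !mulr1.
set b := \sum_(_ < n) _.
lra.
Qed.

(** The bound with 2n + 1 in place of n is what inductively passes through the
    recurrence, and it dominates the mesh functions [arcsine_step] uniformly. *)
Lemma arcsine_seq_le n : n.*2.+1%:R * u n ^+ 2 <= 1.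
Proof.
elim: n => [|n ih]; first by rewrite expr1n mulr1.
apply: le_trans ih.
have := arcsine_seqS n; have := arcsine_seq_gt0 n; have := arcsine_seq_gt0 n.+1.
set a := u n.+1; set b := u n => a0 b0 h.
have n0 : (0:R) <= n%:R by rewrite ler0n.
have E1 : n.+1%:R = n%:R + 1 :> R by rewrite natr1.
have E2 : n.*2.+1%:R = n%:R * 2 + 1 :> R by rewrite -natr1 -muln2 natrM.
have E3 : n.+1.*2.+1%:R = (n%:R + 1) * 2 + 1 :> R by rewrite -natr1 -muln2 natrM E1.
move: h; rewrite E1 E2 E3 => h.
have -> : a = (n%:R * 2 + 1) * b / (n%:R * 2 + 2).
  apply: (mulIf (x := n%:R * 2 + 2)); first by rewrite gt_eqF//; lra.
  rewrite mulfVK; last by rewrite gt_eqF//; lra.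
  lra.
have p0 : 0 < (n%:R * 2 + 2 : R) ^+ 2 by rewrite exprn_gt0//; lra.
rewrite expr_div_n exprMn mulrA ler_pdivrMr//.
rewrite -subr_ge0.
rewrite (_ : _ - _ = b ^+ 2 * (n%:R * 2 + 1)); last by ring.
by rewrite mulr_ge0 ?sqr_ge0//; lra.
Qed.

Lemma arcsine_seq_nondecreasing : nondecreasing_seq (fun k : nat => k%:R * u k ^+ 2).
Proof.
apply/nondecreasing_seqP => n.
have := arcsine_seqS n; have := arcsine_seq_gt0 n; have := arcsine_seq_gt0 n.+1.
set a := u n.+1; set b := u n => a0 b0 h.
have n0 : (0:R) <= n%:R by rewrite ler0n.
have E1 : n.+1%:R = n%:R + 1 :> R by rewrite natr1.
have E2 : n.*2.+1%:R = n%:R * 2 + 1 :> R by rewrite -natr1 -muln2 natrM.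
move: h; rewrite E1 E2 => h.
have -> : a = (n%:R * 2 + 1) * b / (n%:R * 2 + 2).
  apply: (mulIf (x := n%:R * 2 + 2)); first by rewrite gt_eqF//; lra.
  rewrite mulfVK; last by rewrite gt_eqF//; lra.
  lra.
have p0 : 0 < (n%:R * 2 + 2 : R) ^+ 2 by rewrite exprn_gt0//; lra.
rewrite expr_div_n exprMn [in leRHS]mulrA ler_pdivlMr//.
rewrite -subr_ge0.
rewrite (_ : _ - _ = b ^+ 2 * (n%:R + 1)); last by ring.
by rewrite mulr_ge0 ?sqr_ge0//; lra.
Qed.

Lemma arcsine_seq_le1 n : n%:R * u n ^+ 2 <= 1.
Proof.
apply: le_trans (arcsine_seq_le n); rewrite ler_wpM2r ?sqr_ge0// ler_nat.
by rewrite -addnn leqW// leq_addr.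
Qed.

(** Equal to 1/pi, see [arcsine_constE]. *)
Definition arcsine_const : R := limn (fun k : nat => k%:R * u k ^+ 2).

Lemma arcsine_const_cvg : (fun k : nat => k%:R * u k ^+ 2) @ \oo --> arcsine_const.
Proof.
apply: nondecreasing_is_cvgn; first exact: arcsine_seq_nondecreasing.
by exists 1 => _ [k _ <-]; exact: arcsine_seq_le1.
Qed.

Lemma arcsine_const_gt0 : 0 < arcsine_const.
Proof.
apply: (@lt_le_trans _ _ (1%:R * u 1 ^+ 2)).
  by rewrite mulr_gt0// exprn_gt0// arcsine_seq_gt0.
have := nondecreasing_cvgn_le arcsine_seq_nondecreasing.
by apply; exact/cvg_ex/ex_intro/arcsine_const_cvg.
Qed.

End arcsine_sequence.
Arguments arcsine_seq : simpl never.

(** * Integration against densities, images and products *)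

Section density.
Local Open Scope ereal_scope.
Context d (T : measurableType d) (R : realType).
Variables (m lam : {measure set T -> \bar R}) (p : T -> R).
Hypothesis mp : measurable_fun setT p.
Hypothesis p0 : forall x, (0 <= p x)%R.
Hypothesis mE : forall A, measurable A -> m A = \int[lam]_(x in A) (p x)%:E.

Import HBNNSimple.

(** Stated for an arbitrary measure that is given by a density on measurable
    sets, so that it applies to laws which are not defined as such integrals. *)
Lemma ge0_integral_density (f : T -> \bar R) : measurable_fun setT f ->
  (forall x, 0 <= f x) -> \int[m]_x f x = \int[lam]_x (f x * (p x)%:E).
Proof.
move=> mf f0; pose f_ := nnsfun_approx measurableT mf.
have f_f x : EFin (f_ n x) @[n --> \oo] --> f x.
  by apply: cvg_nnsfun_approx => // *; exact: f0.
have nd_f x : {homo (fun n => (f_ n x)%:E) : a b / (a <= b)%N >-> a <= b}.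
  by move=> a b ab; rewrite lee_fin; exact/lefP/nd_nnsfun_approx.
transitivity (limn (fun n => \int[m]_x (f_ n x)%:E)).
  rewrite -monotone_convergence//.
  - by apply: eq_integral => x _; apply/esym/cvg_lim => //; exact: f_f.
  - by move=> n; exact/measurable_EFinP/measurable_funTS.
  - by move=> n x _; rewrite lee_fin.
transitivity (limn (fun n => \int[lam]_x ((f_ n x)%:E * (p x)%:E))); last first.
  rewrite -monotone_convergence//.
  - apply: eq_integral => x _; apply/cvg_lim => //.
    by apply: cvgeZr.
  - by move=> n; apply: emeasurable_funM; apply/measurable_EFinP.
  - by move=> n x _; rewrite mule_ge0// lee_fin.
  - by move=> x _ a b ab; rewrite lee_wpmul2r// ?lee_fin//; exact: nd_f.
congr (limn _); apply/funext => n.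
transitivity (\sum_(k \in range (f_ n)) (k%:E * m (f_ n @^-1` [set k]))).
  by rewrite integralT_nnsfun sintegralE.
transitivity (\int[lam]_x (\sum_(k \in range (f_ n))
    (k%:E * ((\1_(f_ n @^-1` [set k]) x)%:E * (p x)%:E)))); last first.
  apply: eq_integral => x _; rewrite [in RHS]fimfunE -fsumEFin//.
  rewrite ge0_mule_fsuml//.
  - by under [RHS]eq_fsbigr do rewrite EFinM -muleA.
  - by move=> k; rewrite lee_fin; exact: nnfun_muleindic_ge0.
rewrite ge0_integral_fsum//.
- apply: eq_fsbigr => k _.
  have mk : measurable (f_ n @^-1` [set k]) by exact: measurable_sfunP.
  have [k0|k0] := leP 0%R k.
    rewrite ge0_integralZl//.
    + rewrite mE// integral_mkcond; congr (_ * _).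
      by apply: eq_integral => x _; rewrite patchE indicE; case: ifP => _; rewrite ?mul1e ?mul0e.
    + by apply: emeasurable_funM => //; apply/measurable_EFinP.
    + by move=> x _; rewrite mule_ge0 ?lee_fin.
  rewrite preimage_nnfun0// measure0 mule0 integral0_eq// => x _.
  by rewrite indic0 mul0e mule0.
- move=> k; apply: measurable_funeM; apply: emeasurable_funM; last exact/measurable_EFinP.
  by apply/measurable_EFinP/measurable_indic; exact: measurable_sfunP.
- move=> k x _; rewrite muleA mule_ge0 ?lee_fin//.
  exact: nnfun_muleindic_ge0.
Qed.

End density.

Section translation.
Context {R : realType}.
Notation mu := (@lebesgue_measure R).
Notation RM := (measurableTypeR R).

Lemma lebesgue_measure_translation (c : R) (A : set R) : measurable A ->
  pushforward mu (fun x : RM => (c + x) : RM) A = mu A.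
Proof.
move=> mA.
have mf : measurable_fun setT (fun x : RM => (c + x) : RM).
  exact: measurable_funD.
apply/esym/lebesgue_measure_unique => //= _ [[a b]] _ <-.
rewrite /pushforward.
have -> : [eta +%R c] @^-1` [set` `]a, b]] = [set` `]a - c, b - c]].
  by apply/seteqP; split => x /=; rewrite !in_itv/= ltrBlDl lerBrDl.
rewrite !lebesgue_measure_itv/= !lte_fin ltrD2r.
case: ifP => // _.
by rewrite -!EFinB; congr (_%:E); lra.
Qed.

Local Open Scope ereal_scope.

Lemma ge0_integral_translation (c : R) (f : R -> \bar R) :
  measurable_fun setT f -> (forall x, 0 <= f x) ->
  \int[mu]_x f (c + x)%R = \int[mu]_x f x.
Proof.
move=> mf f0.
have mt : measurable_fun setT (fun x : RM => (c + x)%R : RM).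
  exact: measurable_funD.
pose t : RM -> RM := fun x => (c + x)%R.
rewrite [RHS](eq_measure_integral (pushforward mu t))//; last first.
  by move=> A mA _; exact/esym/lebesgue_measure_translation.
by rewrite ge0_integral_pushforward.
Qed.

Lemma ge0_integral_reflection (f : R -> \bar R) :
  measurable_fun setT f -> (forall x, 0 <= f x) ->
  \int[mu]_x f (- x)%R = \int[mu]_x f x.
Proof.
move=> mf f0.
have mt : measurable_fun setT (fun x : RM => (- x)%R : RM).
  exact: measurable_funN.
pose t : RM -> RM := fun x => (- x)%R.
rewrite [RHS](eq_measure_integral (pushforward mu t))//; last first.
  by move=> A mA _; exact/esym/lebesgue_measureN.
by rewrite ge0_integral_pushforward.
Qed.

End translation.

Section cdf_unique.
Context {R : realType}.
Notation RM := (measurableTypeR R).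

Lemma finite_measure_eq_cdf (m1 m2 : {finite_measure set RM -> \bar R}) :
  (forall x : R, m1 `]-oo, x]%classic = m2 `]-oo, x]%classic) ->
  forall A, measurable A -> m1 A = m2 A.
Proof.
move=> h A mA.
pose G := [set A | exists x : R, A = `]-oo, x]%classic].
apply: (@measure_unique _ R RM G (fun k : nat => `]-oo, k%:R]%classic)) => //.
- rewrite [LHS]RGenOInfty.measurableE; apply/seteqP; split.
    apply: smallest_sub; first exact: smallest_sigma_algebra.
    move=> _ [x ->]; rewrite -[X in _ X]setCK.
    apply: (@measurableC _ (g_sigma_algebraType G)).
    by rewrite setCitvr; apply: sub_sigma_algebra; exists x.
  apply: smallest_sub; first exact: smallest_sigma_algebra.
  move=> _ [x ->]; rewrite -[X in _ X]setCK.
  apply: (@measurableC _ (g_sigma_algebraType (@RGenOInfty.G R))).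
  by rewrite setCitvl; apply: sub_sigma_algebra; exists x.
- move=> _ _ [x ->] [y ->]; exists (Num.min x y).
  by apply/seteqP; split => z /=; rewrite !in_itv/= le_min => /andP.
- by move=> i; exists i%:R.
- apply/seteqP; split => // x _; exists (Num.truncn `|x|).+1 => //=.
  by rewrite in_itv/= (le_trans (ler_norm x))// ltW// truncnS_gt.
- by move=> _ [x ->]; exact: h.
- by move=> k; rewrite ltey_eq fin_num_measure.
Qed.

End cdf_unique.
Section finite_image.
Context d1 d2 (T1 : measurableType d1) (T2 : measurableType d2) (R : realType).
Variables (m : {finite_measure set T1 -> \bar R}) (f : {mfun T1 >-> T2}).

Definition image_measure : set T2 -> \bar R := pushforward m f.

Let image0 : image_measure set0 = 0%E.
Proof. exact: measure0. Qed.
Let image_ge0 A : (0 <= image_measure A)%E.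
Proof. exact: measure_ge0. Qed.
Let image_sigma_additive : semi_sigma_additive image_measure.
Proof. exact: measure_semi_sigma_additive. Qed.
HB.instance Definition _ := isMeasure.Build _ _ _ image_measure image0 image_ge0 image_sigma_additive.
Let image_fin : fin_num_fun image_measure.
Proof. by move=> A mA; apply: fin_num_measure; rewrite -[X in measurable X]setTI; exact: measurable_funP. Qed.
HB.instance Definition _ := @Measure_isFinite.Build _ _ _ image_measure image_fin.

Lemma ge0_integral_image (h : T2 -> \bar R) : measurable_fun setT h ->
  (forall y, 0 <= h y)%E -> (\int[image_measure]_y h y = \int[m]_x h (f x))%E.
Proof. by move=> mh h0; rewrite ge0_integral_pushforward. Qed.
End finite_image.

Section finite_product.
Context d1 d2 (T1 : measurableType d1) (T2 : measurableType d2) (R : realType).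
Variables (m1 : {finite_measure set T1 -> \bar R}) (m2 : {finite_measure set T2 -> \bar R}).

Definition finite_prod : set (T1 * T2) -> \bar R := (m1 \x m2)%E.
HB.instance Definition _ := Measure.on finite_prod.
Let finite_prod_fin : fin_num_fun finite_prod.
Proof.
move=> A mA; rewrite ge0_fin_numE//.
apply: (@le_lt_trans _ _ (finite_prod setT)).
  by apply: le_measure; rewrite ?inE.
rewrite /finite_prod -setXTT product_measure1E// lte_mul_pinfty// ?fin_num_measure//.
by rewrite ltey_eq fin_num_measure.
Qed.
HB.instance Definition _ := @Measure_isFinite.Build _ _ _ finite_prod finite_prod_fin.

Lemma finite_prodE A B : measurable A -> measurable B ->
  finite_prod (A `*` B) = (m1 A * m2 B)%E.
Proof. exact: product_measure1E. Qed.

Lemma ge0_integral_finite_prod (h : T1 * T2 -> \bar R) :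
  measurable_fun setT h -> (forall y, 0 <= h y)%E ->
  (\int[finite_prod]_y h y = \int[m1]_x \int[m2]_y h (x, y))%E.
Proof. by move=> mh h0; rewrite /finite_prod fubini_tonelli1. Qed.

Lemma finite_prod_unique (m' : {measure set (T1 * T2) -> \bar R}) :
  (forall A B, measurable A -> measurable B -> m' (A `*` B) = m1 A * m2 B)%E ->
  forall X, measurable X -> m' X = finite_prod X.
Proof. by move=> h X mX; apply/esym/product_measure_unique. Qed.

End finite_product.

(** * Convolution of finite measures on the line *)

Section convolution.
Context {R : realType}.
Notation RM := (measurableTypeR R).

Definition addp (z : RM * RM) : RM := (z.1 + z.2)%R.
Lemma measurable_addp : measurable_fun setT addp.
Proof. exact: measurable_funD. Qed.
HB.instance Definition _ := isMeasurableFun.Build _ _ _ _ addp measurable_addp.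

Definition conv_def (m1 m2 : {finite_measure set RM -> \bar R}) : {finite_measure set RM -> \bar R} :=
  image_measure (finite_prod m1 m2) addp.
Definition conv := locked conv_def.
Definition restr_def (D : set RM) (mD : measurable D) (m : {finite_measure set RM -> \bar R}) : {finite_measure set RM -> \bar R} :=
  mrestr m mD.
Definition restr := locked restr_def.
Local Open Scope ereal_scope.
Implicit Types m : {finite_measure set RM -> \bar R}.

Lemma ge0_integral_conv m1 m2 (h : R -> \bar R) : measurable_fun setT h ->
  (forall x, 0 <= h x) ->
  \int[conv m1 m2]_x h x = \int[m1]_x \int[m2]_y h (x + y)%R.
Proof.
move=> mh h0; rewrite /conv -lock ge0_integral_image// ge0_integral_finite_prod//.
by apply: measurableT_comp => //; exact: measurable_addp.
Qed.

Lemma restrE (D : set RM) (mD : measurable D) m A : restr mD m A = m (A `&` D).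
Proof. by rewrite /restr -lock. Qed.

Lemma ge0_integral_restr (D : set RM) (mD : measurable D) m (h : R -> \bar R) :
  measurable_fun setT h -> (forall x, 0 <= h x) ->
  \int[restr mD m]_x h x = \int[m]_x (h x * (\1_D x)%:E).
Proof.
move=> mh h0; rewrite /restr -lock; apply: ge0_integral_density => //.
move=> A mA; rewrite integral_indic//.
by rewrite setIC.
Qed.

Lemma measure_integral_indic m (A : set RM) : measurable A ->
  m A = \int[m]_x (\1_A x)%:E.
Proof. by move=> mA; rewrite integral_indic// setIT. Qed.

Let mind (A : set RM) : measurable A -> measurable_fun setT (fun x : RM => (\1_A x : R)%:E).
Proof. by move=> mA; exact/measurable_EFinP/measurable_indic. Qed.

Lemma convE m1 m2 (A : set RM) : measurable A ->
  conv m1 m2 A = \int[m1]_x \int[m2]_y (\1_A (x + y)%R)%:E.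
Proof.
by move=> mA; rewrite measure_integral_indic// ge0_integral_conv//; exact: mind.
Qed.

Lemma eq_finite_measure_integral m1 m2 (h : R -> \bar R) :
  (forall A, measurable A -> m1 A = m2 A) -> \int[m1]_x h x = \int[m2]_x h x.
Proof. by move=> h12; apply: eq_measure_integral => A mA _; exact: h12. Qed.

Lemma convC m1 m2 (A : set RM) : measurable A -> conv m1 m2 A = conv m2 m1 A.
Proof.
move=> mA; rewrite !convE//.
rewrite (fubini_tonelli (m1 := m1) (m2 := m2) (fun z : RM * RM => (\1_A (z.1 + z.2)%R)%:E)); first last.
- by [].
- by apply: (measurableT_comp (mind mA)); exact: measurable_addp.
by under eq_integral do under eq_integral do rewrite addrC.
Qed.

Lemma measurable_conv_fun (h : R -> \bar R) : measurable_fun setT h ->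
  measurable_fun setT (fun z : RM * RM => h (z.1 + z.2)%R).
Proof. by move=> mh; apply: (measurableT_comp mh); exact: measurable_addp. Qed.

Lemma measurable_integral_conv m (h : R -> \bar R) : measurable_fun setT h ->
  (forall x, 0 <= h x) ->
  measurable_fun setT (fun x : RM => \int[m]_y h (x + y)%R).
Proof.
move=> mh h0.
apply: (measurable_fun_fubini_tonelli_F (m2 := m) (fun z : RM * RM => h (z.1 + z.2)%R)) => //.
exact: measurable_conv_fun.
Qed.

Lemma convA m1 m2 m3 (A : set RM) : measurable A ->
  conv m1 (conv m2 m3) A = conv (conv m1 m2) m3 A.
Proof.
move=> mA; rewrite (convE m1)// (convE (conv m1 m2))//.
rewrite (ge0_integral_conv _ _ (h := fun x => \int[m3]_y (\1_A (x + y)%R)%:E)).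
- apply: eq_integral => x _.
  rewrite (ge0_integral_conv _ _ (h := fun z => (\1_A (x + z)%R)%:E)).
  + by apply: eq_integral => y _; apply: eq_integral => z _; rewrite addrA.
  + by apply: (measurableT_comp (mind mA)); exact: measurable_funD.
  + by [].
- apply: (measurable_integral_conv m3 (mind mA)).
  by move=> x; rewrite lee_fin.
- by move=> x; apply: integral_ge0 => y _.
Qed.

Lemma eq_conv m1 m1' m2 m2' (A : set RM) : measurable A ->
  (forall A, measurable A -> m1 A = m1' A) ->
  (forall A, measurable A -> m2 A = m2' A) -> conv m1 m2 A = conv m1' m2' A.
Proof.
move=> mA h1 h2; rewrite !convE// (eq_finite_measure_integral _ h1).
by apply: eq_integral => x _; exact: eq_finite_measure_integral.
Qed.

Lemma conv_setT m1 m2 : conv m1 m2 setT = m1 setT * m2 setT.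
Proof.
rewrite /conv -lock -[LHS]/(finite_prod m1 m2 setT).
by rewrite -setXTT finite_prodE.
Qed.

Definition dirac0 : {finite_measure set RM -> \bar R} := \d_(0%R : RM).

Lemma conv_dirac0 m (A : set RM) : measurable A -> conv m dirac0 A = m A.
Proof.
move=> mA; rewrite convE//.
under eq_integral => x _.
  rewrite integral_dirac// ?diracT ?mul1e ?addr0; first over.
  by apply: (measurableT_comp (mind mA)); exact: measurable_funD.
by rewrite -measure_integral_indic.
Qed.

End convolution.

(** * Sparre Andersen's theorem *)

Section sparre_andersen.
Context {R : realType}.
Notation RM := (measurableTypeR R).
Local Open Scope ereal_scope.
Implicit Types m : {finite_measure set RM -> \bar R}.

Definition nnegR : set RM := `[0%R, +oo[%classic.
Definition negR : set RM := `]-oo, 0%R[%classic.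
Lemma measurable_nnegR : measurable nnegR. Proof. exact: measurable_itv. Qed.
Lemma measurable_negR : measurable negR. Proof. exact: measurable_itv. Qed.
Notation Rp := (restr measurable_nnegR).
Notation Rn := (restr measurable_negR).

Let split_sign m (A : set RM) : measurable A ->
  m A = m (A `&` nnegR) + m (A `&` negR).
Proof.
move=> mA; rewrite -measureU; first last.
- apply/seteqP; split => // x [[_ +] [_ +]].
  by rewrite /nnegR /negR/= !in_itv/= andbT leNgt => /negbTE ->.
- by apply: measurableI => //; exact: measurable_negR.
- by apply: measurableI => //; exact: measurable_nnegR.
rewrite -setIUr (_ : nnegR `|` negR = setT) ?setIT//.
apply/seteqP; split => // x _; rewrite /nnegR /negR/= !in_itv/= andbT.
by apply/orP; rewrite orbC ltNge orNb.
Qed.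

(** Restricting the factors to the half-lines makes the vanishing statements
    [conv_nnegR] and [conv_negR] applicable to one summand at a time. *)
Lemma conv_split m m' (A : set RM) : measurable A ->
  conv m m' A = conv (Rp m) m' A + conv (Rn m) m' A.
Proof.
move=> mA; rewrite !convE//.
have mi : measurable_fun setT (fun x : RM => (\1_A x : R)%:E).
  exact/measurable_EFinP/measurable_indic.
have mF := measurable_integral_conv m' mi (fun=> ltac:(by rewrite lee_fin)).
have F0 (x : RM) : 0 <= \int[m']_y (\1_A (x + y)%R)%:E by exact: integral_ge0.
have mE (D : set RM) : measurable D ->
    measurable_fun [set: RM] (fun x => (\1_D x : R)%:E).
  by move=> mD; exact/measurable_EFinP/measurable_indic.
rewrite !ge0_integral_restr// -ge0_integralD//.
- apply: eq_integral => x _; rewrite -ge0_muleDr ?lee_fin//.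
  rewrite -EFinD !indicE /nnegR /negR !mem_setE !in_itv/= andbT ltNge.
  by case: (0 <= x)%R; rewrite ?addr0 ?add0r mule1.
- by move=> x _; rewrite mule_ge0 ?lee_fin.
- by apply: emeasurable_funM => //; apply: mE; exact: measurable_nnegR.
- by move=> x _; rewrite mule_ge0 ?lee_fin.
- by apply: emeasurable_funM => //; apply: mE; exact: measurable_negR.
Qed.

Lemma conv_nnegR m m' (A : set RM) : measurable A ->
  conv (Rp m) (Rp m') (A `&` negR) = 0.
Proof.
move=> mA.
have mAD : measurable (A `&` negR) by apply: measurableI => //; exact: measurable_negR.
rewrite convE// (ge0_integral_restr _ _ (h := fun x => \int[Rp m']_y (\1_(A `&` negR) (x + y)%R)%:E)).
- apply: integral0_eq => x _.
  have mh : measurable_fun [set: R] (fun y : RM => (\1_(A `&` negR) (x + y)%R : R)%:E).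
    apply/measurable_EFinP; apply: (measurableT_comp (measurable_indic _)) => //.
    exact: measurable_funD.
  rewrite (ge0_integral_restr _ _ (h := fun y => (\1_(A `&` negR) (x + y)%R)%:E)) //.
  have [x0|x0] := boolP (x \in nnegR); last by rewrite [\1_nnegR x]indicE (negbTE x0) mule0.
  rewrite integral0_eq ?mul0e// => y _.
  have [y0|y0] := boolP (y \in nnegR); last by rewrite [\1_nnegR y]indicE (negbTE y0) mule0.
  rewrite indicE memNset ?mul0e//= => -[_].
  move: x0 y0; rewrite /nnegR /negR !inE/= !in_itv/= !andbT => x0 y0.
  by rewrite ltNge addr_ge0.
- apply: (measurable_integral_conv (Rp m') (h := fun x => (\1_(A `&` negR) x)%:E)) => [|x]; last by rewrite lee_fin.
  exact/measurable_EFinP/measurable_indic.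
- by move=> x; exact: integral_ge0.
Qed.

Lemma conv_negR m m' (A : set RM) : measurable A ->
  conv (Rn m) (Rn m') (A `&` nnegR) = 0.
Proof.
move=> mA.
have mAD : measurable (A `&` nnegR) by apply: measurableI => //; exact: measurable_nnegR.
rewrite convE// (ge0_integral_restr _ _ (h := fun x => \int[Rn m']_y (\1_(A `&` nnegR) (x + y)%R)%:E)).
- apply: integral0_eq => x _.
  have mh : measurable_fun [set: R] (fun y : RM => (\1_(A `&` nnegR) (x + y)%R : R)%:E).
    apply/measurable_EFinP; apply: (measurableT_comp (measurable_indic _)) => //.
    exact: measurable_funD.
  rewrite (ge0_integral_restr _ _ (h := fun y => (\1_(A `&` nnegR) (x + y)%R)%:E)) //.
  have [x0|x0] := boolP (x \in negR); last by rewrite [\1_negR x]indicE (negbTE x0) mule0.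
  rewrite integral0_eq ?mul0e// => y _.
  have [y0|y0] := boolP (y \in negR); last by rewrite [\1_negR y]indicE (negbTE y0) mule0.
  rewrite indicE memNset ?mul0e//= => -[_].
  move: x0 y0; rewrite /nnegR /negR !inE/= !in_itv/= !andbT => x0 y0.
  by rewrite leNgt -oppr_gt0 opprD addr_gt0// oppr_gt0.
- apply: (measurable_integral_conv (Rn m') (h := fun x => (\1_(A `&` nnegR) x)%:E)) => [|x]; last by rewrite lee_fin.
  exact/measurable_EFinP/measurable_indic.
- by move=> x; exact: integral_ge0.
Qed.

Variable nu : {finite_measure set RM -> \bar R}.

(** Law of the walk with step law nu at time k, on the event that its first k
    values are all nonnegative. *)
Fixpoint walk_nneg (k : nat) : {finite_measure set RM -> \bar R} :=
  if k is j.+1 then Rp (conv nu (walk_nneg j)) else dirac0.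
(** Law of the walk with step law nu at time k, on the event that its first k
    values are all negative. *)
Fixpoint walk_neg (k : nat) : {finite_measure set RM -> \bar R} :=
  if k is j.+1 then Rn (conv nu (walk_neg j)) else dirac0.

Local Notation a := walk_nneg.
Local Notation b := walk_neg.

(** One step of the walk sends a_k to a_(k+1) on [0, +oo[ and to some measure c
    carried by ]-oo, 0[; since c * b_j is also carried by ]-oo, 0[, the part on
    [0, +oo[ of nu * a_k * b_(j+1) only sees a_(k+1).  Symmetrically for b. *)
Lemma wiener_hopf_step k j (Y : set RM) : measurable Y ->
  conv nu (conv (a k) (b j.+1)) (Y `&` nnegR) +
  conv nu (conv (a k.+1) (b j)) (Y `&` negR) = conv (a k.+1) (b j.+1) Y.
Proof.
move=> mY.
have mYp : measurable (Y `&` nnegR) by apply: measurableI => //; exact: measurable_nnegR.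
have mYn : measurable (Y `&` negR) by apply: measurableI => //; exact: measurable_negR.
rewrite [RHS]split_sign//; congr (_ + _).
  rewrite convA// conv_split//= [X in _ + X](_ : _ = 0) ?adde0//.
  exact: conv_negR.
rewrite (eq_conv (m1' := nu) (m2' := conv (b j) (a k.+1)))//; last first.
  by move=> A mA; exact: convC.
rewrite convA// conv_split//= [X in X + _](_ : _ = 0) ?add0e; last first.
  exact: conv_nnegR.
exact: convC.
Qed.

Lemma wiener_hopf_nneg k (Y : set RM) : measurable Y ->
  conv nu (conv (a k) (b 0)) (Y `&` nnegR) = conv (a k.+1) (b 0) Y.
Proof.
move=> mY.
have mYp : measurable (Y `&` nnegR) by apply: measurableI => //; exact: measurable_nnegR.
by rewrite convA// !conv_dirac0//= restrE.
Qed.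

Lemma wiener_hopf_neg k (Y : set RM) : measurable Y ->
  conv nu (conv (a 0) (b k)) (Y `&` negR) = conv (a 0) (b k.+1) Y.
Proof.
move=> mY.
have mYp : measurable (Y `&` negR) by apply: measurableI => //; exact: measurable_negR.
rewrite (convC (a 0))// [RHS]conv_dirac0//.
rewrite (eq_conv (m1' := nu) (m2' := conv (b k) (a 0)))//; last first.
  by move=> A mA; exact: convC.
by rewrite convA// conv_dirac0//= restrE.
Qed.

(** Joint law of the number k of nonnegative values among the first n and of the
    last value: it factors as if k steps of a walk kept nonnegative were followed
    by n - k steps of a walk kept negative.  The family rho is characterized by
    the dynamics of this pair, and [wiener_hopf_step] says that the convolutions
    satisfy the same recursion. *)
Lemma sparre_andersen_law (rho : nat -> nat -> {finite_measure set RM -> \bar R}) :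
  (forall Y, measurable Y -> rho 0%N 0%N Y = dirac0 Y) ->
  (forall n k Y, (n < k)%N -> measurable Y -> rho n k Y = 0) ->
  (forall n Y, measurable Y -> rho n.+1 0%N Y = conv nu (rho n 0%N) (Y `&` negR)) ->
  (forall n k Y, measurable Y -> rho n.+1 k.+1 Y =
    conv nu (rho n k) (Y `&` nnegR) + conv nu (rho n k.+1) (Y `&` negR)) ->
  forall n k Y, (k <= n)%N -> measurable Y -> rho n k Y = conv (a k) (b (n - k)%N) Y.
Proof.
move=> h00 h0 hn0 hS; elim=> [[|//]|n ih [|k]] Y kn mY.
- by rewrite h00// conv_dirac0.
- rewrite hn0// subn0 -wiener_hopf_neg//; apply: eq_conv => //.
    by apply: measurableI => //; exact: measurable_negR.
  by move=> A mA; rewrite ih// subn0.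
- rewrite hS// subSS.
  have mYp : measurable (Y `&` nnegR) by apply: measurableI => //; exact: measurable_nnegR.
  have mYn : measurable (Y `&` negR) by apply: measurableI => //; exact: measurable_negR.
  move: (kn); rewrite ltnS leq_eqVlt => /predU1P[kE|{}kn'].
    rewrite kE subnn -wiener_hopf_nneg// [X in _ + X](_ : _ = 0).
      by rewrite adde0; apply: eq_conv => // A mA; rewrite ih// ?subnn// kE.
    rewrite (convC nu)// convE// (eq_finite_measure_integral (m2 := mzero))//.
      by rewrite integral_measure_zero.
    by move=> A mA; rewrite h0.
  rewrite -[in RHS](subnSK kn') -wiener_hopf_step//; congr (_ + _).
    by apply: eq_conv => // A mA; rewrite ih ?(subnSK kn').
  by apply: eq_conv => // A mA; rewrite ih.
Qed.

Hypothesis nu_sym : forall A, measurable A -> nu ((-%R : RM -> RM) @^-1` A) = nu A.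
Hypothesis nu_atomless : forall x : R, nu [set x] = 0.

Lemma measurable_oppR (A : set RM) : measurable A ->
  measurable ((-%R : RM -> RM) @^-1` A).
Proof.
move=> mA; rewrite -[X in measurable X]setTI.
by apply: (measurable_funN (@measurable_id _ RM setT)).
Qed.

Let conv_opp m m' (A : set RM) : measurable A ->
  (forall A, measurable A -> m ((-%R : RM -> RM) @^-1` A) = m' A) ->
  conv nu m ((-%R : RM -> RM) @^-1` A) = conv nu m' A.
Proof.
have mo : measurable_fun setT (-%R : RM -> RM).
  exact: (measurable_funN (@measurable_id _ RM setT)).
have E (m1 m2 : {finite_measure set RM -> \bar R}) (h : R -> \bar R) :
    (forall A, measurable A -> m1 ((-%R : RM -> RM) @^-1` A) = m2 A) ->
    measurable_fun setT h -> (forall x, 0 <= h x) ->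
    \int[m1]_x h (- x)%R = \int[m2]_x h x.
  move=> h12 mh h0.
  rewrite [RHS](eq_measure_integral (pushforward m1 (-%R : RM -> RM)))//.
    by rewrite ge0_integral_pushforward.
  by move=> B mB _; apply/esym; exact: h12.
move=> mA h; rewrite !convE//; last exact: measurable_oppR.
have mi : measurable_fun setT (fun x : RM => (\1_A x : R)%:E).
  exact/measurable_EFinP/measurable_indic.
rewrite -[RHS](E nu nu _ nu_sym).
- apply: eq_integral => x _; rewrite -[RHS](E m m' _ h)//.
    by apply: eq_integral => y _; rewrite -opprD.
  by apply: (measurableT_comp mi); exact: measurable_funD.
- apply: (measurable_integral_conv m' mi).
  by move=> x; rewrite lee_fin.
- by move=> x; exact: integral_ge0.
Qed.

Let conv_atomless m (x : R) : conv nu m [set x] = 0.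
Proof.
have mx : @measurable _ RM [set x] by exact: measurable_set1.
rewrite convC// convE//; apply: integral0_eq => y _.
transitivity (\int[nu]_z (\1_[set (x - y)%R] z)%:E).
  apply: eq_integral => z _; rewrite !indicE; congr ((_ : bool)%:R%:E).
  apply/idP/idP; rewrite !inE => zE; first by rewrite /= -zE; ring.
  by rewrite zE/=; ring.
rewrite -measure_integral_indic ?nu_atomless//.
Qed.

(** Reflecting the walk exchanges positive and negative values; strict and weak
    inequalities agree because nu has no atom, hence neither has the law of any
    later position. *)
Lemma walk_neg_opp k (A : set RM) : measurable A ->
  a k ((-%R : RM -> RM) @^-1` A) = b k A.
Proof.
elim: k A => [|k ih] A mA.
  rewrite /= /dirac0/= !diracE; congr ((_ : bool)%:R%:E).
  by apply/idP/idP; rewrite !inE/= oppr0.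
rewrite /= !restrE.
have mAn : measurable (A `&` negR) by apply: measurableI => //; exact: measurable_negR.
have mA0 : @measurable _ RM (A `&` [set 0%R]) by apply: measurableI => //; exact: measurable_set1.
have -> : (-%R : RM -> RM) @^-1` A `&` nnegR =
    (-%R : RM -> RM) @^-1` ((A `&` negR) `|` (A `&` [set 0%R])).
  apply/seteqP; split => x /=; rewrite /nnegR /negR/= !in_itv/= !andbT.
    move=> [Ax]; rewrite le_eqVlt => /predU1P[x0|x0].
      by right; split => //; rewrite -x0 oppr0.
    by left; rewrite oppr_lt0.
  move=> [[Ax x0]|[Ax /eqP x0]]; split => //; first by rewrite ltW// -oppr_lt0.
  by rewrite oppr_eq0 in x0; rewrite (eqP x0).
rewrite (conv_opp (m' := b k))//; last exact: measurableU.
rewrite measureU//.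
  rewrite [X in _ + X](_ : _ = 0) ?adde0//; apply/eqP; rewrite eq_le measure_ge0 andbT.
  rewrite -(conv_atomless (b k) 0%R) le_measure ?inE//.
apply/seteqP; split => // x [[_]]; rewrite /negR/= in_itv/= => x0 [_ xE].
by rewrite xE ltxx in x0.
Qed.

Lemma walk_mass_sym k : a k setT = b k setT.
Proof. by rewrite -walk_neg_opp// preimage_setT. Qed.

(** By symmetry the masses of a_k and b_k are the same number v_k, and since
    the counts have total probability 1, sum_k v_k v_(n-k) = 1 for all n.  By
    uniqueness v is the sequence u: the law does not depend on nu. *)
Lemma sparre_andersen (rho : nat -> nat -> {finite_measure set RM -> \bar R}) :
  (forall Y, measurable Y -> rho 0%N 0%N Y = dirac0 Y) ->
  (forall n k Y, (n < k)%N -> measurable Y -> rho n k Y = 0) ->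
  (forall n Y, measurable Y -> rho n.+1 0%N Y = conv nu (rho n 0%N) (Y `&` negR)) ->
  (forall n k Y, measurable Y -> rho n.+1 k.+1 Y =
    conv nu (rho n k) (Y `&` nnegR) + conv nu (rho n k.+1) (Y `&` negR)) ->
  (forall n, \sum_(k < n.+1) rho n k setT = 1) ->
  forall n k, (k <= n)%N ->
    rho n k setT = (arcsine_seq k * arcsine_seq (n - k))%:E.
Proof.
move=> h00 h0 hn0 hS h1.
have rhoE := sparre_andersen_law h00 h0 hn0 hS.
have rhoT n k : (k <= n)%N -> rho n k setT = (fine (a k setT) * fine (a (n - k)%N setT))%:E.
  by move=> kn; rewrite rhoE// conv_setT -walk_mass_sym EFinM !fineK//; exact: fin_num_measure.
have aE : forall k, fine (a k setT) = arcsine_seq k.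
  apply: arcsine_seq_unique => n; first by rewrite fine_ge0.
  apply: EFin_inj; rewrite -(h1 n) -sumEFin; apply: eq_bigr => i _.
  by rewrite rhoT// -ltnS.
by move=> n k kn; rewrite rhoT// !aE.
Qed.

End sparre_andersen.

(** * Chains driven by independent inputs *)

Section product_uniqueness.
Context d1 d2 (T1 : measurableType d1) (T2 : measurableType d2) (R : realType).

Definition mk_mfun (f : T1 -> T2) (mf : measurable_fun setT f) : {mfun T1 >-> T2} :=
  HB.pack f (isMeasurableFun.Build _ _ _ _ f mf).

(** Law of f under m, with the measurability proof as an argument to avoid
    declaring each random variable as a bundled measurable function. *)
Definition law (m : {finite_measure set T1 -> \bar R}) (f : T1 -> T2) (mf : measurable_fun setT f) :
  {finite_measure set T2 -> \bar R} := image_measure m (mk_mfun mf).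

Lemma lawE m f mf A : @law m f mf A = m (f @^-1` A). Proof. by []. Qed.

Lemma ge0_integral_law m f mf (h : T2 -> \bar R) : measurable_fun setT h ->
  (forall y, 0 <= h y)%E -> (\int[@law m f mf]_y h y = \int[m]_x h (f x))%E.
Proof. exact: ge0_integral_image. Qed.

Lemma finite_measure_eq_pi (K : set (set T2)) (m1 m2 : {finite_measure set T2 -> \bar R}) :
  measurable = <<s K >> -> setI_closed K -> K setT ->
  (forall B, K B -> m1 B = m2 B) -> forall Z, measurable Z -> m1 Z = m2 Z.
Proof.
move=> KE KI KT h Z mZ; apply: (measure_unique K (fun=> setT)) => //.
- by apply/seteqP; split => // x _; exists 0%N.
- by move=> k; rewrite ltey_eq fin_num_measure.
Qed.

End product_uniqueness.

Section product_uniqueness2.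
Context d1 d2 (T1 : measurableType d1) (T2 : measurableType d2) (R : realType).

(** Only the second factor is tested on a pi-system: this is the form needed when
    independence of the inputs is known on generators. *)
Lemma product_measure_eq_pi (K : set (set T2)) (m1 m2 : {finite_measure set (T1 * T2)%type -> \bar R}) :
  measurable = <<s K >> -> setI_closed K -> K setT ->
  (forall A B, measurable A -> K B -> m1 (A `*` B) = m2 (A `*` B)) ->
  forall Z, measurable Z -> m1 Z = m2 Z.
Proof.
move=> KE KI KT h.
have h' A B : measurable A -> measurable B -> m1 (A `*` B) = m2 (A `*` B).
  move=> mA mB.
  have mAT : measurable (A `*` [set: T2]) by exact: measurableX.
  pose r (m : {finite_measure set (T1 * T2)%type -> \bar R}) :
    {finite_measure set (T1 * T2)%type -> \bar R} := mrestr m mAT.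
  have E (m : {finite_measure set (T1 * T2)%type -> \bar R}) B' : m (A `*` B') = law (r m) (@measurable_snd _ _ T1 T2) B'.
    rewrite lawE /r/= /mrestr; congr (m _).
    by apply/seteqP; split => -[x y] /=; [move=> [? ?]|move=> [? [? ?]]].
  rewrite !E; apply: (finite_measure_eq_pi KE KI KT) mB.
  by move=> B' KB'; rewrite -!E; exact: h.
apply: (finite_measure_eq_pi (K := [set A `*` B | A in measurable & B in measurable])).
- exact: measurable_prod_measurableType.
- move=> _ _ [A mA [B mB <-]] [A' mA' [B' mB' <-]].
  exists (A `&` A'); first exact: measurableI.
  exists (B `&` B'); first exact: measurableI.
  by rewrite setXI.
- by exists setT => //; exists setT => //; rewrite setXTT.
- by move=> _ [A mA [B mB <-]]; exact: h'.
Qed.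

End product_uniqueness2.

Section chain.
Context {R : realType} d (Omega : measurableType d) (P : probability Omega R).
Context dT (T : measurableType dT) (dU : nat -> measure_display) (U : forall n, measurableType (dU n)).
Variables (K : forall n, set (set (U n))).
Arguments K : clear implicits.
Hypothesis KE : forall n, measurable = <<s K n >>.
Hypothesis KI : forall n, setI_closed (K n).
Hypothesis KT : forall n, K n setT.
Variables (xi : forall n, Omega -> U n) (mxi : forall n, measurable_fun setT (@xi n)).
Arguments xi : clear implicits.
Hypothesis xi_indep : forall N (C : forall n, set (U n)), (forall n, K n (C n)) ->
  P [set w | forall i, (i < N)%N -> C i (xi i w)] = (\prod_(0 <= i < N) P (xi i @^-1` C i))%E.
Variables (step : forall n, T * U n -> T) (mstep : forall n, measurable_fun setT (@step n)).
Arguments step : clear implicits.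
Variables (X : nat -> Omega -> T) (x0 : T).
Hypothesis X0 : forall w, X 0%N w = x0.
Hypothesis XS : forall n w, X n.+1 w = step n (X n w, xi n w).

Lemma measurable_chain n : measurable_fun setT (X n).
Proof.
elim: n => [|n ih].
  by rewrite (_ : X 0%N = cst x0)//; apply/funext => w; rewrite X0.
rewrite (_ : X n.+1 = step n \o (fun w => (X n w, xi n w))); last first.
  by apply/funext => w; rewrite XS.
apply: measurableT_comp => //.
exact: measurable_fun_pair.
Qed.

(** The state at time n depends on the inputs of index < n, so it is independent
    of the later ones.  The future inputs are kept in the statement to make the
    induction work: the step from n to n + 1 uses that (X_n, xi_n) is independent
    of the inputs of index > n, which two applications of the induction
    hypothesis give on rectangles. *)
Lemma chain_indep n N (C : forall n, set (U n)) A : (forall n, K n (C n)) -> measurable A ->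
  (P (X n @^-1` A `&` [set w | forall i, (n <= i < N)%N -> C i (xi i w)]) =
  P (X n @^-1` A) * \prod_(n <= i < N) P (xi i @^-1` C i))%E.
Proof.
have mxK (C' : forall n, set (U n)) i : (forall n, K n (C' n)) -> measurable (xi i @^-1` C' i).
  move=> KC; rewrite -[X in measurable X]setTI; apply: mxi => //.
  by rewrite KE; apply: sub_sigma_algebra; exact: KC.
have mK (C' : forall n, set (U n)) (n' N' : nat) : (forall n, K n (C' n)) ->
    measurable [set w | forall i, (n' <= i < N')%N -> C' i (xi i w)].
  move=> KC.
  rewrite (_ : [set w | _] = \bigcap_(i in [set i | (n' <= i < N')%N]) (xi i @^-1` C' i))//.
  by apply: bigcap_measurableType => i _; exact: mxK.
elim: n N C A => [|n ih] N C A KC mA.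
  have [x0A|x0A] := pselect (A x0).
    rewrite (_ : X 0%N @^-1` A = setT); last first.
      by apply/seteqP; split => // w _ /=; rewrite X0.
    rewrite setTI probability_setT mul1e.
    by rewrite -xi_indep//; congr (P _); apply/seteqP; split.
  rewrite (_ : X 0%N @^-1` A = set0); last first.
    by apply/seteqP; split => // w /=; rewrite X0.
  by rewrite set0I measure0 mul0e.
have [nN|Nn] := ltnP n.+1 N; last first.
  rewrite big_geq// mule1; congr (P _).
  by rewrite setIidl// => w _ i /andP[ni iN]; have := leq_trans iN Nn; rewrite ltnNge ni.
set F := [set w | _]; set c := (\prod_(n.+1 <= i < N) _)%E.
have mF' : measurable F by exact: mK.
have mxC i := mxK C i KC.
have c0 : (0 <= c)%E by apply: prode_ge0 => i _.
have cfin : c \is a fin_num.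
  by apply: prode_fin_num => i _; exact: fin_num_measure.
have mXU : measurable_fun setT (fun w => (X n w, xi n w)).
  by apply: measurable_fun_pair => //; exact: measurable_chain.
(* restricting P to the future event F only multiplies the law of (X_n, xi_n) by
   the constant P F = c *)
pose PF : {finite_measure set Omega -> \bar R} := mrestr P mF'.
have fc0 : 0 <= fine c by exact: fine_ge0.
pose cP : {finite_measure set Omega -> \bar R} := mscale (NngNum fc0) P.
have key Z : measurable Z -> law PF mXU Z = law cP mXU Z.
  apply: (product_measure_eq_pi (@KE n) (@KI n) (@KT n)) => // B D mB KD.
  have KC' i : K i (@eqtype.dfwith _ (fun i => set (U i)) C n D i) by case: eqtype.dfwithP.
  have E N' : (n < N')%N -> P [set w | (B (X n w) /\ D (xi n w)) /\ forall i, (n < i < N')%N -> C i (xi i w)] =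
      (P (X n @^-1` B) * (P (xi n @^-1` D) * \prod_(n.+1 <= i < N') P (xi i @^-1` C i)))%E.
    move=> nN'; transitivity (P (X n @^-1` B `&`
       [set w | forall i, (n <= i < N')%N -> @eqtype.dfwith _ (fun i => set (U i)) C n D i (xi i w)])).
      congr (P _); apply/seteqP; split => w /=.
        move=> [[BX Dxi] h]; split => // i /andP[]; rewrite leq_eqVlt => /predU1P[<-|ni] iN.
          by rewrite eqtype.dfwith_in.
        by rewrite eqtype.dfwith_out ?ltn_eqF//; apply: h; rewrite ni.
      move=> [BX h]; split.
        by split => //; have := h n; rewrite leqnn nN' eqtype.dfwith_in; exact.
      by move=> i /andP[ni iN]; have := h i; rewrite ltnW// iN eqtype.dfwith_out ?ltn_eqF//; exact.
    rewrite ih// big_ltn// eqtype.dfwith_in; congr (_ * (_ * _))%E.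
    apply: eq_big_nat => i /andP[ni _].
    by rewrite eqtype.dfwith_out// ltn_eqF.
  rewrite !lawE /PF /cP/= /mrestr /mscale/=.
  transitivity (P [set w | (B (X n w) /\ D (xi n w)) /\ forall i, (n < i < N)%N -> C i (xi i w)]).
    by congr (P _).
  rewrite (E N) 1?ltnW// (_ : P (_ @^-1` (B `*` D)) = P (X n @^-1` B) * P (xi n @^-1` D))%E; last first.
    have := E n.+1; rewrite big_geq// mule1 ltnSn => <-//.
    congr (P _); apply/seteqP; split => w /=; last by case.
    by move=> ?; split => // i /andP[ni]; rewrite ltnS leqNgt ni.
  by rewrite fineK// muleA muleC.
have mAs : measurable (step n @^-1` A) by rewrite -[X in measurable X]setTI; exact: mstep.
have := key _ mAs; rewrite !lawE /PF /cP/= /mrestr /mscale/= fineK// => h.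
rewrite (_ : X n.+1 @^-1` A = (fun w => (X n w, xi n w)) @^-1` (step n @^-1` A)); last first.
  by apply/seteqP; split => w /=; rewrite XS.
by rewrite h muleC.
Qed.

Lemma chain_law n Z : measurable Z ->
  P [set w | Z (X n w, xi n w)] =
  finite_prod (law P (measurable_chain n)) (law P (@mxi n)) Z.
Proof.
move=> mZ.
have mXU : measurable_fun setT (fun w => (X n w, xi n w)).
  by apply: measurable_fun_pair => //; exact: measurable_chain.
rewrite -[LHS]/(law P mXU Z).
apply: (product_measure_eq_pi (@KE n) (@KI n) (@KT n)) => // A B mA KB.
have mB : measurable B by rewrite KE; exact: sub_sigma_algebra.
rewrite [RHS](finite_prodE _ _ mA mB) !lawE.
have KC i : K i (@eqtype.dfwith _ (fun i => set (U i)) (fun i => setT) n B i) by case: eqtype.dfwithP.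
have := @chain_indep n n.+1 _ A KC mA; rewrite big_nat1 eqtype.dfwith_in => <-.
congr (P _); apply/seteqP; split => w /= [XA].
  move=> xB; split => // i; rewrite ltnS -eqn_leq => /eqP <-.
  by rewrite eqtype.dfwith_in.
move=> /(_ n); rewrite leqnn ltnSn eqtype.dfwith_in => h; split => //; exact: h.
Qed.

Lemma ge0_integral_chain n (h : T * U n -> \bar R) : measurable_fun setT h ->
  (forall z, 0 <= h z)%E ->
  (\int[P]_w h (X n w, xi n w) =
   \int[law P (measurable_chain n)]_x \int[law P (@mxi n)]_u h (x, u))%E.
Proof.
move=> mh h0.
have mXU : measurable_fun setT (fun w => (X n w, xi n w)).
  by apply: measurable_fun_pair => //; exact: measurable_chain.
rewrite -ge0_integral_finite_prod// -(ge0_integral_law P mXU)//.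
by apply: eq_measure_integral => A mA _; exact: chain_law.
Qed.

End chain.

(** * Joint measurability and occupation times *)

Section countable_pick.
Context d d' (Z : measurableType d) (Y : measurableType d').

Lemma measurable_fun_pick (k : Z -> nat) (F : nat -> Z -> Y) :
  (forall n, measurable [set z | k z = n]) -> (forall n, measurable_fun setT (F n)) ->
  measurable_fun setT (fun z => F (k z) z).
Proof.
move=> mk mF _ B mB; rewrite setTI.
rewrite (_ : _ @^-1` B = \bigcup_n ([set z | k z = n] `&` F n @^-1` B)); last first.
  apply/seteqP; split => z /=; first by move=> FB; exists (k z).
  by move=> [n _ [/= ->]].
apply: bigcupT_measurable => n; apply: measurableI => //.
by rewrite -[X in measurable X]setTI; exact: mF.
Qed.

End countable_pick.

Section grid.
Context {R : realType}.
Notation RM := (measurableTypeR R).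

(** Right endpoint of the mesh interval of length h that contains t, or h for
    t < 0; it is > max 0 t, so that only right limits are taken at time 0. *)
Definition grid (h t : R) : R := (Num.truncn (t / h)).+1%:R * h.

Lemma grid_gt h t : 0 < h -> Num.max 0 t < grid h t.
Proof.
move=> h0; rewrite gt_max /grid mulr_gt0// -ltr_pdivrMr//.
exact: truncnS_gt.
Qed.

Lemma grid_le h t : 0 < h -> grid h t <= Num.max 0 t + h.
Proof.
move=> h0; rewrite /grid -natr1 mulrDl mul1r lerD2r le_max.
have [t0|t0] := leP 0 t; last first.
  rewrite (_ : Num.truncn _ = 0%N) ?mul0r ?lexx//.
  by apply/truncn0Pn; rewrite -ltNge (lt_trans _ (@ltr01 R))// pmulr_llt0// invr_gt0.
apply/orP; right; rewrite -ler_pdivlMr//.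
by have /andP[] := truncn_itv (divr_ge0 t0 (ltW h0)).
Qed.

Lemma grid_cvg (h : nat -> R) t : (forall n, 0 < h n) -> h @ \oo --> (0:R) ->
  (fun n => grid (h n) t) @ \oo --> Num.max 0 t.
Proof.
move=> h0 hc; apply: (@squeeze_cvgr _ _ _ _ (cst (Num.max 0 t)) (fun n => Num.max 0 t + h n)).
- by apply: nearW => n; rewrite grid_le// andbT ltW// grid_gt.
- exact: cvg_cst.
- by rewrite -[X in _ --> X]addr0; apply: cvgD => //; exact: cvg_cst.
Qed.

Lemma measurable_truncn_div (h : R) n : 0 < h ->
  measurable [set t : RM | Num.truncn (t / h) = n].
Proof.
move=> h0; have [->|n0] := eqVneq n 0%N.
  rewrite (_ : [set t | _] = `]-oo, h[%classic); first exact: measurable_itv.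
  apply/seteqP; split => t /=; rewrite in_itv/=.
    by move/truncn0Pn; rewrite -ltNge ltr_pdivrMr// mul1r.
  by move=> th; apply/truncn0Pn; rewrite -ltNge ltr_pdivrMr// mul1r.
rewrite (_ : [set t | _] = `[n%:R * h, n.+1%:R * h[%classic); first exact: measurable_itv.
apply/seteqP; split => t /=; rewrite in_itv/= -ler_pdivlMr// -ltr_pdivrMr//.
  move=> tn; have t0 : 0 <= t / h.
    rewrite leNgt; apply/negP => t0; move: n0; rewrite -tn => /eqP; apply.
    by apply/truncn0Pn; rewrite -ltNge (lt_trans t0).
  by rewrite -truncn_eq// tn.
by move=> /truncn_def.
Qed.

End grid.

Section joint_measurability.
Context {R : realType} d (Omega : measurableType d).
Notation RM := (measurableTypeR R).

(** A path continuous on [0, +oo[ is the limit of its values on finer grids.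
    Taking max 0 t extends the process to all real times, which avoids
    restricting the product sigma-algebra to nonnegative times. *)
Lemma measurable_continuous_process (X : R -> Omega -> R) :
  (forall t, 0 <= t -> measurable_fun setT (X t)) ->
  (forall w, {within `[0, +oo[, continuous (fun t => X t w)}) ->
  measurable_fun setT (fun z : RM * Omega => X (Num.max 0 z.1) z.2).
Proof.
move=> mX cX.
pose h (n : nat) : R := n.+1%:R^-1.
have h0 n : 0 < h n by rewrite invr_gt0.
have hc : h @ \oo --> (0:R) by exact: cvg_harmonic.
apply: (measurable_fun_cvg (h := fun n (z : RM * Omega) => X (grid (h n) z.1) z.2)).
  move=> n.
  apply: (measurable_fun_pick (k := fun z : RM * Omega => Num.truncn (z.1 / h n))
    (F := fun j z => X (j.+1%:R * h n) z.2)).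
    move=> j; rewrite (_ : [set z | _] = [set t : RM | Num.truncn (t / h n) = j] `*` setT).
      by apply: measurableX => //; exact: measurable_truncn_div.
    by apply/seteqP; split => z /= => [|[]].
  move=> j; apply: measurableT_comp => //.
  by apply: mX; rewrite mulr_ge0// ltW.
move=> [t w] _ /=.
have := cX w => /continuous_within_itvcyP[c0 c1].
set m := Num.max 0 t.
have m0 : 0 <= m by rewrite le_max lexx.
have gc : (fun n => grid (h n) t) @ \oo --> m by exact: grid_cvg.
move: m0; rewrite le_eqVlt => /predU1P[m0|m0].
  (* at time 0 the path is only right-continuous, and the grid lies to the right *)
  rewrite -m0 in gc *.
  move/cvg_at_rightP : c1; apply; split => // n.
  by rewrite m0; exact: grid_gt.
apply: (cvg_comp _ (fun u => X u w)); first exact: gc.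
by apply: c0; rewrite in_itv/= m0.
Qed.

Variable X : R -> Omega -> R.
Hypothesis mX : measurable_fun setT (fun z : RM * Omega => X (Num.max 0 z.1) z.2).

Notation mu := (@lebesgue_measure R).

(** The pairs ((l, w), t) such that t is a time of [0, l] counted for w; a section
    of this measurable set is integrated to get the occupation time. *)
Definition positive_set : set ((RM * Omega) * RM) :=
  [set z | (0 <= z.2 <= z.1.1) /\ 0 <= X (Num.max 0 z.2) z.1.2].

Lemma measurable_positive_set : measurable positive_set.
Proof.
have mge0 (f : (RM * Omega) * RM -> R) : measurable_fun setT f -> measurable [set z | 0 <= f z].
  move=> mf; rewrite (_ : [set z | _] = f @^-1` `[0, +oo[%classic).
    by rewrite -[X in measurable X]setTI; apply: mf => //; exact: measurable_itv.
  by apply/seteqP; split => z /=; rewrite in_itv/= andbT.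
have m2 : measurable_fun setT (fun z : (RM * Omega) * RM => z.2 : R) by exact: measurable_snd.
have m11 : measurable_fun setT (fun z : (RM * Omega) * RM => z.1.1 : R).
  exact: measurableT_comp.
rewrite (_ : positive_set = [set z | 0 <= z.2] `&` [set z | 0 <= z.1.1 - z.2] `&`
  [set z | 0 <= X (Num.max 0 z.2) z.1.2]).
  apply: measurableI; first apply: measurableI.
  - exact: mge0.
  - by apply: mge0; exact: measurable_funB.
  - apply: (mge0 (fun z => X (Num.max 0 z.2) z.1.2)).
    pose g (z : (RM * Omega) * RM) : RM * Omega := (z.2, z.1.2).
    have mg : measurable_fun setT g.
      by apply: measurable_fun_pair => //; exact: measurableT_comp.
    exact: (measurableT_comp mX mg).
apply/seteqP; split => z; rewrite /positive_set/= subr_ge0.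
  by move=> [/andP[-> ->] ->].
by move=> [[-> ->] ->].
Qed.

Lemma occupation_timeE (l : R) w :
  occupation_time X l w = fine (\int[mu]_t (\1_positive_set ((l, w), t))%:E).
Proof.
rewrite /occupation_time /Rintegral [in LHS]integral_mkcond; congr fine.
apply: eq_integral => t _; rewrite patchE !indicE.
have -> : (((l, w), t) \in positive_set) = (t \in `[0, l]) && (0 <= X (Num.max 0 t) w).
  rewrite in_itv/=; apply/idP/idP; rewrite inE /positive_set/=.
    by move=> [-> ->].
  by move=> /andP[-> ->].
rewrite mem_setE; have [|//] := boolP (t \in `[0, l]).
rewrite in_itv/= => /andP[t0 _].
by rewrite (max_idPr t0) mem_setE in_itv/= andbT.
Qed.

Lemma measurable_positive_section (l : R) w :
  measurable_fun setT (fun t : RM => (\1_positive_set ((l, w), t) : R)%:E).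
Proof.
apply/measurable_EFinP.
have mg : measurable_fun setT (fun t : RM => ((l, w), t) : (RM * Omega) * RM).
  exact: measurable_fun_pair.
rewrite (_ : (fun _ => _) = (\1_positive_set : (RM * Omega) * RM -> R) \o (fun t : RM => ((l, w), t)))//.
apply: measurableT_comp; last exact: mg.
by apply: measurable_indic; exact: measurable_positive_set.
Qed.

Lemma occupation_integral_le (l : R) w :
  (\int[mu]_t (\1_positive_set ((l, w), t))%:E <= (Num.max 0 l)%:E)%E.
Proof.
apply: (@le_trans _ _ (\int[mu]_t (\1_(`[0, l]%classic : set RM) t)%:E)%E).
  apply: ge0_le_integral => //.
  - exact: measurable_positive_section.
  - by apply/measurable_EFinP/measurable_indic; exact: measurable_itv.
  - move=> t _; rewrite lee_fin !indicE ler_nat.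
    have [|//] := boolP (_ \in positive_set).
    by rewrite inE /positive_set/= => -[tl _]; rewrite mem_setE in_itv/= tl.
rewrite integral_indic// setIT.
rewrite [leLHS](_ : _ = mu [set` `[0, l]])// lebesgue_measure_itv/= lte_fin.
by case: ltP => l0; rewrite ?oppr0 ?adde0// lee_fin.
Qed.

Lemma occupation_timeK (l : R) w :
  (occupation_time X l w)%:E = (\int[mu]_t (\1_positive_set ((l, w), t))%:E)%E.
Proof.
rewrite occupation_timeE fineK// ge0_fin_numE; last exact: integral_ge0.
by apply: le_lt_trans (occupation_integral_le l w) _; exact: ltry.
Qed.

Lemma measurable_occupation_time :
  measurable_fun setT (fun z : RM * Omega => occupation_time X z.1 z.2).
Proof.
apply/measurable_EFinP.
rewrite (_ : _ \o _ = fun z : RM * Omega => (\int[mu]_t (\1_positive_set (z, t))%:E)%E).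
  apply: (measurable_fun_fubini_tonelli_F (m2 := mu) (fun z : (RM * Omega) * RM => (\1_positive_set z)%:E)) => //.
  by apply/measurable_EFinP/measurable_indic; exact: measurable_positive_set.
by apply/funext => -[l w]/=; rewrite occupation_timeK.
Qed.

End joint_measurability.

Section sojourn.
Context {R : realType} d (Omega : measurableType d).
Notation RM := (measurableTypeR R).
Notation mu := (@lebesgue_measure R).
Variable X : R -> Omega -> R.
Hypothesis mX : measurable_fun setT (fun z : RM * Omega => X (Num.max 0 z.1) z.2).

(** Half-open time intervals, unlike in the occupation time itself: consecutive
    pieces then add up pointwise and not just almost everywhere. *)
Definition sojourn (w : Omega) (l t : R) : R :=
  ((0 <= t < l) && (0 <= X (Num.max 0 t) w))%:R.

Let positive_sign (w : Omega) (t : R) : R := (0 <= X (Num.max 0 t) w)%R%:R.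

Let measurable_positive_sign w : measurable_fun setT (positive_sign w : RM -> RM).
Proof.
have mg : measurable_fun setT (fun t : RM => (t, w) : RM * Omega) by exact: measurable_fun_pair.
have mI : measurable_fun setT ((\1_(`[0, +oo[%classic : set R) : R -> R) : RM -> RM).
  by apply: measurable_indic; exact: measurable_itv.
rewrite (_ : positive_sign w = \1_(`[0, +oo[%classic : set R) \o (fun t => X (Num.max 0 t) w)).
  exact: (measurableT_comp mI (measurableT_comp mX mg)).
by apply/funext => t; rewrite /positive_sign /= indicE mem_setE in_itv/= andbT.
Qed.

Lemma sojournE w l : sojourn w l = positive_sign w \_ `[0, l[%classic.
Proof.
apply/funext => t; rewrite patchE mem_setE in_itv/= /sojourn /positive_sign.
by case: (0 <= t < l).
Qed.

Lemma measurable_sojourn w l : measurable_fun setT (sojourn w l : RM -> RM).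
Proof.
rewrite sojournE; apply/(measurable_restrictT (positive_sign w)); first exact: measurable_itv.
by apply: measurable_funTS; exact: measurable_positive_sign.
Qed.

Lemma sojourn_ge0 w l t : 0 <= sojourn w l t. Proof. by rewrite /sojourn. Qed.

Lemma occupation_time_sojourn (l : R) w :
  (occupation_time X l w)%:E = (\int[mu]_t (sojourn w l t)%:E)%E.
Proof.
have mp (D : set RM) : measurable_fun D (fun t : RM => (positive_sign w t)%:E).
  by apply/measurable_EFinP/measurable_funTS; exact: measurable_positive_sign.
transitivity (\int[mu]_(t in `[0%R, l[) (positive_sign w t)%:E)%E; last first.
  by rewrite [LHS]integral_mkcond; apply: eq_integral => t _; rewrite sojournE !patchE; case: ifP.
rewrite occupation_timeK// integral_itv_bndo_bndc; last exact: mp.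
rewrite [RHS]integral_mkcond; apply: eq_integral => t _; rewrite patchE mem_setE indicE.
have -> : (((l, w), t) \in positive_set X) = (t \in `[0, l]) && (0 <= X (Num.max 0 t) w).
  rewrite in_itv/=; apply/idP/idP; rewrite inE /positive_set/=.
    by move=> [-> ->].
  by move=> /andP[-> ->].
by case: ifP.
Qed.

End sojourn.

(** * From the discrete to the continuous arcsine law *)

Section step_function.
Context {R : realType}.
Notation mu := (@lebesgue_measure R).
Notation RM := (measurableTypeR R).

Lemma measurable_step_function (h : R) (phi : nat -> R) : 0 < h ->
  measurable_fun setT (fun t : RM => phi (Num.truncn (t / h))).
Proof.
move=> h0; apply: (measurable_fun_pick (k := fun t : RM => Num.truncn (t / h)) (F := fun j _ => phi j)).
  by move=> n; exact: measurable_truncn_div.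
by move=> n; exact: measurable_cst.
Qed.

Lemma integral_step_function (h : R) (phi : nat -> R) n : 0 < h -> (forall k, 0 <= phi k) ->
  (\int[mu]_(t in `[0%R, (n%:R * h)%R[) (phi (Num.truncn (t / h)))%:E = (h * \sum_(k < n) phi k)%:E)%E.
Proof.
move=> h0 phi0; elim: n => [|n ih].
  by rewrite mul0r big_ord0 mulr0 set_itvco0 integral_set0.
have nh : 0 <= n%:R * h by rewrite mulr_ge0// ltW.
have nhS : n%:R * h <= n.+1%:R * h by rewrite ler_pM2r// ler_nat.
have -> : `[0%R, n.+1%:R * h[%classic = `[0%R, n%:R * h[%classic `|` `[n%:R * h, n.+1%:R * h[%classic.
  by rewrite -itv_bndbnd_setU// bnd_simp.
rewrite ge0_integral_setU//.
- rewrite ih big_ord_recr/= mulrDr EFinD; congr (_ + _)%E.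
  rewrite (eq_integral (cst (phi n)%:E)).
    rewrite integral_cst// [X in (_ * X)%E](_ : _ = mu [set` `[n%:R * h, n.+1%:R * h[])//.
    rewrite lebesgue_measure_itv/= lte_fin ltr_pM2r// ltr_nat ltnSn.
    by rewrite -EFinB -EFinM -natr1; congr (_%:E); ring.
  move=> t; rewrite inE/= in_itv/= -ler_pdivlMr// -ltr_pdivrMr// => /truncn_def ->.
  by [].
- apply/measurable_EFinP; apply: measurable_funTS; exact: measurable_step_function.
- by move=> t _; rewrite lee_fin.
- apply/disj_setPS => t [] /=; rewrite !in_itv/= => /andP[_ tn] /andP[nt _].
  by have := lt_le_trans tn nt; rewrite ltxx.
Qed.
End step_function.

Section arcsine_density.
Context {R : realType}.
Notation mu := (@lebesgue_measure R).
Notation RM := (measurableTypeR R).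
Variable (l : R).
Hypothesis l0 : 0 < l.
Local Notation u := (@arcsine_seq R).

(** The density of the arcsine law on ]0, l[, its normalization being proved in
    [integral_arcsine_pdf]. *)
Definition arcsine_pdf (l t : R) : R :=
  if 0 < t < l then arcsine_const / Num.sqrt (t * (l - t)) else 0.

Lemma arcsine_pdf_ge0 (l' : R) t : 0 <= arcsine_pdf l' t.
Proof.
rewrite /arcsine_pdf; case: ifP => // _.
by rewrite divr_ge0// ?sqrtr_ge0// ltW// arcsine_const_gt0.
Qed.

Let h (n : nat) : R := l / n%:R.
Let k n t := Num.truncn (t / h n).
(** Density of the discrete arcsine law spread out uniformly over the mesh
    intervals of length l/n. *)
Definition arcsine_step n t : R := u (k n t) * u (n - k n t) / h n.

Let h0 n : (0 < n)%N -> 0 < h n.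
Proof. by move=> n0; rewrite divr_gt0// ltr0n. Qed.

Let nh n : (0 < n)%N -> n%:R * h n = l.
Proof. by move=> n0; rewrite /h mulrC divfK// pnatr_eq0 -lt0n. Qed.

Let kP n t : (0 < n)%N -> 0 < t < l ->
  [/\ (k n t < n)%N, (k n t)%:R * h n <= t & t < (k n t).+1%:R * h n].
Proof.
move=> n0 /andP[t0 tl].
have hn := h0 n0.
have th : 0 <= t / h n by rewrite divr_ge0// ltW.
have /andP[a b] := truncn_itv th.
split; last 2 first.
- by rewrite -ler_pdivlMr.
- by rewrite -ltr_pdivrMr.
by rewrite truncn_lt_nat// ltr_pdivrMr// nh.
Qed.

Lemma arcsine_step_ge0 n t : 0 <= arcsine_step n t.
Proof.
rewrite /arcsine_step divr_ge0//; last by rewrite divr_ge0// ltW.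
by rewrite mulr_ge0// ltW// arcsine_seq_gt0.
Qed.

(** Domination by a multiple of the limit density, from (2k+1) u_k^2 <= 1 applied
    to both factors. *)
Lemma arcsine_step_sqr n t : (0 < n)%N -> 0 < t < l ->
  arcsine_step n t ^+ 2 * (t * (l - t)) <= 1.
Proof.
move=> n0 t0l; have [kn kt tk] := kP n0 t0l; move: (t0l) => /andP[t0 tl].
have hn := h0 n0.
have nkE : (n - k n t)%:R = n%:R - (k n t)%:R :> R by rewrite natrB// ltnW.
have A : t * u (k n t) ^+ 2 <= h n.
  apply: (@le_trans _ _ (((k n t).*2.+1%:R * h n) * u (k n t) ^+ 2)).
    rewrite ler_wpM2r ?sqr_ge0// (le_trans (ltW tk))// ler_pM2r// ler_nat.
    by rewrite -addnn ltnS leq_addr.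
  by rewrite mulrAC -[leRHS]mul1r ler_pM2r// arcsine_seq_le.
have B : (l - t) * u (n - k n t) ^+ 2 <= h n.
  apply: (@le_trans _ _ (((n - k n t).*2.+1%:R * h n) * u (n - k n t) ^+ 2)).
    rewrite ler_wpM2r ?sqr_ge0//.
    apply: (@le_trans _ _ ((n - k n t)%:R * h n)).
      by rewrite nkE mulrBl nh// lerB.
    rewrite ler_pM2r// ler_nat.
    by rewrite -addnn leqW// leq_addr.
  by rewrite mulrAC -[leRHS]mul1r ler_pM2r// arcsine_seq_le.
rewrite /arcsine_step.
have -> : (u (k n t) * u (n - k n t) / h n) ^+ 2 * (t * (l - t)) =
  (t * u (k n t) ^+ 2) * ((l - t) * u (n - k n t) ^+ 2) / h n ^+ 2.
  by field; rewrite gt_eqF.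
rewrite ler_pdivrMr ?exprn_gt0// mul1r expr2 ler_pM// mulr_ge0// ?sqr_ge0// ?ltW// subr_gt0//.
Qed.

Lemma arcsine_step_le n t : (0 < n)%N -> 0 < t < l ->
  arcsine_step n t <= arcsine_pdf l t / arcsine_const.
Proof.
move=> n0 t0l; rewrite /arcsine_pdf t0l mulrAC divff ?gt_eqF ?arcsine_const_gt0// mul1r.
have p : 0 < t * (l - t) by move: t0l => /andP[? ?]; rewrite mulr_gt0// subr_gt0.

rewrite -(ler_pXn2r (ltn0Sn 1)) ?nnegrE ?invr_ge0 ?sqrtr_ge0 ?arcsine_step_ge0//.
rewrite exprVn sqr_sqrtr; last exact: ltW.
rewrite -div1r ler_pdivlMr//.
exact: arcsine_step_sqr.
Qed.

Let hc : (fun n => h n.+1) @ \oo --> (0 : R).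
Proof.
rewrite -[X in _ --> X](mulr0 l); apply: cvgM; first exact: cvg_cst.
exact: cvg_harmonic.
Qed.

Let kh_cvg (t : R) : 0 < t < l -> (fun n => (k n.+1 t)%:R * h n.+1) @ \oo --> t.
Proof.
move=> t0l; have KP n := kP (ltn0Sn n) t0l.
apply: (@squeeze_cvgr _ _ _ _ (fun n => t - h n.+1) (cst t)).
- apply: nearW => n; have [_ a b] := KP n; rewrite a andbT.
  by rewrite lerBlDr (le_trans (ltW b))// -natr1 mulrDl mul1r.
- by rewrite -[X in _ --> X]subr0; apply: cvgB => //; exact: cvg_cst.
- exact: cvg_cst.
Qed.

Let u_cvg0 : (fun n => u n.+1) @ \oo --> (0 : R).
Proof.
have -> : (fun n => u n.+1) = (fun n => Num.sqrt (u n.+1 ^+ 2)).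
  by apply/funext => n; rewrite sqrtr_sqr gtr0_norm// arcsine_seq_gt0.
rewrite -[X in _ --> X](sqrtr0 R); apply: (continuous_cvg _ (@sqrt_continuous R _)).
apply: (@squeeze_cvgr _ _ _ _ (cst 0) (fun n => n.+1%:R^-1)).
- apply: nearW => n; rewrite sqr_ge0/= -div1r ler_pdivlMr ?ltr0n// mulrC.
  exact: arcsine_seq_le1.
- exact: cvg_cst.
- exact: cvg_harmonic.
Qed.

(** With k ~ n t / l, both k u_k^2 and (n-k) u_(n-k)^2 tend to the constant, and
    the square of the density is their product divided by t (l - t). *)
Lemma arcsine_step_cvg (t : R) : 0 < t < l ->
  (fun n => arcsine_step n.+1 t) @ \oo --> arcsine_pdf l t.
Proof.
move=> t0l; move: (t0l) => /andP[t0 tl]; rewrite /arcsine_pdf t0l.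
pose K n := k n.+1 t.
have KP n := kP (ltn0Sn n) t0l.
have Kh : (fun n => (K n)%:R * h n.+1) @ \oo --> t by exact: kh_cvg.
have nKh : (fun n => (n.+1 - K n)%:R * h n.+1) @ \oo --> l - t.
  rewrite (_ : (fun n => _) = (fun n => l - (K n)%:R * h n.+1)).
    by apply: cvgB => //; exact: cvg_cst.
  apply/funext => n; have [/ltnW a _ _] := KP n.
  by rewrite natrB// mulrBl nh.
have to_oo (v : nat -> nat) (c : R) : 0 < c -> (fun n => (v n)%:R * h n.+1) @ \oo --> c ->
    v @ \oo --> \oo.
  move=> c0 vc; apply/cvgnyPge => A.
  have : \forall n \near \oo, c / 2 < (v n)%:R * h n.+1.
    by apply: (cvgr_gt _ vc); rewrite ltr_pdivrMr// ltr_pMr// ltr1n.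
  have : \forall n \near \oo, A%:R * h n.+1 < c / 2.
    have : (fun n => A%:R * h n.+1) @ \oo --> (0 : R).
      by rewrite -[X in _ --> X](mulr0 A%:R); apply: cvgM => //; exact: cvg_cst.
    by move/(cvgr_lt); apply; rewrite divr_gt0.
  move=> H1 H2; near=> n.
  have a1 : A%:R * h n.+1 < c / 2 by near: n.
  have a2 : c / 2 < (v n)%:R * h n.+1 by near: n.
  by have := lt_trans a1 a2; rewrite ltr_pM2r ?h0// ltr_nat => /ltnW.
have K_oo : K @ \oo --> \oo by exact: (to_oo _ t).
have nK_oo : (fun n => n.+1 - K n)%N @ \oo --> \oo.
  by apply: (to_oo _ (l - t)) => //; rewrite subr_gt0.
have uc (v : nat -> nat) : v @ \oo --> \oo -> (fun n => (v n)%:R * u (v n) ^+ 2) @ \oo --> arcsine_const.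
  by move=> vo; exact: (cvg_comp v (fun j : nat => j%:R * u j ^+ 2) vo (@arcsine_const_cvg R)).
have c0 := @arcsine_const_gt0 R.
have -> : arcsine_const / Num.sqrt (t * (l - t)) =
    Num.sqrt ((arcsine_const * arcsine_const) / (t * (l - t))).
  have cc : 0 <= arcsine_const * arcsine_const :> R by rewrite mulr_ge0// ltW.
  rewrite (sqrtrM _ cc) -expr2 sqrtr_sqr gtr0_norm// sqrtrV//.
  by rewrite mulr_ge0// ltW// subr_gt0.
have S : (fun n => Num.sqrt (((K n)%:R * u (K n) ^+ 2) * ((n.+1 - K n)%:R * u (n.+1 - K n) ^+ 2) /
   (((K n)%:R * h n.+1) * ((n.+1 - K n)%:R * h n.+1)))) @ \oo -->
   Num.sqrt ((arcsine_const * arcsine_const) / (t * (l - t))).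
  apply: (continuous_cvg _ (@sqrt_continuous R _)).
  apply: cvgM; first by apply: cvgM; exact: uc.
  by apply: cvgV; [rewrite mulf_neq0// gt_eqF// subr_gt0|exact: cvgM].
apply: cvg_trans S; apply: near_eq_cvg; near=> n.

have Kn : (0 < K n)%N by near: n; move/cvgnyPgt : K_oo => /(_ 0%N).
have nKn : (0 < n.+1 - K n)%N by near: n; move/cvgnyPgt : nK_oo => /(_ 0%N).
have hn := h0 (ltn0Sn n).
rewrite /arcsine_step -/(K n).
have E : u (K n) * u (n.+1 - K n) / h n.+1 >= 0.
  by rewrite divr_ge0// ?ltW// mulr_gt0// arcsine_seq_gt0.
rewrite -[RHS](ger0_norm E) -sqrtr_sqr; congr (Num.sqrt _).
field.
by rewrite !pnatr_eq0 -!lt0n Kn nKn gt_eqF.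
Unshelve. all: by end_near. Qed.

Local Open Scope ereal_scope.

Let g n (t : R) : R := if (0 < t < l)%R then arcsine_step n.+1 t else 0%R.

Let mtest : measurable_fun setT (fun t : RM => (0 < t < l)%R).
Proof. by apply: measurable_and; exact: measurable_fun_ltr. Qed.

Let mg n : measurable_fun setT (g n : RM -> R).
Proof.
apply: measurable_fun_ifT => //.
exact: (measurable_step_function (fun j => u j * u (n.+1 - j) / h n.+1)%R (h0 (ltn0Sn n))).
Qed.

Let g_cvg t : g n t @[n --> \oo] --> arcsine_pdf l t.
Proof.
rewrite /g; have [t0l|t0l] := boolP (0 < t < l)%R; first exact: arcsine_step_cvg.
by rewrite /arcsine_pdf (negbTE t0l); exact: cvg_cst.
Qed.

Lemma measurable_arcsine_pdf : measurable_fun setT (arcsine_pdf l : RM -> R).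
Proof. by apply: (measurable_fun_cvg (h := g)) => // t _; exact: g_cvg. Qed.

Let integral_g (f : R -> R) n : (forall t, (0 <= f t)%R) ->
  \int[mu]_t (g n t * f ((k n.+1 t)%:R * h n.+1)%R)%:E =
  (\sum_(j < n.+1) u j * u (n.+1 - j) * f (j%:R * h n.+1)%R)%:E.
Proof.
move=> f0.
have hn := h0 (ltn0Sn n).
pose phi j : R := (u j * u (n.+1 - j) / h n.+1 * f (j%:R * h n.+1))%R.
have phi0 j : (0 <= phi j)%R.
  by rewrite /phi mulr_ge0// divr_ge0// ?ltW// mulr_gt0// arcsine_seq_gt0.
transitivity (\int[mu]_(t in `]0%R, l[) (phi (k n.+1 t))%:E).
  rewrite [RHS]integral_mkcond; apply: eq_integral => t _.
  rewrite patchE mem_setE in_itv/= /g; case: ifP => // _.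
  by rewrite mul0r.
transitivity (\int[mu]_(t in `[0%R, (n.+1%:R * h n.+1)%R[) (phi (k n.+1 t))%:E).
  rewrite nh// integral_itv_obnd_cbnd//.
  by apply/measurable_EFinP/measurable_funTS; exact: measurable_step_function.
rewrite integral_step_function//; congr (_%:E); rewrite mulr_sumr.
by apply: eq_bigr => j _; rewrite /phi; field; rewrite gt_eqF.
Qed.

(** Fatou's lemma: the mesh densities have mass at most 1.  Integrability of the
    limit then provides the dominating function of [discrete_arcsine_cvg]. *)
Lemma integral_arcsine_pdf_lty : \int[mu]_t (arcsine_pdf l t)%:E < +oo.
Proof.
have -> : \int[mu]_t (arcsine_pdf l t)%:E = \int[mu]_t limn_einf (fun n => (g n t)%:E).
  apply: eq_integral => t _; apply/esym; apply: (fst (cvg_limn_einf_sup _)).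
  by apply: cvg_EFin; [exact: nearW|exact: g_cvg].
apply: (@le_lt_trans _ _ (limn_einf (fun n => \int[mu]_t (g n t)%:E))).
  apply: fatou => //.
  - by move=> n; apply/measurable_EFinP.
  - move=> n t _; rewrite lee_fin /g; case: ifP => // _; exact: arcsine_step_ge0.

apply: (@le_lt_trans _ _ 1); last exact: ltry.
rewrite limn_einf_lim; apply: lime_le; first exact: is_cvg_einfs.
apply: nearW => n; apply: (@le_trans _ _ (\int[mu]_t (g n t)%:E)).
  by apply: ereal_inf_lbound; exists n => /=.
have := integral_g (f := cst 1%R) n (fun=> ler01).
under eq_integral do rewrite mulr1.
move=> ->; rewrite lee_fin; under eq_bigr do rewrite mulr1.
rewrite -[leRHS](arcsine_seq_conv n.+1) [leRHS]big_ord_recr/= lerDl.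
by rewrite mulr_ge0// ltW// arcsine_seq_gt0.
Qed.

Lemma integrable_arcsine_pdf : mu.-integrable setT (EFin \o arcsine_pdf l).
Proof.
apply/integrableP; split.
  by apply/measurable_EFinP; exact: measurable_arcsine_pdf.
under eq_integral do rewrite /= ger0_norm ?arcsine_pdf_ge0//.
exact: integral_arcsine_pdf_lty.
Qed.

(** The atom at l (the term j = n + 1) has no mesh interval and vanishes in the
    limit; the other terms form the integral of a step function. *)
Lemma discrete_arcsine_cvg (f : R -> R) : continuous f -> (forall t, (0 <= f t <= 1)%R) ->
  (\sum_(j < n.+2) u j * u (n.+1 - j) * f (j%:R * (l / n.+1%:R)))%R%:E @[n --> \oo] -->
  \int[mu]_t (f t * arcsine_pdf l t)%:E.
Proof.
move=> cf f01.
have f0 t : (0 <= f t)%R by have /andP[] := f01 t.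
have f1 t : (f t <= 1)%R by have /andP[] := f01 t.
have mf : measurable_fun setT (f : RM -> R) by exact: continuous_measurable_fun.
have E n : (\sum_(j < n.+2) u j * u (n.+1 - j) * f (j%:R * (l / n.+1%:R)))%R%:E =
    \int[mu]_t (g n t * f ((k n.+1 t)%:R * h n.+1)%R)%:E + (u n.+1 * f l)%:E.
  rewrite integral_g// big_ord_recr/= -EFinD; congr (_ + _)%:E.
  by rewrite subnn mulr1 nh.
move/funext : E => ->.
rewrite -[X in _ --> X]adde0; apply: cvgeD; first by rewrite fin_num_adde_defl.
  pose G := fun t => (arcsine_const^-1 * arcsine_pdf l t)%:E.
  have iG : mu.-integrable setT G.
    rewrite /G; under [X in _.-integrable _ X]eq_fun do rewrite EFinM.
    by apply: integrableZl => //; exact: integrable_arcsine_pdf.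
  have [] := @dominated_convergence _ RM R mu setT measurableT
    (fun n t => (g n t * f ((k n.+1 t)%:R * h n.+1)%R)%:E)
    (fun t => (f t * arcsine_pdf l t)%:E) G _ _ _ iG _ => //.
  - move=> n; apply/measurable_EFinP; apply: measurable_funM => //.
    exact: (measurable_step_function (fun j => f (j%:R * h n.+1)%R) (h0 (ltn0Sn n))).
  - apply/measurable_EFinP; apply: measurable_funM => //.
    exact: measurable_arcsine_pdf.
  - apply: aeW => t _; apply: cvg_EFin; first exact: nearW.
    rewrite mulrC; have [t0l|t0l] := boolP (0 < t < l)%R; last first.
      under eq_fun do rewrite /g (negbTE t0l) mul0r.
      by rewrite /arcsine_pdf (negbTE t0l) mul0r; exact: cvg_cst.
    apply: cvgM; first exact: g_cvg.
    apply: (cvg_comp _ f); last exact: cf.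
    exact: kh_cvg.
  - apply: aeW => t n _; rewrite /G lee_fin.
    rewrite ger0_norm; last first.
      by rewrite mulr_ge0// /g; case: ifP => // _; exact: arcsine_step_ge0.
    rewrite /g; case: ifPn => [t0l|_]; last first.
      by rewrite mul0r mulr_ge0 ?arcsine_pdf_ge0// invr_ge0 ltW// arcsine_const_gt0.
    apply: le_trans (ler_piMr _ (f1 _)) _; first exact: arcsine_step_ge0.
    by rewrite mulrC; exact: arcsine_step_le.
rewrite [X in _ --> X](_ : 0 = (0 * f l)%:E); last by rewrite mul0r.
apply: cvg_EFin; first exact: nearW.
by apply: cvgM; [exact: u_cvg0|exact: cvg_cst].
Qed.

End arcsine_density.

(** * Signs of a Brownian path on a grid *)

Section independence_prefix.
Context {R : realType} d (Omega : measurableType d) (P : probability Omega R).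
Local Open Scope fset_scope.

(** Independence over finite sets of indices, in the form used for sequences. *)
Lemma mutually_independent_prefix (I : choiceType) (F : I -> set (set Omega))
    (e : nat -> I) (A : nat -> set Omega) N : injective e ->
  mutually_independent P F -> (forall i, F (e i) (A i)) ->
  P [set w | forall i, (i < N)%N -> A i w] = (\prod_(0 <= i < N) P (A i))%E.
Proof.
move=> inje iF FA.
pose J := fix J n : {fset I} := if n is n'.+1 then e n' |` J n' else fset0.
have inJ n i : (e i \in J n) = (i < n)%N.
  elim: n => [|n ih]; first by rewrite inE.
  by rewrite /= !inE ih (inj_eq inje) ltnS [RHS]leq_eqVlt.
have inJP n x : x \in J n -> exists2 i, (i < n)%N & x = e i.
  elim: n => [|n ih]; first by rewrite inE.
  rewrite /= !inE => /orP[/eqP ->|/ih[i ni ->]]; first by exists n.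
  by exists i => //; rewrite ltnS ltnW.
pose A' x := if pselect (exists i, x = e i) is left h then A (sval (cid h)) else set0.
have A'E i : A' (e i) = A i.
  rewrite /A'; case: pselect => [h|[]]; last by exists i.
  by case: cid => j /= /inje ->.
transitivity (P (\bigcap_(i in [set` J N]) A' i)).
  congr (P _); apply/seteqP; split => w /=.
    by move=> h x /= /inJP[i iN ->]; rewrite A'E; exact: h.
  by move=> h i iN; rewrite -A'E; apply: h; rewrite /= inJ.
rewrite iF; last by move=> x /inJP[i _ ->]; rewrite A'E.
elim: {iF} N => [|N ih]; first by rewrite big_geq// big_seq_fset0.
rewrite big_nat_recr//= big_fsetU1/= ?inJ ?ltnn//.
by rewrite A'E ih muleC.
Qed.
End independence_prefix.

Section random_walk.
Context {R : realType} d (Omega : measurableType d) (P : probability Omega R).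
Notation RM := (measurableTypeR R).
Variable B : R -> {RV P >-> R}.
Hypothesis hB : standard_brownian_motion B.
Variable h : R.
Hypothesis h0 : 0 < h.

Let S (j : nat) (w : Omega) : RM := B (j%:R * h) w.

Definition grid_count (j : nat) (w : Omega) : nat := \sum_(i < j) (0 <= S i.+1 w)%R.

(** The count and the position form a Markov chain, which gives the recursion that
    [sparre_andersen] asks for. *)
Definition walk_state (j : nat) (w : Omega) : nat * RM := (grid_count j w, S j w).

Definition walk_incr (i : nat) (w : Omega) : RM := S i.+1 w - S i w.

Definition walk_step (i : nat) (z : (nat * RM) * RM) : nat * RM :=
  (if 0 <= z.1.2 + z.2 :> R then z.1.1.+1 else z.1.1, z.1.2 + z.2).

Let mS j : measurable_fun setT (S j).
Proof. exact: (measurable_funP (B (j%:R * h))). Qed.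

Let mincr i : measurable_fun setT (walk_incr i).
Proof. exact: measurable_funB. Qed.

Let mstep i : measurable_fun setT (walk_step i).
Proof.
have ms : measurable_fun setT (fun z : (nat * RM) * RM => z.1.2 + z.2 : RM).
  by apply: measurable_funD => //; exact: measurableT_comp.
apply: measurable_fun_pair => //=.
have mn (f : nat -> nat) : measurable_fun setT (fun z : (nat * RM) * RM => f z.1.1).
  by apply: (measurableT_comp (f := f)) => //; exact: measurableT_comp.
apply: (@measurable_fun_ifT _ _ _ _ _ _ (fun z : (nat * RM) * RM => 0 <= z.1.2 + z.2 :> R)) => //.
  exact: measurable_fun_ler.
exact: (mn id).
Qed.

Lemma grid_count_le j w : (grid_count j w <= j)%N.
Proof.
rewrite -[leqRHS]card_ord -sum1_card; apply: leq_sum => i _.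
exact: leq_b1.
Qed.

Let state0 w : walk_state 0 w = (0%N, 0).
Proof.
have [B0 _ _ _] := hB.
by rewrite /walk_state /grid_count big_ord0 /S mul0r B0.
Qed.

Let stateS j w : walk_state j.+1 w = walk_step j (walk_state j w, walk_incr j w).
Proof.
rewrite /walk_state /walk_step /walk_incr/= subrKC /grid_count big_ord_recr/=.
by congr (_, _); case: ifP => _; rewrite ?addn1 ?addn0.
Qed.

Let t_nd : nondecreasing_seq (fun i : nat => i%:R * h).
Proof. by move=> i j ij; rewrite ler_pM2r// ler_nat. Qed.

Let incr_indep N (C : nat -> set RM) : (forall n, measurable (C n)) ->
  P [set w | forall i, (i < N)%N -> C i (walk_incr i w)] =
  (\prod_(0 <= i < N) P (walk_incr i @^-1` C i))%E.
Proof.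
move=> mC; have [_ _ _ ind] := hB.
have i0 : 0 <= 0%:R * h by rewrite mul0r.
apply: (mutually_independent_prefix (e := id) (A := fun i => walk_incr i @^-1` C i) N _ (ind _ i0 t_nd)) => // i.
apply: sub_sigma_algebra; exists i => //.
exists (C i); first exact: mC.
by rewrite setTI.
Qed.

Let incr_law i (Y : set RM) : measurable Y ->
  P (walk_incr i @^-1` Y) = normal_prob 0 (Num.sqrt h) Y.
Proof.
move=> mY; have [_ _ law _] := hB.
rewrite -[RHS](_ : normal_prob 0 (Num.sqrt (i.+1%:R * h - i%:R * h)) Y = _).
  apply: law => //; first by rewrite mulr_ge0// ltW.
  by rewrite ltr_pM2r// ltr_nat.
by congr (normal_prob 0 (Num.sqrt _) Y); rewrite -mulrBl -natr1; ring.
Qed.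

Let nu : {finite_measure set RM -> \bar R} := normal_prob 0 (Num.sqrt h).

Let sh0 : Num.sqrt h != 0.
Proof. by rewrite sqrtr_eq0 -ltNge. Qed.

Let nu_atomless (x : R) : nu [set x] = 0%E.
Proof.
rewrite /nu/=; have := @normal_prob_dominates R 0 (Num.sqrt h).
move/null_content_dominatesP; apply; first exact: measurable_set1.
exact: lebesgue_measure_set1.
Qed.

Let nu_sym (A : set RM) : measurable A -> nu ((-%R : RM -> RM) @^-1` A) = nu A.
Proof.
move=> mA; rewrite /nu/= /normal_prob.
have mo := measurable_oppR mA.
rewrite [LHS]integral_mkcond [RHS]integral_mkcond.
rewrite -[RHS]ge0_integral_reflection.
- apply: eq_integral => x _; rewrite !patchE.
  have -> : (x \in (-%R : RM -> RM) @^-1` A) = (- x \in A) by apply/idP/idP; rewrite !inE.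
  by case: ifP => // _; rewrite /normal_pdf (negbTE sh0) /normal_fun !subr0 sqrrN.
- apply/(measurable_restrictT _ _).1 => //.
  by apply/measurable_EFinP/measurable_funTS; exact: measurable_normal_pdf.
- by move=> x; rewrite patchE; case: ifP => // _; rewrite lee_fin normal_pdf_ge0.
Qed.

Let mcount j k : measurable [set w | grid_count j w = k].
Proof.
have mst := measurable_chain mincr mstep state0 stateS j.
rewrite (_ : [set w | _] = walk_state j @^-1` ([set k] `*` setT)).
  by rewrite -[X in measurable X]setTI; apply: mst => //; exact: measurableX.
by apply/seteqP; split => w /=; [move=> ->|case].
Qed.

Let rho (j k : nat) : {finite_measure set RM -> \bar R} :=
  law (mrestr P (mcount j k) : {finite_measure set Omega -> \bar R}) (mS j).

Let rhoE j k Y : rho j k Y = P [set w | grid_count j w = k /\ Y (S j w)].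
Proof.
rewrite /rho lawE/= /mrestr; congr (P _).
by apply/seteqP; split => w /= [].
Qed.

Let conv_rho j k Y : measurable Y ->
  conv nu (rho j k) Y = P [set w | grid_count j w = k /\ Y (S j.+1 w)].
Proof.
move=> mY; rewrite convC// /conv -lock.
have mSX : measurable_fun setT (fun w => (S j w, walk_incr j w)).
  exact: measurable_fun_pair.
have mYp : @measurable _ (RM * RM)%type (@addp R @^-1` Y).
  by rewrite -[X in measurable X]setTI; exact: measurable_addp.
pose PF := mrestr P (mcount j k) : {finite_measure set Omega -> \bar R}.
rewrite -[LHS]/(finite_prod (rho j k) nu (@addp R @^-1` Y)).
rewrite -(finite_prod_unique (m' := law PF mSX)) => //.
  transitivity (PF ((fun w => (S j w, walk_incr j w)) @^-1` (@addp R @^-1` Y))) => //.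
  rewrite /PF/= /mrestr; congr (P _).
  by apply/seteqP; split => w /=; rewrite /addp /walk_incr/= subrKC => -[].
move=> A C mA mC.

transitivity (PF ((fun w => (S j w, walk_incr j w)) @^-1` (A `*` C))) => //.
rewrite /PF/= /mrestr.
rewrite [X in _ = (X * _)%E](_ : _ = P [set w | grid_count j w = k /\ A (S j w)]); last exact: rhoE.
have KE (n : nat) : @measurable _ RM = <<s @measurable _ RM >>.
  by rewrite smallest_id//; exact: sigma_algebra_measurable.
have := @chain_law R d Omega P _ (nat * RM)%type _ (fun=> RM) (fun=> @measurable _ RM)
  KE (fun n => @measurableI _ RM) (fun n => measurableT) walk_incr mincr incr_indep
  walk_step mstep walk_state (0%N, 0) state0 stateS j (([set k] `*` A) `*` C).
move=> /(_ (measurableX (measurableX _ mA) mC)) E.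
transitivity (P [set w | (([set k] `*` A) `*` C) (walk_state j w, walk_incr j w)]).
  by congr (P _); apply/seteqP; split => w /=; [move=> [[? ?] ?]|move=> [[? ?] ?]].
rewrite E// finite_prodE//; last exact: measurableX.
congr (_ * _)%E; last exact: incr_law.
Qed.

Let rho0 Y : measurable Y -> rho 0%N 0%N Y = @dirac0 R Y.
Proof.
move=> mY; rewrite rhoE /dirac0/= diracE.
have [Y0|Y0] := boolP (0 \in Y).
  rewrite (_ : [set w | _] = setT) ?probability_setT//.
  apply/seteqP; split => // w _ /=; have [-> ->] := state0 w.
  by split=> //; rewrite inE in Y0.
rewrite (_ : [set w | _] = set0) ?measure0//.
apply/seteqP; split => // w /=; have [_ ->] := state0 w => -[_ Y0'].
by rewrite mem_set in Y0.
Qed.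

Let countS j w : grid_count j.+1 w = (if 0 <= S j.+1 w :> R then (grid_count j w).+1 else grid_count j w).
Proof. by rewrite /grid_count big_ord_recr/=; case: ifP => _; rewrite ?addn1 ?addn0. Qed.

Let nnegE (x : R) : nnegR x = (0 <= x) :> Prop.
Proof. by rewrite /nnegR /= in_itv/= andbT. Qed.

Let negE (x : R) : negR x = (x < 0) :> Prop.
Proof. by rewrite /negR /= in_itv/=. Qed.

(** The values on the grid form a random walk with symmetric atomless Gaussian
    steps. *)
Lemma grid_count_law j k : (k <= j)%N ->
  P [set w | grid_count j w = k] = (arcsine_seq k * arcsine_seq (j - k))%:E.
Proof.
have rhoT j' k' : rho j' k' setT = P [set w | grid_count j' w = k'].
  by rewrite rhoE; congr (P _); apply/seteqP; split => w /= [].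
move=> kj; rewrite -rhoT.
apply: (@sparre_andersen R nu nu_sym nu_atomless rho) kj.
- by move=> Y mY; exact: rho0.
- move=> n k' Y nk mY; rewrite rhoE (_ : [set w | _] = set0) ?measure0//.
  apply/seteqP; split => // w [/= nE _].
  by have := grid_count_le n w; rewrite nE leqNgt nk.
- move=> n Y mY; rewrite rhoE conv_rho; last first.
    by apply: measurableI => //; exact: measurable_negR.
  congr (P _); apply/seteqP; split => w /=; rewrite negE countS.
    by have [_ []//|S0 [-> YS]] := leP.
  by move=> [nE [YS]]; rewrite ltNge => /negbTE ->.
- move=> n k' Y mY.
  have mYp : @measurable _ RM (Y `&` @nnegR R) by apply: measurableI => //; exact: measurable_nnegR.
  have mYn : @measurable _ RM (Y `&` @negR R) by apply: measurableI => //; exact: measurable_negR.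
  have mE j1 k1 Z : @measurable _ RM Z -> measurable [set w | grid_count j1 w = k1 /\ Z (S j1.+1 w)].
    move=> mZ; rewrite (_ : [set w | _] = [set w | grid_count j1 w = k1] `&` S j1.+1 @^-1` Z)//.
    apply: measurableI => //.
    by rewrite -[X in measurable X]setTI; exact: mS.
  rewrite !conv_rho// rhoE -measureU ?mE//.
    congr (P _); apply/seteqP; split => w /=; rewrite nnegE negE countS.
      case: ifP => [S0 [[nE] YS]|/negbT]; first by left.
      by rewrite -ltNge => S0 [nE YS]; right.
    by move=> [[-> [YS ->]]|[-> [YS]]] //; rewrite ltNge => /negbTE ->.
  - exact: (mE _ _ _ mYp).
  - exact: (mE _ _ _ mYn).
  - apply/seteqP; split => // w [[/= -> _] [/= /eqP]].
    by rewrite ltn_eqF.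
- move=> n; under eq_bigr do rewrite rhoT.
  rewrite -(measure_bigsetU P _ (F := fun k' => [set w | grid_count n w = k'])).
  - rewrite -(bigcup_mkord n.+1 (fun k' => [set w | grid_count n w = k'])).
    rewrite (_ : \bigcup_(_ in _) _ = setT); first exact: probability_setT.
    apply/seteqP; split => // w _; exists (grid_count n w) => //=.
    by rewrite ltnS grid_count_le.
  - by move=> i.
  - by move=> i j' _ _ [w [/= -> ->]].
Qed.

End random_walk.

(** * Weak uniqueness of finite measures *)

Section density_measure.
Context {R : realType}.
Notation mu := (@lebesgue_measure R).
Notation RM := (measurableTypeR R).
Local Open Scope ereal_scope.
Variable p : R -> R.
Hypothesis mp : measurable_fun setT (p : RM -> R).
Hypothesis p0 : forall x, (0 <= p x)%R.
Hypothesis pfin : \int[mu]_x (p x)%:E < +oo.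

Definition density_measure (A : set RM) : \bar R := \int[mu]_(x in A) (p x)%:E.

Let density0 : density_measure set0 = 0.
Proof. exact: integral_set0. Qed.

Let density_ge0 A : 0 <= density_measure A.
Proof. by apply: integral_ge0 => x _; rewrite lee_fin. Qed.

Let density_sigma_additive : semi_sigma_additive density_measure.
Proof.
move=> /= F mF tF mUF; rewrite /density_measure; apply: cvg_toP.
  apply: ereal_nondecreasing_is_cvgn => m n mn.
  by apply: lee_sum_nneg_natr => // k _ _; apply: integral_ge0 => x _; rewrite lee_fin.
rewrite ge0_integral_bigcup//=.
- by apply/measurable_EFinP/measurable_funTS.
- by move=> x _; rewrite lee_fin.
Qed.

HB.instance Definition _ := isMeasure.Build _ _ _ density_measure
  density0 density_ge0 density_sigma_additive.

Let density_fin : fin_num_fun density_measure.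
Proof.
move=> A mA; rewrite ge0_fin_numE//; apply: le_lt_trans pfin.
apply: ge0_subset_integral => //; first exact/measurable_EFinP.
by move=> x _; rewrite lee_fin.
Qed.

HB.instance Definition _ := @Measure_isFinite.Build _ _ _ density_measure density_fin.

Definition density_finite_measure : {finite_measure set RM -> \bar R} := density_measure.

Lemma ge0_integral_density_measure (f : R -> \bar R) : measurable_fun setT f ->
  (forall x, 0 <= f x) ->
  \int[density_finite_measure]_x f x = \int[mu]_x (f x * (p x)%:E).
Proof. by move=> mf f0; apply: ge0_integral_density. Qed.

End density_measure.

Section weak_uniqueness.
Context {R : realType}.
Notation RM := (measurableTypeR R).
Local Open Scope ereal_scope.

(** Decreases linearly from 1 at x to 0 at x + 1/j; these functions converge
    pointwise to the indicator of ]-oo, x]. *)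
Definition ramp (x : R) (j : nat) (y : R) : R := Num.max 0%R (Num.min 1%R (1 - j%:R * (y - x))%R).

Lemma ramp_itv x j y : (0 <= ramp x j y <= 1)%R.
Proof. by rewrite /ramp le_max lexx/= ge_max ler01 ge_min lexx. Qed.

Lemma continuous_ramp x j : continuous (ramp x j).
Proof.
rewrite (_ : ramp x j = (cst 0%R : R -> R) \max ((cst 1%R : R -> R) \min (fun y => 1 - j%:R * (y - x))%R))//.
move=> y; apply: continuous_max; first exact: cvg_cst.
apply: continuous_min; first exact: cvg_cst.
apply: cvgB; first exact: cvg_cst.
apply: cvgM; first exact: cvg_cst.
by apply: cvgB; [exact: cvg_id|exact: cvg_cst].
Qed.

Lemma ramp_cvg x y : ramp x j y @[j --> \oo] --> (\1_(`]-oo, x]%classic) y : R).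
Proof.
rewrite indicE mem_setE in_itv/=; have [yx|xy] := leP y x.
  rewrite (_ : (fun _ => _) = cst 1%R); first exact: cvg_cst.
  apply/funext => j; rewrite /ramp (min_idPl _) ?(max_idPr _)//.
  by rewrite lerDl oppr_ge0 mulr_ge0_le0// subr_le0.
apply: cvg_near_cst.
near=> j; rewrite /ramp; apply/max_idPl.
rewrite ge_min; apply/orP; right; rewrite subr_le0 -ler_pdivrMr ?subr_gt0//.
by near: j; exact: nbhs_infty_ger.
Unshelve. all: by end_near. Qed.

Lemma finite_measure_eq_ramp (m1 m2 : {finite_measure set RM -> \bar R}) :
  (forall f : R -> R, continuous f -> (forall x, (0 <= f x <= 1)%R) ->
     \int[m1]_x (f x)%:E = \int[m2]_x (f x)%:E) ->
  forall A, measurable A -> m1 A = m2 A.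
Proof.
move=> h; apply: finite_measure_eq_cdf => x.
have H (m : {finite_measure set RM -> \bar R}) :
    \int[m]_y (ramp x j y)%:E @[j --> \oo] --> m `]-oo, x]%classic.
  have -> : m `]-oo, x]%classic = \int[m]_y (\1_(`]-oo, x]%classic) y)%:E.
    by rewrite integral_indic// setIT.
  have [] := @dominated_convergence _ RM R m setT measurableT
    (fun j y => (ramp x j y)%:E) (fun y => (\1_(`]-oo, x]%classic : set R) y : R)%:E) (cst 1) _ _ _ _ _ => //.
  - move=> j; apply/measurable_EFinP.
    exact: (continuous_measurable_fun (@continuous_ramp x j)).
  - by apply/measurable_EFinP/measurable_indic.
  - by apply: aeW => y _; apply: cvg_EFin; [exact: nearW|exact: ramp_cvg].
  - exact: finite_measure_integrable_cst.
  - apply: aeW => y j _; rewrite lee_fin.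
    by have /andP[a b] := ramp_itv x j y; rewrite ger0_norm.
have := H m1; rewrite (_ : (fun j => _) = (fun j => \int[m2]_y (ramp x j y)%:E)).
  by move=> H1; exact: (cvg_unique _ H1 (H m2)).
by apply/funext => j; apply: h; [exact: continuous_ramp|exact: ramp_itv].
Qed.

End weak_uniqueness.

(** * Lévy's arcsine law *)

Section levy.
Context {R : realType} d (Omega : measurableType d) (P : probability Omega R).
Notation RM := (measurableTypeR R).
Notation mu := (@lebesgue_measure R).
Variable B : R -> {RV P >-> R}.
Hypothesis hB : standard_brownian_motion B.
Let X (t : R) (w : Omega) : R := B t w.

Lemma measurable_brownian : measurable_fun setT (fun z : RM * Omega => X (Num.max 0 z.1) z.2).
Proof.
have [_ cB _ _] := hB.
by apply: measurable_continuous_process => // t _; exact: measurable_funP.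
Qed.
Let mX := measurable_brownian.

Variable l : R.
Hypothesis l0 : 0 < l.
Let h (n : nat) : R := l / n.+1%:R.
Let h0 n : 0 < h n. Proof. by rewrite divr_gt0. Qed.
Let hc : h @ \oo --> (0 : R).
Proof.
rewrite -[X in _ --> X](mulr0 l); apply: cvgM; first exact: cvg_cst.
exact: cvg_harmonic.
Qed.
Let nh n : n.+1%:R * h n = l.
Proof. by rewrite /h mulrC divfK. Qed.

Let riemann n (w : Omega) : R := h n * (grid_count B (h n) n.+1 w)%:R.
Let occ (w : Omega) : R := occupation_time X l w.

Let pos (x : R) : R := (0 <= x)%R%:R.

Let pos0 x : 0 <= pos x. Proof. by rewrite /pos. Qed.

Let pos1 x : pos x <= 1.
Proof. by rewrite /pos lern1; case: (0 <= x). Qed.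

Let mpos : measurable_fun setT (pos : RM -> R).
Proof.
rewrite (_ : pos = \1_(`[0, +oo[%classic)); first exact: measurable_indic.
by apply/funext => x; rewrite /pos indicE mem_setE in_itv/= andbT.
Qed.

Let mXw w : measurable_fun setT (fun t : RM => X (Num.max 0 t) w : RM).
Proof.
have mg : measurable_fun setT (fun t : RM => (t, w) : RM * Omega) by exact: measurable_fun_pair.
exact: (measurableT_comp mX mg).
Qed.

Let riemannE n w : (riemann n w)%:E =
  (\int[mu]_(t in `]0%R, l[) (pos (X (grid (h n) t) w))%:E)%E.
Proof.
rewrite integral_itv_obnd_cbnd; last first.
  apply/measurable_EFinP/measurable_funTS.
  exact: (measurable_step_function (fun k => pos (X (k.+1%:R * h n) w)) (h0 n)).
have := integral_step_function (phi := fun k => pos (X (k.+1%:R * h n) w)) n.+1 (h0 n) (fun k => pos0 _).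
rewrite nh => ->; congr (_%:E); rewrite /riemann /grid_count natr_sum.
by congr (_ * _); apply: eq_bigr.
Qed.

Let occE w : (occ w)%:E = (\int[mu]_(t in `]0%R, l[) (pos (X (Num.max 0 t) w))%:E)%E.
Proof.
have mp (D : set RM) : measurable_fun D (fun t : RM => (pos (X (Num.max 0 t) w))%:E).
  by apply/measurable_EFinP/measurable_funTS; exact: (measurableT_comp mpos (mXw w)).
rewrite /occ (occupation_time_sojourn mX) integral_itv_obnd_cbnd; last exact: mp.
rewrite [RHS]integral_mkcond; apply: eq_integral => t _.
by rewrite patchE mem_setE in_itv/= /sojourn; case: (0 <= t < l).
Qed.

(** At a time where the path does not vanish, the sign is locally constant. *)
Let pos_cvg w t : 0 < t -> X t w != 0 ->
  pos (X (grid (h n) t) w) @[n --> \oo] --> pos (X t w).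
Proof.
move=> t0 Xt0; have [_ cB _ _] := hB.
have gc : (fun n => grid (h n) t) @ \oo --> t.
  by rewrite -[X in _ --> X](max_idPr (ltW t0)); exact: grid_cvg.
have Xc : X (grid (h n) t) w @[n --> \oo] --> X t w.
  apply: (cvg_comp _ (fun u => X u w)); first exact: gc.
  have /continuous_within_itvcyP[c0 _] := cB w.
  by apply: c0; rewrite in_itv/= t0.
apply: cvg_near_cst.
move: Xt0; rewrite neq_lt => /orP[Xn|Xp].
  near=> n; have Xgn : X (grid (h n) t) w < 0 by near: n; exact: (cvgr_lt _ Xc).
  by rewrite /pos leNgt Xgn leNgt Xn.
near=> n; have Xgn : 0 < X (grid (h n) t) w by near: n; exact: (cvgr_gt _ Xc).
by rewrite /pos ltW// ltW.
Unshelve. all: by end_near. Qed.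

Let zero_set : set (RM * Omega) := [set z | 0 < z.1 < l /\ X (Num.max 0 z.1) z.2 = 0].

Let mzero_set : measurable zero_set.
Proof.
rewrite (_ : zero_set = (`]0, l[%classic `*` setT) `&`
    (fun z : RM * Omega => X (Num.max 0 z.1) z.2 : RM) @^-1` [set 0]).
  apply: measurableI; first by apply: measurableX => //; exact: measurable_itv.
  by rewrite -[X in measurable X]setTI; apply: mX => //; exact: measurable_set1.
apply/seteqP; split => z; rewrite /zero_set/= in_itv/=; first by move=> [-> ->].
by move=> [[-> _] ->].
Qed.

Let marginal0 t : 0 < t -> P [set w | X t w = 0] = 0%E.
Proof.
move=> t0; have [B0 _ law _] := hB.
rewrite (_ : [set w | _] = (fun w => B t w - B 0 w) @^-1` [set 0]); last first.
  by apply/seteqP; split => w /=; rewrite B0 subr0.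
have m0 : @measurable _ RM [set 0] by exact: measurable_set1.
rewrite law// subr0.
have := @normal_prob_dominates R 0 (Num.sqrt t).
move/null_content_dominatesP; apply => //.
exact: lebesgue_measure_set1.
Qed.

(** Each time t > 0 is almost surely not a zero of the path, since B_t has a
    density; by Tonelli's theorem the zero set of almost every path is null. *)
Let ae_zero : \forall w \ae P, \forall t \ae mu, ~ zero_set (t, w).
Proof.
have mi : measurable_fun setT (fun z : RM * Omega => (\1_zero_set z : R)%:E).
  by apply/measurable_EFinP; exact: measurable_indic.
have I0 : (\int[P]_w \int[mu]_t (\1_zero_set (t, w))%:E = 0)%E.
  rewrite -(fubini_tonelli (m1 := mu) (m2 := P) (fun z : RM * Omega => (\1_zero_set z)%:E)) => //; last first.
  apply: integral0_eq => t _.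
  have mt : measurable [set w | zero_set (t, w)].
    have mg : measurable_fun setT (fun w => (t, w) : RM * Omega) by exact: measurable_fun_pair.
    by rewrite -[X in measurable X]setTI; exact: mg.
  transitivity (\int[P]_w (\1_[set w | zero_set (t, w)] w)%:E)%E.
    by apply: eq_integral => w _; rewrite !indicE; congr ((_ : bool)%:R%:E); apply/idP/idP; rewrite !inE.
  rewrite integral_indic// setIT; apply/eqP; rewrite eq_le measure_ge0 andbT.
  have [t0|t0] := ltP 0 t; last first.
    rewrite (_ : [set w | _] = set0) ?measure0//.
    by apply/seteqP; split => // w; rewrite /zero_set/= ltNge t0 => -[].
  have mXt : measurable_fun setT (X t : Omega -> RM) by exact: (measurable_funP (B t)).
  have mX0 : measurable [set w | X t w = 0].
    by rewrite -[X in measurable X]setTI; exact: (mXt measurableT [set 0] (measurable_set1 _)).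
  rewrite -(marginal0 t0); apply: (@le_measure _ _ _ P); rewrite ?inE//.
  by move=> w; rewrite /zero_set/= (max_idPr (ltW t0)) => -[].
have mI : measurable_fun setT (fun w => \int[mu]_t (\1_zero_set (t, w))%:E)%E.
  exact: (measurable_fun_fubini_tonelli_G (m1 := mu) (fun z : RM * Omega => (\1_zero_set z)%:E)).
have /(ae_eq_integral_abs _ measurableT mI) : (\int[P]_w `|\int[mu]_t (\1_zero_set (t, w))%:E| = 0)%E.
  rewrite -[RHS]I0; apply: eq_integral => w _; rewrite gee0_abs//.
  exact: integral_ge0.
apply: filterS => w /(_ I) Iw.
have mz : measurable_fun setT (fun t : RM => (\1_zero_set (t, w) : R)%:E).
  have mg : measurable_fun setT (fun t : RM => (t, w) : RM * Omega) by exact: measurable_fun_pair.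
  exact: (measurableT_comp mi mg).
have /(ae_eq_integral_abs _ measurableT mz) : (\int[mu]_t `|(\1_zero_set (t, w) : R)%:E| = 0)%E.
  by rewrite -[RHS]Iw; apply: eq_integral => t _; rewrite gee0_abs.
apply: filterS => t /(_ I)/= => -[] /eqP; rewrite indicE pnatr_eq0 eqb0 => /negP nz zt.
by apply: nz; rewrite inE.
Qed.

(** The Riemann sum is the integral over ]0, l[ of the sign of the path at the next
    grid point, so dominated convergence on ]0, l[ applies to almost every path. *)
Let riemann_cvg : \forall w \ae P, riemann n w @[n --> \oo] --> occ w.
Proof.
move: ae_zero; apply: filterS => w aw.
have mp n : measurable_fun (`]0%R, l[%classic : set RM) (fun t : RM => (pos (X (grid (h n) t) w))%:E).
  apply/measurable_EFinP/measurable_funTS.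
  exact: (measurable_step_function (fun k => pos (X (k.+1%:R * h n) w)) (h0 n)).
have mp' : measurable_fun (`]0%R, l[%classic : set RM) (fun t : RM => (pos (X (Num.max 0 t) w))%:E).
  by apply/measurable_EFinP/measurable_funTS; exact: (measurableT_comp mpos (mXw w)).
have i1 : mu.-integrable (`]0%R, l[%classic : set RM) (cst (1%:E : \bar R)).
  apply/integrableP; split; first exact: measurable_cst.
  rewrite (eq_integral (cst 1%E)); last by move=> t _; rewrite /= normr1.
  by rewrite integral_cst//= mul1e lebesgue_measure_itv/=; case: ifP => //; rewrite ltry.
have [] := @dominated_convergence _ RM R mu `]0%R, l[%classic (measurable_itv _)
   (fun n t => (pos (X (grid (h n) t) w))%:E) (fun t => (pos (X (Num.max 0 t) w))%:E)
   (cst 1%:E) mp mp' _ i1 _.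
- move: aw; apply: filterS => t nz; rewrite /= in_itv/= => /andP[t0 tl].
  apply: cvg_EFin; first exact: nearW.
  rewrite /comp/= (max_idPr (ltW t0)); apply: pos_cvg => //.
  by apply/negP => /eqP z; apply: nz; rewrite /zero_set/= t0 tl (max_idPr (ltW t0)).
- apply: nearW => t n _; rewrite /= lee_fin ger0_norm//.
move=> _ _; rewrite -occE.
have -> : (fun n => \int[mu]_(t in `]0%R, l[) (pos (X (grid (h n) t) w))%:E)%E = (EFin \o riemann ^~ w).
  by apply/funext => n; rewrite /= riemannE.
by move=> /fine_cvgP[_].
Qed.

Let mriemann n : measurable_fun setT (riemann n : Omega -> RM).
Proof.
apply: measurable_funM; first exact: measurable_cst.
rewrite (_ : (fun w => _) = fun w => \sum_(i < n.+1) pos (X (i.+1%:R * h n) w)); last first.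
  by apply/funext => w; rewrite /grid_count natr_sum; apply: eq_bigr.
apply: measurable_sum => i.
have mXi : measurable_fun setT (X (i.+1%:R * h n) : Omega -> RM) by exact: (measurable_funP (B _)).
exact: (measurableT_comp mpos mXi).
Qed.

Let mocc : measurable_fun setT (occ : Omega -> RM).
Proof.
have mg : measurable_fun setT (fun w => (l, w) : RM * Omega) by exact: measurable_fun_pair.
exact: (measurableT_comp (measurable_occupation_time mX) mg).
Qed.

Let integral_riemann (f : R -> R) n : continuous f -> (forall t, 0 <= f t) ->
  (\int[P]_w (f (riemann n w))%:E)%E =
  (\sum_(j < n.+2) arcsine_seq j * arcsine_seq (n.+1 - j) * f (j%:R * (l / n.+1%:R)))%:E.
Proof.
move=> cf f0; pose C j := [set w | grid_count B (h n) n.+1 w = j].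
have CE j : C j = riemann n @^-1` [set j%:R * h n].
  apply/seteqP; split => w; rewrite /C /riemann /=; first by move=> ->; rewrite mulrC.
  by rewrite mulrC => /(mulIf (lt0r_neq0 (h0 n)))/eqP; rewrite eqr_nat => /eqP.
have mC j : measurable (C j).
  rewrite CE -[X in measurable X]setTI.
  have m1 : @measurable _ RM [set (j%:R * h n : R)] by exact: measurable_set1.
  by apply: (mriemann n) => //; exact: m1.
transitivity (\int[P]_w \sum_(j < n.+2) (f (j%:R * h n))%:E * (\1_(C j) w)%:E)%E.
  apply: eq_integral => w _.
  have jn : (grid_count B (h n) n.+1 w < n.+2)%N by rewrite ltnS grid_count_le.
  rewrite (bigD1 (Ordinal jn))//= big1 ?adde0.
    by rewrite indicE mem_set// mule1 /riemann mulrC.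
  move=> j jne; rewrite indicE memNset ?mule0// => jC; move/eqP: jne; apply.
  by apply: val_inj; rewrite /= jC.
rewrite ge0_integral_sum//; last 2 first.
- by move=> j; apply/measurable_EFinP; apply: measurable_funM => //; exact: measurable_indic.
- by move=> j w _; rewrite mule_ge0// lee_fin.
rewrite -sumEFin; apply: eq_bigr => j _.
rewrite ge0_integralZl//; last first.
- by rewrite lee_fin.
- by apply/measurable_EFinP; exact: measurable_indic.
rewrite integral_indic// setIT.
have PC : P (C j) = (arcsine_seq j * arcsine_seq (n.+1 - j) : R)%:E.
  by apply: (grid_count_law hB (h0 n)); rewrite -ltnS.
by rewrite [X in (_ * X)%E]PC -EFinM mulrC.
Qed.

Let integral_occ (f : R -> R) : continuous f -> (forall t, 0 <= f t <= 1) ->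
  (\int[P]_w (f (occ w))%:E = \int[mu]_t (f t * arcsine_pdf l t)%:E)%E.
Proof.
move=> cf f01.
have mf : measurable_fun setT (f : RM -> RM) by exact: continuous_measurable_fun.
have f0 x : 0 <= f x by have /andP[] := f01 x.
have := discrete_arcsine_cvg l0 cf f01.
rewrite -(_ : (fun n => \int[P]_w (f (riemann n w))%:E)%E = fun n =>
    (\sum_(j < n.+2) arcsine_seq j * arcsine_seq (n.+1 - j) * f (j%:R * (l / n.+1%:R)))%:E); last first.
  by apply/funext => n; rewrite integral_riemann.
move=> /cvg_lim <- //; apply/esym; apply/cvg_lim => //.
have i1 : P.-integrable setT (cst (1%:E : \bar R)) by exact: finite_measure_integrable_cst.
have [] := @dominated_convergence _ Omega R P setT measurableT
   (fun n w => (f (riemann n w))%:E) (fun w => (f (occ w))%:E) (cst 1%:E) _ _ _ i1 _ => //.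
- by move=> n; apply/measurable_EFinP; exact: (measurableT_comp mf (mriemann n)).
- by apply/measurable_EFinP; exact: (measurableT_comp mf mocc).
- move: riemann_cvg; apply: filterS => w rw _.
  apply: cvg_EFin; first exact: nearW.
  exact: (cvg_comp _ f rw (cf _)).
- by apply: nearW => w n _; rewrite /= lee_fin; have /andP[_ f1] := f01 (riemann n w); rewrite ger0_norm.
Qed.

(** Both sides are finite measures in Y with the same integral against
    continuous functions: [integral_occ] is the limit of the discrete identity
    [integral_riemann] along finer grids. *)
Lemma levy_arcsine (Y : set RM) : measurable Y ->
  P [set w | Y (occupation_time X l w)] = (\int[mu]_(t in Y) (arcsine_pdf l t)%:E)%E.
Proof.
move=> mY.
have mp := measurable_arcsine_pdf l0; have p0 := arcsine_pdf_ge0 l.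
have pf := integral_arcsine_pdf_lty l0.
pose m1 : {finite_measure set RM -> \bar R} := law P mocc.
pose m2 := density_finite_measure mp p0 pf.
apply: (finite_measure_eq_ramp (m1 := m1) (m2 := m2)) => // f cf f01.
have mf : measurable_fun setT (f : RM -> RM) by exact: continuous_measurable_fun.
have f0 x : 0 <= f x by have /andP[] := f01 x.
rewrite [LHS](ge0_integral_law P mocc)//; last by exact/measurable_EFinP.
rewrite [RHS](ge0_integral_density_measure mp p0 pf)//; last by exact/measurable_EFinP.
by rewrite /comp/= integral_occ//; apply: eq_integral => t _; rewrite EFinM.
Qed.

End levy.

(** * Gamma densities of half-integer shape *)

Section half_power.
Context {R : realType}.
Notation mu := (@lebesgue_measure R).
Notation RM := (measurableTypeR R).

Lemma is_derive_half_power n (z : R) : 0 < z ->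
  is_derive z 1 (fun z => 2 / n.+1%:R * Num.sqrt z ^+ n.+1) (Num.sqrt z ^+ n / Num.sqrt z).
Proof.
move=> z0; have ds := is_derive1_sqrt z0.
have dx : is_derive z 1 (fun z => Num.sqrt z ^+ n.+1)
    ((n.+1%:R * Num.sqrt z ^+ n) *: (2 * Num.sqrt z)^-1).
  rewrite (_ : (fun z => _) = (Num.sqrt : R -> R) ^+ n.+1).
    exact: (is_deriveX n.+1 ds).
  by apply/funext => x; rewrite exprfctE.
apply: is_derive_eq; rewrite /GRing.scale/=.
have sz : Num.sqrt z != 0 by rewrite sqrtr_eq0 -ltNge.
have n0 : n.+1%:R != 0 :> R by rewrite pnatr_eq0.
by field; rewrite sz addrC natr1 n0.
Qed.

Lemma measurable_half_power n (A : set RM) : A `<=` `]0, +oo[%classic -> measurable A ->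
  measurable_fun A (fun z : RM => (Num.sqrt z ^+ n / Num.sqrt z : R)).
Proof.
move=> A0 mA; apply: (@measurable_funS _ _ _ _ (`]0%R, +oo[%classic : set RM)) => //.
apply: open_continuous_measurable_fun; first exact: interval_open.
move=> z; rewrite inE/= in_itv/= andbT => z0.
have cs : Num.sqrt x @[x --> z] --> Num.sqrt z by exact: sqrt_continuous.
apply: cvgM; first exact: (continuous_comp cs (@exprn_continuous _ n _)).
by apply: (continuousV _ cs); rewrite sqrtr_eq0 -ltNge.
Qed.

(** For n = 0 the integrand is unbounded at 0: the fundamental theorem of calculus
    is applied on [c/k, c] and k goes to infinity. *)
Lemma integral_half_power n (c : R) : 0 < c ->
  (\int[mu]_(z in `]0%R, c[) (Num.sqrt z ^+ n / Num.sqrt z)%:E =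
  (2 / n.+1%:R * Num.sqrt c ^+ n.+1)%:E)%E.
Proof.
move=> c0.
pose f (z : R) := Num.sqrt z ^+ n / Num.sqrt z.
pose F (z : R) := 2 / n.+1%:R * Num.sqrt z ^+ n.+1.
have cs (z : R) : Num.sqrt x @[x --> z] --> Num.sqrt z by exact: sqrt_continuous.
have cX k (z : R) : Num.sqrt x ^+ k @[x --> z] --> Num.sqrt z ^+ k.
  exact: (continuous_comp (cs z) (@exprn_continuous _ k _)).
have cF : continuous F.
  move=> z; apply: cvgM; first exact: cvg_cst.
  exact: cX.
have cf (z : R) : 0 < z -> f x @[x --> z] --> f z.
  move=> z0; apply: cvgM.
    exact: cX.
  by apply: (continuousV _ (cs z)); rewrite sqrtr_eq0 -ltNge.
pose e (k : nat) : R := c / k.+2%:R.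
have e0 k : 0 < e k by rewrite divr_gt0.
have ec k : e k < c by rewrite /e ltr_pdivrMr// ltr_pMr// ltr1n.
have key k : (\int[mu]_(z in `[e k, c]) (f z)%:E = (F c - F (e k))%:E)%E.
  rewrite (@continuous_FTC2 _ f F)//.
  - apply: continuous_in_subspaceT => z; rewrite inE/= in_itv/= => /andP[ez _].
    exact/cf/(lt_le_trans (e0 k)).
  - split; last 2 first.
    + by apply: cvg_at_right_filter; exact: cF.
    + by apply: cvg_at_left_filter; exact: cF.
    move=> z; rewrite in_itv/= => /andP[ez _].
    by have [] := is_derive_half_power n (lt_trans (e0 k) ez).
  - move=> z; rewrite in_itv/= => /andP[ez _].
    by rewrite derive1E; have [_ ->] := is_derive_half_power n (lt_trans (e0 k) ez).
have ec0 : e @ \oo --> (0 : R).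
  rewrite -[X in _ --> X](mulr0 c); apply: cvgM; first exact: cvg_cst.
  by have := @cvg_harmonic R; rewrite -cvg_shiftS.
have sub : (`]0%R, c]%classic : set RM) = \bigcup_k (`[e k, c]%classic : set RM).
  apply/seteqP; split=> z /=; rewrite in_itv/=.
    move=> /andP[z0 zc]; exists (Num.truncn (c / z)) => //=; rewrite in_itv/= zc andbT.
    rewrite /e ler_pdivrMr// -ler_pdivrMl// mulrC ltW//.
    apply: (lt_trans (truncnS_gt _)); by rewrite ltr_nat.
  by move=> [k _] /=; rewrite in_itv/= => /andP[ez ->]; rewrite andbT (lt_le_trans (e0 k)).
have nd k m : (k <= m)%N -> `[e k, c]%classic `<=` (`[e m, c]%classic : set RM).
  move=> km z; rewrite /= !in_itv/= => /andP[ez ->]; rewrite andbT (le_trans _ ez)//.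
  by rewrite /e ler_pM2l// lef_pV2 ?posrE// ler_nat !ltnS.
have mf : measurable_fun (`]0%R, c]%classic : set RM) (f : RM -> RM) 
  by apply: measurable_half_power => // z /=; rewrite !in_itv/= => /andP[-> _].
rewrite integral_itv_bndo_bndc; last first.
  by apply/measurable_EFinP; apply: measurable_half_power => // z /=; rewrite !in_itv/= => /andP[-> _].
have := @ge0_nondecreasing_set_cvg_integral _ RM R (fun k => `[e k, c]%classic) (fun z => (f z)%:E) mu.
rewrite -sub => /(_ _ _ _ _)/cvg_lim <- //.
- apply/cvg_lim => //.
  rewrite (_ : (fun i => _) = (EFin \o (fun k => F c - F (e k)))); last first.
    by apply/funext => k; rewrite key.
  apply: cvg_EFin; first exact: nearW.
  rewrite /comp/= -[X in _ --> X](subr0 (F c)); apply: cvgB; first exact: cvg_cst.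
  rewrite (_ : 0 = F 0); last by rewrite /F sqrtr0 expr0n mulr0.
  apply: (cvg_comp _ F _ (cF _)).
  exact: ec0.
- by move=> k m km; apply/subsetPset; exact: nd.
- move=> k; apply/measurable_EFinP; apply: (measurable_funS _ _ mf) => //.
  by move=> z /=; rewrite !in_itv/= => /andP[ez ->]; rewrite andbT (lt_le_trans (e0 k)).
- by move=> k z _; rewrite lee_fin divr_ge0// exprn_ge0.
Qed.

End half_power.

Section half_gamma.
Context {R : realType}.
Notation mu := (@lebesgue_measure R).
Notation RM := (measurableTypeR R).
Local Notation u := (@arcsine_seq R).

(** Limit of the total masses 1 of the discrete laws. *)
Lemma integral_arcsine_pdf (l : R) : 0 < l -> (\int[mu]_t (arcsine_pdf l t)%:E = 1)%E.
Proof.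
move=> l0; have c1 : continuous (cst 1 : R -> R) by exact: cst_continuous.
have := discrete_arcsine_cvg l0 c1.
have h1 (t : R) : 0 <= cst (1 : R) t <= 1 by rewrite /= ler01 lexx.
move=> /(_ h1); rewrite (_ : (fun n => _) = cst 1%E); last first.
  apply/funext => n; rewrite /cst -[in RHS](@arcsine_seq_conv R n.+1).
  by congr (_%:E); apply: eq_bigr => i _; rewrite mulr1.
rewrite (_ : (\int[mu]_t _ = \int[mu]_t (arcsine_pdf l t)%:E)%E); last first.
  by apply: eq_integral => t _; rewrite /= mul1r.
by move=> /cvg_lim <- //; rewrite lim_cst.
Qed.

(** Anticipates 1 / Gamma((n+1)/2), proved in [Gamma_half]; the recursion is the
    one produced by convolution with the exponential density. *)
Fixpoint half_gamma_coef (n : nat) : R :=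
  match n with
  | 0 => Num.sqrt arcsine_const
  | 1 => 1
  | m.+2 => half_gamma_coef m * (2 / m.+1%:R)
  end.

Lemma half_gamma_coef_ge0 n : 0 <= half_gamma_coef n.
Proof.
suff: 0 <= half_gamma_coef n /\ 0 <= half_gamma_coef n.+1 by case.
elim: n => [|n [ih1 ih2]]; first by rewrite /= ler01 sqrtr_ge0.
by split=> //=; rewrite mulr_ge0// divr_ge0.
Qed.

Variable r : R.
Hypothesis r0 : 0 < r.

(** The Gamma density of shape (n+1)/2 and rate r, with the powers of c written
    through square roots. *)
Definition half_gamma (n : nat) (c : R) : R :=
  if 0 < c then half_gamma_coef n * Num.sqrt r ^+ n.+1 *
    (Num.sqrt c ^+ n / Num.sqrt c) * expR (- (r * c)) else 0.

Lemma half_gamma_ge0 n c : 0 <= half_gamma n c.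
Proof.
rewrite /half_gamma; case: ifP => // c0.
by rewrite !mulr_ge0 ?expR_ge0 ?half_gamma_coef_ge0 ?invr_ge0 ?exprn_ge0 ?sqrtr_ge0.
Qed.

Lemma half_gamma_le0 n c : c <= 0 -> half_gamma n c = 0.
Proof. by move=> c0; rewrite /half_gamma ltNge c0. Qed.

Lemma measurable_half_gamma n : measurable_fun setT (half_gamma n : RM -> RM).
Proof.
pose f (c : R) := half_gamma_coef n * Num.sqrt r ^+ n.+1 *
    (Num.sqrt c ^+ n / Num.sqrt c) * expR (- (r * c)).
rewrite (_ : half_gamma n = f \_ `]0, +oo[%classic); last first.
  by apply/funext => c; rewrite patchE mem_setE in_itv/= andbT.
apply/(measurable_restrictT f) => //.
apply: open_continuous_measurable_fun; first exact: interval_open.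
move=> z; rewrite inE/= in_itv/= andbT => z0.
have cs : {for z, continuous (Num.sqrt : R -> R)} by exact: sqrt_continuous.
have cX k : {for z, continuous (fun x : R => Num.sqrt x ^+ k)}.
  exact: (continuous_comp cs (@exprn_continuous _ k _)).
apply: (@cvgM R R (nbhs z)).
  apply: (@cvgM R R (nbhs z)); first exact: cvg_cst.
  apply: (@cvgM R R (nbhs z)); first exact: cX.
  by apply: (continuousV _ cs); rewrite sqrtr_eq0 -ltNge.
apply: (cvg_comp _ (@expR R)); last exact: continuous_expR.
by apply: cvgN; apply: (@cvgM R R (nbhs z)); first exact: cvg_cst.
Qed.

(** The identity behind the theorem: an exponential length cut by the arcsine law
    yields two independent variables with density half_gamma 0. *)
Lemma half_gamma0M (c x : R) :
  half_gamma 0 x * half_gamma 0 (c - x) = half_gamma 1 c * arcsine_pdf c x.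
Proof.
rewrite /half_gamma /arcsine_pdf subr_gt0.
have [x0|x0] := ltP 0 x; last by rewrite mul0r mulr0.
have [xc|xc] := ltP x c; last by rewrite !mulr0.
have c0 := lt_trans x0 xc; rewrite c0 /= !expr0 !expr1.
have sr : Num.sqrt r ^+ 2 = r by rewrite sqr_sqrtr// ltW.
have sk : Num.sqrt (@arcsine_const R) ^+ 2 = arcsine_const by rewrite sqr_sqrtr// ltW// arcsine_const_gt0.
rewrite sqrtrM ?ltW//.
have -> : expR (- (r * c)) = expR (- (r * x)) * expR (- (r * (c - x))) :> R.
  by rewrite -expRD; congr expR; ring.
have s1 : Num.sqrt c != 0 by rewrite sqrtr_eq0 -ltNge.
have s2 : Num.sqrt x != 0 by rewrite sqrtr_eq0 -ltNge.
have s3 : Num.sqrt (c - x) != 0 by rewrite sqrtr_eq0 -ltNge subr_gt0.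
rewrite -[in RHS]sk divff//; field; by rewrite s2 s3.
Qed.

Local Open Scope ereal_scope.

Lemma conv_half_gamma0 (c : R) :
  \int[mu]_x (half_gamma 0 x * half_gamma 0 (c - x))%:E = (half_gamma 1 c)%:E.
Proof.
under eq_integral do rewrite half_gamma0M EFinM.
have [c0|c0] := ltP 0%R c; last first.
  by rewrite half_gamma_le0// integral0_eq// => x _; rewrite mul0e.
rewrite ge0_integralZl//; last 3 first.
- by apply/measurable_EFinP; exact: measurable_arcsine_pdf.
- by move=> x _; rewrite lee_fin arcsine_pdf_ge0.
- by rewrite lee_fin half_gamma_ge0.
by rewrite integral_arcsine_pdf// mule1.
Qed.

(** The two densities differ at 0 only. *)
Lemma exponential_probE (A : set RM) : measurable A ->
  exponential_prob r A = \int[mu]_(c in A) (half_gamma 1 c)%:E.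
Proof.
move=> mA; rewrite /exponential_prob.
have me : measurable_fun setT (exponential_pdf r : RM -> RM) by exact: measurable_exponential_pdf.
apply: ge0_ae_eq_integral => //.
- by apply/measurable_EFinP/measurable_funTS.
- by apply/measurable_EFinP/measurable_funTS; exact: measurable_half_gamma.
- by move=> x _; rewrite lee_fin exponential_pdf_ge0 ?ltW.
- by move=> x _; rewrite lee_fin half_gamma_ge0.
exists [set (0%R : R)]; split => //.
- exact: lebesgue_measure_set1.
move=> x /=; apply: contra_notP => /eqP x0 _.
have [xp|xn|xe] := ltgtP 0%R x; last by rewrite -xe eqxx in x0.
  rewrite exponential_pdfE ?ltW// /half_gamma xp expr1 divff; last by rewrite sqrtr_eq0 -ltNge.
  by rewrite sqr_sqrtr ?ltW// /= mul1r mulr1 mulNr.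
by rewrite lt0_exponential_pdf// half_gamma_le0// ltW.
Qed.

(** The convolution of two densities has the product of their masses. *)
Lemma ge0_integral_convolution (f g : R -> R) :
  measurable_fun setT (f : RM -> RM) -> measurable_fun setT (g : RM -> RM) ->
  (forall x, 0 <= f x)%R -> (forall x, 0 <= g x)%R ->
  \int[mu]_c \int[mu]_z (f z * g (c - z))%:E = \int[mu]_z (f z)%:E * \int[mu]_z (g z)%:E.
Proof.
move=> mf mg f0 g0.
have mfg : measurable_fun setT (fun z : RM * RM => (f z.2 * g (z.1 - z.2))%R%:E).
  apply/measurable_EFinP; apply: measurable_funM; first exact: measurableT_comp.
  apply: (measurableT_comp mg); exact: measurable_funB.
rewrite (fubini_tonelli (m1 := mu) (m2 := mu) (fun z : RM * RM => (f z.2 * g (z.1 - z.2))%R%:E)) => //; last first.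
  by move=> z; rewrite lee_fin mulr_ge0.
rewrite -ge0_integralZr//=; last 3 first.
- exact/measurable_EFinP.
- by move=> x _; rewrite lee_fin.
- by apply: integral_ge0 => x _; rewrite lee_fin.
apply: eq_integral => z _ /=.
under eq_integral do rewrite EFinM.
rewrite ge0_integralZl//; last 3 first.
- by apply/measurable_EFinP; apply: (measurableT_comp mg); exact: measurable_funB.
- by move=> x _; rewrite lee_fin.
- by rewrite lee_fin.
congr (_ * _).
rewrite -(ge0_integral_translation (- z) (f := fun x => (g x)%:E)).
- by apply: eq_integral => x _; rewrite addrC.
- exact/measurable_EFinP.
- by move=> x; rewrite lee_fin.
Qed.

Lemma conv_half_gamma1 n (c : R) :
  \int[mu]_z (half_gamma n z * half_gamma 1 (c - z))%:E = (half_gamma n.+2 c)%:E.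
Proof.
have [c0|c0] := ltP 0%R c; last first.
  rewrite half_gamma_le0// integral0_eq// => x _.
  have [x0|x0] := leP x 0%R; first by rewrite half_gamma_le0// mul0r.
  by rewrite [X in (_ * X)%R]half_gamma_le0 ?mulr0// subr_le0 (le_trans c0)// ltW.
pose k := (half_gamma_coef n * Num.sqrt r ^+ n.+3 * expR (- (r * c)))%R.
transitivity (\int[mu]_(z in `]0%R, c[) (k * (Num.sqrt z ^+ n / Num.sqrt z))%:E).
  rewrite [RHS]integral_mkcond; apply: eq_integral => z _.
  rewrite patchE mem_setE in_itv/= /half_gamma subr_gt0.
  have [z0|z0] := ltP 0%R z; last by rewrite mul0r.
  have [zc|zc] := ltP z c; last by rewrite mulr0.
  congr (_%:E); rewrite /k expr1 divff; last by rewrite sqrtr_eq0 -ltNge subr_gt0.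
  have -> : expR (- (r * c)) = (expR (- (r * z)) * expR (- (r * (c - z))))%R :> R.
    by rewrite -expRD; congr expR; ring.
  by rewrite /= !exprS; ring.
under eq_integral do rewrite EFinM.
have k0 : (0 <= k)%R by rewrite /k mulr_ge0 ?expR_ge0// mulr_ge0 ?half_gamma_coef_ge0// exprn_ge0 ?sqrtr_ge0.
rewrite ge0_integralZl//; last first.
  by apply/measurable_EFinP; apply: measurable_half_power => // z /=; rewrite !in_itv/= => /andP[-> _].
rewrite integral_half_power// -EFinM; congr (_%:E); rewrite /k /half_gamma c0 /=.
have s1 : Num.sqrt c != 0%R by rewrite sqrtr_eq0 -ltNge.
have n0 : n.+1%:R != 0%R :> R by rewrite pnatr_eq0.
by rewrite !exprS; field; rewrite s1 addrC natr1 n0.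
Qed.

(** The square of the mass of half_gamma 0 is the mass of the exponential
    density; the other shapes follow by convolution with it. *)
Lemma integral_half_gamma n : \int[mu]_c (half_gamma n c)%:E = 1.
Proof.
have m n := measurable_half_gamma n; have g0 n := half_gamma_ge0 n.
have h1 : \int[mu]_c (half_gamma 1 c)%:E = 1.
  have := exponential_probE measurableT.
  by rewrite /exponential_prob integral_exponential_pdf// => <-.
suff: \int[mu]_c (half_gamma n c)%:E = 1 /\ \int[mu]_c (half_gamma n.+1 c)%:E = 1 by case.
elim: n => [|n [ih1 ih2]]; last first.
  split => //; have := ge0_integral_convolution (m n) (m 1%N) (g0 n) (g0 1%N).
  by rewrite ih1 h1 mule1 => <-; apply: eq_integral => c _; rewrite conv_half_gamma1.
split => //; have := ge0_integral_convolution (m 0%N) (m 0%N) (g0 0%N) (g0 0%N).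
rewrite -[LHS]/(\int[mu]_c \int[mu]_z (half_gamma 0 z * half_gamma 0 (c - z))%:E).
under eq_integral do rewrite conv_half_gamma0.
rewrite h1; set I := \int[mu]_c _.
have : 0 <= I by apply: integral_ge0 => x _; rewrite lee_fin.
case: I => [x| |]; [|by move=> _; rewrite mulyy|by []].
rewrite lee_fin => x0; rewrite -EFinM => -[] /esym/eqP; rewrite -expr2 -[X in _ == X](expr1n _ 2).
by rewrite eqrXn2// => /eqP ->.
Qed.

Definition half_gamma_measure : {finite_measure set RM -> \bar R} :=
  density_finite_measure (measurable_half_gamma 0) (half_gamma_ge0 0)
    (eq_ind_r (fun x => x < +oo) (ltry 1) (integral_half_gamma 0)).

Fixpoint half_gamma_pow (n : nat) : {finite_measure set RM -> \bar R} :=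
  if n is m.+1 then conv (half_gamma_pow m) half_gamma_measure else @dirac0 R.

Lemma ge0_integral_half_gamma_powS n (f : RM -> \bar R) :
  measurable_fun setT f -> (forall x, 0 <= f x) ->
  \int[half_gamma_pow n.+1]_x f x =
  \int[half_gamma_pow n]_x \int[mu]_y (f (x + y)%R * (half_gamma 0 y)%:E).
Proof.
move=> mf f0; rewrite [LHS](ge0_integral_conv _ _ mf f0).
apply: eq_integral => x _.
rewrite (ge0_integral_density_measure _ _ _ (f := fun y => f (x + y)%R)) => //.
by apply: (measurableT_comp mf); exact: measurable_funD.
Qed.

Let mhg n c : measurable_fun setT (fun x : RM => (half_gamma n (c - x))%:E).
Proof.
apply/measurable_EFinP; apply: (measurableT_comp (measurable_half_gamma n)).
exact: measurable_funB.
Qed.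

Let hg_ge0 n c : 0 <= (half_gamma n c)%:E.
Proof. by rewrite lee_fin half_gamma_ge0. Qed.

Let half_gamma_pow_conv0 n (c : R) :
  \int[half_gamma_pow n.+1]_x (half_gamma 0 (c - x))%:E =
  \int[half_gamma_pow n]_x (half_gamma 1 (c - x))%:E.
Proof.
rewrite (ge0_integral_half_gamma_powS n (f := fun x => (half_gamma 0 (c - x))%:E))//.
apply: eq_integral => x _; rewrite -conv_half_gamma0; apply: eq_integral => y _.
by rewrite -EFinM mulrC opprD addrA.
Qed.

(** Additivity of the shape parameter.  The last two factors g * g are first
    merged into the exponential density, which leaves the elementary integral of
    [conv_half_gamma1]. *)
Lemma half_gamma_pow_conv n (c : R) :
  \int[half_gamma_pow n]_x (half_gamma 0 (c - x))%:E = (half_gamma n c)%:E.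
Proof.
suff: forall c, \int[half_gamma_pow n]_x (half_gamma 0 (c - x))%:E = (half_gamma n c)%:E /\
  \int[half_gamma_pow n.+1]_x (half_gamma 0 (c - x))%:E = (half_gamma n.+1 c)%:E by move=> /(_ c)[].
have i0 k d : \int[half_gamma_pow 0]_x (half_gamma k (d - x))%:E = (half_gamma k d)%:E.
  by rewrite [LHS]integral_dirac ?diracT ?mul1e ?subr0.
elim: n => [|n ih] {}c; first by rewrite half_gamma_pow_conv0 !i0.
split; first by have [] := ih c.
rewrite half_gamma_pow_conv0 (ge0_integral_half_gamma_powS n (f := fun x => (half_gamma 1 (c - x))%:E))//.
transitivity (\int[half_gamma_pow n]_x \int[mu]_z (half_gamma 1 (c - z) * half_gamma 0 (z - x))%:E).
  apply: eq_integral => x _.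
  rewrite -(ge0_integral_translation x (f := fun z => (half_gamma 1 (c - z) * half_gamma 0 (z - x))%:E)).
  - by apply: eq_integral => y _; rewrite -EFinM addrAC subrr add0r.
  - apply/measurable_EFinP; apply: measurable_funM.
      by apply: (measurableT_comp (measurable_half_gamma 1)); exact: measurable_funB.
    apply: (measurableT_comp (measurable_half_gamma 0)); exact: measurable_funB.
  - by move=> z; rewrite lee_fin mulr_ge0// half_gamma_ge0.
rewrite (fubini_tonelli (m1 := half_gamma_pow n) (m2 := mu)
   (fun z : RM * RM => (half_gamma 1 (c - z.2) * half_gamma 0 (z.2 - z.1))%:E)); last 2 first.
- apply/measurable_EFinP; apply: measurable_funM.
    apply: (measurableT_comp (measurable_half_gamma 1)); exact: measurable_funB.
  apply: (measurableT_comp (measurable_half_gamma 0)); exact: measurable_funB.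
- by move=> z; rewrite lee_fin mulr_ge0// half_gamma_ge0.
rewrite -conv_half_gamma1; apply: eq_integral => z _ /=.
under eq_integral do rewrite EFinM.
rewrite ge0_integralZl//.
by have [-> _] := ih z; rewrite -EFinM mulrC.
Qed.

End half_gamma.

Section gamma_half_integers.
Context {R : realType}.
Notation RM := (measurableTypeR R).
Notation mu := (@lebesgue_measure R).

Lemma half_powR n (t : R) : 0 < t -> t `^ (n.+1%:R / 2 - 1) = Num.sqrt t ^+ n / Num.sqrt t.
Proof.
move=> t0.
have -> : n.+1%:R / 2 - 1 = 2^-1 * n%:R + - 2^-1 :> R by rewrite -natr1; field.
rewrite powRD; last by rewrite (gt_eqF t0) implybT.
by rewrite powRrM powRN powR12_sqrt ?ltW// powR_mulrn.
Qed.

(** Total mass of the density at r = 1. *)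
Lemma Gamma_half n : @half_gamma_coef R n * Gamma (n.+1%:R / 2) = 1.
Proof.
have := integral_half_gamma (@ltr01 R) n.
have c0 := @half_gamma_coef_ge0 R n.
have -> : (\int[mu]_c (half_gamma 1 n c)%:E = (half_gamma_coef n)%:E *
    \int[mu]_(t in `]0%R, +oo[) (t `^ (n.+1%:R / 2 - 1) * expR (- t))%:E)%E.
  rewrite -ge0_integralZl//; last 2 first.
  - apply/measurable_EFinP/measurable_funTS; apply: measurable_funM; first exact: measurable_powR.
    have mN : measurable_fun setT (fun x : RM => - x : RM) by exact: measurable_funN.
    exact: (measurableT_comp (@measurable_expR R) mN).
  - by move=> t _; rewrite lee_fin mulr_ge0 ?expR_ge0 ?powR_ge0.
  rewrite [RHS]integral_mkcond; apply: eq_integral => t _.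
  rewrite patchE mem_setE in_itv/= andbT /half_gamma; case: ifPn => // t0.
  by rewrite half_powR// sqrtr1 expr1n mul1r mulr1 -EFinM -mulrA.
rewrite /Gamma /Rintegral; set I := (\int[mu]_(t in _) _)%E.
have : (0 <= I)%E by apply: integral_ge0 => t _; rewrite lee_fin mulr_ge0 ?expR_ge0 ?powR_ge0.
case: I => [x| |] //=; first by move=> _ [].
move=> _; move: c0; rewrite le_eqVlt => /orP[/eqP<-|c0].
  by rewrite mul0e => -[] /esym/eqP; rewrite oner_eq0.
by rewrite gt0_muley ?lte_fin.
Qed.

End gamma_half_integers.

(** * Times spent on each side before a reset *)

Section exponential_tail.
Context {R : realType}.
Variable r : R.
Hypothesis r0 : 0 < r.

(** Up to the factor r, the tail is the density itself: this is why the current,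
    incomplete piece contributes like a complete one. *)
Lemma exponential_prob_tail (s : R) : 0 <= s ->
  exponential_prob r `[s, +oo[ = (expR (- (r * s)))%:E.
Proof.
move=> s0; rewrite /exponential_prob.
have cE : continuous (fun x : R => expR (- r * x)).
  move=> x; apply: (continuous_comp (f := fun x => - r * x)); last exact: continuous_expR.
  exact: mulrl_continuous.
rewrite (@ge0_continuous_FTC2y _ _ (fun x => - expR (- r * x)) _ 0)//.
- by rewrite sub0e -EFinN opprK mulNr.
- by move=> x _; apply: exponential_pdf_ge0; exact: ltW.
- apply: (@continuous_subspaceW R^o _ _ [set` `[0, +oo[%R]).
    by move=> x /=; rewrite !in_itv/= !andbT; exact: le_trans.
  exact: within_continuous_exponential_pdf.
- rewrite -oppr0; apply: cvgN.
  rewrite (_ : (fun x => expR (- r * x)) =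
               (fun z => expR (- z)) \o (fun z => r * z)); last first.
    by apply: eq_fun => x; rewrite mulNr.
  apply: (@cvg_comp _ _ _ _ _ _ (pinfty_nbhs R)); last exact: cvgr_expR.
  exact: gt0_cvgMry.
- by apply: cvgN; apply/cvg_at_right_filter; exact: cE.
- move=> z; rewrite in_itv/= andbT => sz; apply: derive1_exponential_pdf.
  by rewrite in_itv/= andbT (le_lt_trans s0).
Qed.
End exponential_tail.

Section reset_chain.
Context {R : realType} d (Omega : measurableType d) (P : probability Omega R).
Notation RM := (measurableTypeR R).
Notation mu := (@lebesgue_measure R).
Variables (r : R) (S : nat -> {RV P >-> R}) (B : nat -> R -> {RV P >-> R}).
Hypothesis r0 : 0 < r.
Hypothesis hS : poisson_process r S.
Hypothesis hB : forall k, standard_brownian_motion (B k).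
Hypothesis hI : mutually_independent P (fun i : option nat =>
          match i with
          | None => sigma_of setT (fun k => S k : Omega -> R)
          | Some k => sigma_of `[0, +oo[ (fun t => B k t : Omega -> R)
          end).

Definition piece_gen (n : nat) : set (set Omega) :=
  \bigcup_(t in `[0, +oo[%classic) preimage_set_system setT (B n t : Omega -> R) measurable.
(** Omega with the sigma-algebra generated by the n-th piece: independence is
    known only for events of these sigma-algebras, so the pieces enter the chain
    as inputs valued in different measurable spaces. *)
Definition piece_space (n : nat) := g_sigma_algebraType (piece_gen n).

Definition gap (n : nat) (w : Omega) : RM := S n.+1 w - S n w.

Lemma measurable_gap n : measurable_fun setT (gap n).
Proof. by apply: measurable_funB; exact: measurable_funP. Qed.

Let piece_gen_sub n : piece_gen n `<=` @measurable _ Omega.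
Proof.
move=> A [t _ [C mC <-]].
by apply: (measurable_funP (B n t)).
Qed.

Definition piece_id (n : nat) (w : Omega) : piece_space n := w.

Lemma measurable_piece_id n : measurable_fun setT (piece_id n).
Proof.
move=> _ A mA; rewrite setTI; apply: (smallest_sub _ _ mA); last exact: piece_gen_sub.
exact: sigma_algebra_measurable.
Qed.

Lemma measurable_piece n :
  measurable_fun setT (fun z : RM * piece_space n => (B n (Num.max 0 z.1) : Omega -> R) z.2).
Proof.
apply: (measurable_continuous_process (Omega := piece_space n) (X := fun t => (B n t : Omega -> R))).
  move=> t t0 _ C mC; rewrite setTI.
  apply: sub_sigma_algebra; exists t; first by rewrite /= in_itv/= t0.
  by exists C => //; rewrite setTI.
by have [_ cB _ _] := hB n.
Qed.

Definition piece_occ (n : nat) (z : RM * piece_space n) : RM :=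
  occupation_time (fun t => (B n t : Omega -> R)) z.1 z.2.

Lemma measurable_piece_occ n : measurable_fun setT (@piece_occ n).
Proof. exact: (measurable_occupation_time (@measurable_piece n)). Qed.

(** The n-th input of the chain: the length of the n-th piece and its path. *)
Definition piece_input (n : nat) (w : Omega) : RM * piece_space n := (gap n w, w).

Lemma measurable_piece_input n : measurable_fun setT (piece_input n).
Proof. by apply: measurable_fun_pair; [exact: measurable_gap|exact: measurable_piece_id]. Qed.

Definition piece_rect (n : nat) : set (set (RM * piece_space n)) :=
  [set A `*` D | A in measurable & D in measurable].

Definition occ_step (n : nat) (z : (RM * RM) * (RM * piece_space n)) : RM * RM :=
  (z.1.1 + piece_occ z.2, z.1.2 + (z.2.1 - piece_occ z.2)).

(** Positive and negative times accumulated over the first n pieces. *)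
Definition occ_state (n : nat) (w : Omega) : RM * RM :=
  (\sum_(k < n) piece_occ (piece_input k w), \sum_(k < n) (gap k w - piece_occ (piece_input k w))).

Let state0 w : occ_state 0 w = (0, 0).
Proof. by rewrite /occ_state !big_ord0. Qed.

Let stateS n w : occ_state n.+1 w = occ_step (occ_state n w, piece_input n w).
Proof. by rewrite /occ_state !big_ord_recr. Qed.

Lemma occ_state_sum n w : (occ_state n w).1 + (occ_state n w).2 = S n w.
Proof.
rewrite /occ_state /= -big_split/=; have [S0 _ _] := hS.
elim: n => [|n ih]; first by rewrite big_ord0 S0.
by rewrite big_ord_recr/= ih [X in _ + X]addrC subrK /gap addrC subrK.
Qed.

Let mstep n : measurable_fun setT (@occ_step n).
Proof.
have mo : measurable_fun setT (fun z : (RM * RM) * (RM * piece_space n) => piece_occ z.2 : RM).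
  by apply: (measurableT_comp (@measurable_piece_occ n)).
apply: measurable_fun_pair; first by apply: measurable_funD => //; exact: measurableT_comp.
apply: measurable_funD; first exact: measurableT_comp.
by apply: measurable_funB => //; exact: measurableT_comp.
Qed.

Let gap_indep N (A : nat -> set RM) : (forall n, measurable (A n)) ->
  P [set w | forall i, (i < N)%N -> A i (gap i w)] =
  (\prod_(0 <= i < N) P (gap i @^-1` A i))%E.
Proof.
move=> mA; have [_ _ ind] := hS.
apply: (mutually_independent_prefix (e := id) (A := fun i => gap i @^-1` A i) N _ ind) => // i.
apply: sub_sigma_algebra; exists i => //.
by exists (A i); [exact: mA|rewrite setTI].
Qed.

Let gap_law n (Y : set RM) : measurable Y -> P (gap n @^-1` Y) = exponential_prob r Y.
Proof. by move=> mY; have [_ law _] := hS; exact: law. Qed.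

(** Events on the gaps belong to the sigma-algebra of the Poisson process, the
    one that is independent of the pieces. *)
Let gap_event N (A : nat -> set RM) : (forall n, measurable (A n)) ->
  sigma_of setT (fun k => S k : Omega -> R) [set w | forall i, (i < N)%N -> A i (gap i w)].
Proof.
move=> mA; pose G := \bigcup_(i in setT) preimage_set_system setT (S i : Omega -> R) measurable.
pose O := g_sigma_algebraType G.
have mS i : measurable_fun setT (S i : O -> RM).
  move=> _ C mC; apply: sub_sigma_algebra; exists i => //.
  by exists C => //; rewrite setTI.
have mg i : measurable_fun setT (gap i : O -> RM) by exact: (measurable_funB (mS i.+1) (mS i)).
rewrite -[sigma_of _ _]/(@measurable _ O).
rewrite (_ : [set w | _] = \bigcap_(i in [set i | (i < N)%N]) (gap i @^-1` A i))//.
apply: (@bigcap_measurableType _ O) => i _.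
by rewrite -[X in measurable X]setTI; apply: mg.
Qed.

Let input_prod N (A : nat -> set RM) (D : nat -> set Omega) : (forall n, measurable (A n)) ->
  (forall n, @measurable _ (piece_space n) (D n)) ->
  P [set w | forall i, (i < N)%N -> A i (gap i w) /\ D i w] =
  (\prod_(0 <= i < N) P (gap i @^-1` A i) * \prod_(0 <= i < N) P (D i))%E.
Proof.
move=> mA mD.
pose e (i : nat) : option nat := if i is j.+1 then Some j else None.
pose E (i : nat) : set Omega :=
  if i is j.+1 then D j else [set w | forall i, (i < N)%N -> A i (gap i w)].
have inje : injective e by move=> [|i] [|j]//= [->].
have := @mutually_independent_prefix _ _ _ P _ _ e E N.+1 inje hI.
have FE i : match e i with
    | None => sigma_of setT (fun k => S k : Omega -> R)
    | Some k => sigma_of `[0, +oo[ (fun t => B k t : Omega -> R)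
    end (E i) by case: i => [|i]; [exact: gap_event|exact: mD].
move=> /(_ FE).
rewrite big_nat_recl//= gap_indep// => <-.
congr (P _); apply/seteqP; split => w /= h.
  by move=> [|i] iN /=; [move=> j jN; have [] := h j jN|have [] := h i iN].
by move=> i iN; split; [exact: (h 0%N)|exact: (h i.+1)].
Qed.

(** The case of one index is obtained from [input_prod] by taking full events for
    the other indices. *)
Let input_law1 n (A : set RM) (D : set (piece_space n)) : measurable A -> measurable D ->
  P (piece_input n @^-1` (A `*` D)) = (P (gap n @^-1` A) * P D)%E.
Proof.
move=> mA mD.
pose A' (i : nat) := if i == n then A else setT.
pose D' := @eqtype.dfwith _ (fun i => set (piece_space i)) (fun i => setT) n D.
have mA' i : measurable (A' i) by rewrite /A'; case: ifP.
have mD' i : @measurable _ (piece_space i) (D' i) by rewrite /D'; case: eqtype.dfwithP.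
have := @input_prod n.+1 A' D' mA' mD'.
have E1 : (\prod_(0 <= i < n) P (gap i @^-1` A' i) = 1)%E.
  apply: big1_seq => i; rewrite mem_index_iota => /andP[_ /andP[_ iN]].
  by rewrite /A' ltn_eqF// preimage_setT probability_setT.
have E2 : (\prod_(0 <= i < n) P (D' i) = 1)%E.
  apply: big1_seq => i; rewrite mem_index_iota => /andP[_ /andP[_ iN]].
  by rewrite /D' eqtype.dfwith_out ?probability_setT// gtn_eqF.
rewrite !big_nat_recr//= E1 E2 !mul1e /A' eqxx /D' eqtype.dfwith_in => <-.
congr (P _); apply/seteqP; split => w /=.
  move=> [Aw Dw] i iN; case: eqVneq => [->|ni]; first by rewrite eqtype.dfwith_in.
  by rewrite eqtype.dfwith_out// eq_sym.
by move=> /(_ n (ltnSn n)); rewrite eqxx eqtype.dfwith_in.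
Qed.

Let input_indep N (C : forall n, set (RM * piece_space n)) : (forall n, piece_rect (C n)) ->
  P [set w | forall i, (i < N)%N -> C i (piece_input i w)] =
  (\prod_(0 <= i < N) P (piece_input i @^-1` C i))%E.
Proof.
move=> KC.
have /choice[A hA] n : exists A, measurable A /\ exists2 D, measurable D & A `*` D = C n.
  by have [A mA [D mD AD]] := KC n; exists A; split => //; exists D.
have /choice[D hD] n : exists D : set Omega, @measurable _ (piece_space n) D /\
    A n `*` (D : set (piece_space n)) = C n.
  by have [mA [D mD AD]] := hA n; exists D.
have mA n := (hA n).1; have mD n := (hD n).1.
transitivity (\prod_(0 <= i < N) (P (gap i @^-1` A i) * P (D i)))%E.
  rewrite big_split/= -input_prod//; congr (P _).
  by apply/seteqP; split => w h i /h; rewrite -(hD i).2.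
by apply: eq_bigr => i _; rewrite -(hD i).2 input_law1.
Qed.

Let KE n : @measurable _ (RM * piece_space n)%type = <<s @piece_rect n >>.
Proof. exact: measurable_prod_measurableType. Qed.

Let KI n : setI_closed (@piece_rect n).
Proof.
move=> _ _ [A1 mA1 [D1 mD1 <-]] [A2 mA2 [D2 mD2 <-]].
exists (A1 `&` A2); first exact: measurableI.
by exists (D1 `&` D2); [exact: measurableI|rewrite setXI].
Qed.

Let KT n : @piece_rect n setT.
Proof. by exists setT => //; exists setT => //; rewrite setXTT. Qed.

Definition measurable_occ_state n : measurable_fun setT (occ_state n) :=
  measurable_chain measurable_piece_input mstep state0 stateS n.

(** Law of the path of a piece, on the sigma-algebra that it generates. *)
Definition piece_law (n : nat) : {finite_measure set (piece_space n) -> \bar R} :=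
  law P (@measurable_piece_id n).

Definition gap_measure (n : nat) : {finite_measure set RM -> \bar R} :=
  law P (@measurable_gap n).

Local Open Scope ereal_scope.

Lemma ge0_integral_input n (h : RM * piece_space n -> \bar R) : measurable_fun setT h ->
  (forall z, 0 <= h z) ->
  \int[P]_w h (piece_input n w) = \int[gap_measure n]_l \int[piece_law n]_w h (l, w).
Proof.
move=> mh h0; rewrite -ge0_integral_finite_prod//.
rewrite -(ge0_integral_law P (@measurable_piece_input n))//.
apply: eq_measure_integral => A mA _.
apply: (finite_prod_unique (m1 := gap_measure n) (m2 := piece_law n)) => // A' D mA' mD.
exact: input_law1.
Qed.

Lemma ge0_integral_occ_chain n (h : (RM * RM) * (RM * piece_space n) -> \bar R) :
  measurable_fun setT h -> (forall z, 0 <= h z) ->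
  \int[P]_w h (occ_state n w, piece_input n w) =
  \int[law P (measurable_occ_state n)]_x \int[gap_measure n]_l \int[piece_law n]_w h (x, (l, w)).
Proof.
move=> mh h0.
transitivity (\int[law P (measurable_occ_state n)]_x
    \int[law P (@measurable_piece_input n)]_u h (x, u)).
  exact: (ge0_integral_chain KE KI KT measurable_piece_input input_indep mstep state0 stateS mh h0).
apply: eq_integral => x _.
rewrite (ge0_integral_law P (@measurable_piece_input n))//; last first.
  by apply: (measurableT_comp mh); exact: measurable_fun_pair.
rewrite (ge0_integral_input (h := fun u => h (x, u)))//.
by apply: (measurableT_comp mh); exact: measurable_fun_pair.
Qed.

Notation hg := (half_gamma r).
Notation gam := (half_gamma_measure r0).
Notation gpow := (half_gamma_pow r0).

Let mocc_at n (l : RM) : measurable_fun setT (fun w : piece_space n => piece_occ (l, w)).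
Proof. by apply: (measurableT_comp (@measurable_piece_occ n)); exact: measurable_fun_pair. Qed.

(** Lévy's law at a fixed length l, transported to the space of the piece. *)
Lemma ge0_integral_piece_occ n (l : R) (f : RM -> \bar R) : (0 < l)%R ->
  measurable_fun setT f -> (forall x, 0 <= f x) ->
  \int[piece_law n]_w f (piece_occ (l, w)) = \int[mu]_x (f x * (arcsine_pdf l x)%:E).
Proof.
move=> l0 mf f0.
rewrite -(ge0_integral_law (piece_law n) (mocc_at l))//.
apply: ge0_integral_density => //.
- exact: measurable_arcsine_pdf.
- by move=> x; exact: arcsine_pdf_ge0.
- move=> A mA; exact: (levy_arcsine (hB n) l0 mA).
Qed.

Lemma ge0_integral_gap n (f : RM -> \bar R) : measurable_fun setT f -> (forall x, 0 <= f x) ->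
  \int[gap_measure n]_l f l = \int[mu]_l (f l * (hg 1 l)%:E).
Proof.
move=> mf f0; apply: ge0_integral_density => //.
- exact: measurable_half_gamma.
- by move=> x; exact: half_gamma_ge0.
- by move=> A mA; rewrite -exponential_probE// -(gap_law n).
Qed.

Let ge0_integral_gam (f : RM -> \bar R) : measurable_fun setT f -> (forall x, 0 <= f x) ->
  \int[gam]_x f x = \int[mu]_x (f x * (hg 0 x)%:E).
Proof. exact: ge0_integral_density_measure. Qed.

Let mpair_l (g : RM * RM -> \bar R) (x : RM) : measurable_fun setT g ->
  measurable_fun setT (fun y : RM => g (x, y)).
Proof. by move=> mg; apply: (measurableT_comp mg); exact: measurable_fun_pair. Qed.

(** Lévy's law conditionally on the length of the piece, then [half_gamma0M]
    and the change of variables (x, l) -> (x, l - x). *)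
Lemma ge0_integral_gap_split n (h : RM * RM -> \bar R) : measurable_fun setT h ->
  (forall z, 0 <= h z) ->
  \int[gap_measure n]_l \int[piece_law n]_w h (piece_occ (l, w), (l - piece_occ (l, w))%R) =
  \int[gam]_x \int[gam]_y h (x, y).
Proof.
move=> mh h0.
have m0 := @measurable_half_gamma _ r 0.
have m1 := @measurable_half_gamma _ r 1.
have g0 k x : (0 <= hg k x)%R by exact: half_gamma_ge0.
have mdiff : measurable_fun setT (fun z : RM * RM => h (z.2, (z.1 - z.2)%R)).
  apply: (measurableT_comp mh); apply: measurable_fun_pair => //; exact: measurable_funB.
have mF : measurable_fun setT (fun z : RM * RM =>
    h (z.2, (z.1 - z.2)%R) * (hg 0 z.2 * hg 0 (z.1 - z.2)%R)%:E).
  apply: emeasurable_funM => //; apply/measurable_EFinP; apply: measurable_funM.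
    exact: measurableT_comp.
  by apply: (measurableT_comp m0); exact: measurable_funB.
rewrite ge0_integral_gap; last 2 first.
- apply: (measurable_fun_fubini_tonelli_F (m2 := piece_law n) (fun z : RM * piece_space n =>
     h (piece_occ z, (z.1 - piece_occ z)%R))) => //.
  apply: (measurableT_comp mh).
  by apply: measurable_fun_pair; [exact: measurable_piece_occ|
     apply: measurable_funB => //; exact: measurable_piece_occ].
- by move=> l; apply: integral_ge0.
transitivity (\int[mu]_l \int[mu]_x (h (x, (l - x)%R) * (hg 0 x * hg 0 (l - x)%R)%:E)).
  apply: eq_integral => l _.
  have [l0|l0] := ltP 0%R l; last first.
    rewrite half_gamma_le0// mule0 integral0_eq// => x _.
    have [x0|x0] := leP x 0%R; first by rewrite half_gamma_le0// mul0r mule0.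
    by rewrite [X in (_ * X)%R]half_gamma_le0 ?mulr0 ?mule0// subr_le0 (le_trans l0)// ltW.
  have ml : measurable_fun setT (fun x : RM => h (x, (l - x)%R)).
    by apply: (measurableT_comp mh); apply: measurable_fun_pair => //; exact: measurable_funB.
  rewrite (ge0_integral_piece_occ n (f := fun x => h (x, (l - x)%R)))//.
  rewrite -ge0_integralZr//=; last 3 first.
  - by apply: emeasurable_funM => //; apply/measurable_EFinP; exact: measurable_arcsine_pdf.
  - by move=> x _; rewrite mule_ge0// lee_fin arcsine_pdf_ge0.
  - by rewrite lee_fin.
  by apply: eq_integral => x _; rewrite half_gamma0M// -muleA -EFinM [in LHS]mulrC.
rewrite (fubini_tonelli (m1 := mu) (m2 := mu) (fun z : RM * RM =>
    h (z.2, (z.1 - z.2)%R) * (hg 0 z.2 * hg 0 (z.1 - z.2)%R)%:E))//; last first.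
  by move=> z; rewrite mule_ge0// lee_fin mulr_ge0.
rewrite ge0_integral_gam; last 2 first.
- exact: (measurable_fun_fubini_tonelli_F (m2 := gam) h).
- by move=> x; exact: integral_ge0.
apply: eq_integral => x _ /=.
rewrite ge0_integral_gam//; last exact: mpair_l.
rewrite -ge0_integralZr//=; last 3 first.
- by apply: emeasurable_funM; [exact: mpair_l|exact/measurable_EFinP].
- by move=> y _; rewrite mule_ge0// lee_fin.
- by rewrite lee_fin.
rewrite -(ge0_integral_translation x (f := fun l => h (x, (l - x)%R) * (hg 0 x * hg 0 (l - x)%R)%:E)).
- apply: eq_integral => y _; have -> : (x + y - x = y)%R by rewrite addrAC subrr add0r.
  by rewrite -[in RHS]muleA -EFinM [in RHS]mulrC.
- have ms : measurable_fun setT (fun l : RM => (l, x) : RM * RM) by exact: measurable_fun_pair.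
  exact: (measurableT_comp mF ms).
- by move=> y; rewrite mule_ge0// lee_fin mulr_ge0.
Qed.

Let madd (h : RM * RM -> \bar R) (a b : RM) : measurable_fun setT h ->
  measurable_fun setT (fun z : RM * RM => h ((a + z.1)%R, (b + z.2)%R)).
Proof.
by move=> mh; apply: (measurableT_comp mh); apply: measurable_fun_pair; exact: measurable_funD.
Qed.

(** Each complete piece adds an independent pair with law gam x gam to the state,
    so the two coordinates stay independent. *)
Lemma ge0_integral_occ_state n (h : RM * RM -> \bar R) : measurable_fun setT h ->
  (forall z, 0 <= h z) ->
  \int[law P (measurable_occ_state n)]_z h z = \int[gpow n]_x \int[gpow n]_y h (x, y).
Proof.
elim: n h => [|n ih] h mh h0.
  rewrite ge0_integral_law//.
  rewrite (eq_integral (cst (h (0%R, 0%R)))); last by move=> w _; rewrite state0.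
  rewrite integral_cst//.
  transitivity (h (0%R, 0%R) * 1); first by congr (_ * _); exact: (@probability_setT _ _ _ P).
  rewrite mule1; apply/esym.
  rewrite [LHS]integral_dirac//; last by exact: (measurable_fun_fubini_tonelli_F (m2 := @dirac0 R) h).
  rewrite diracT mul1e [LHS]integral_dirac ?diracT ?mul1e//.
  exact: mpair_l.
rewrite ge0_integral_law//.
transitivity (\int[P]_w (h \o @occ_step n) (occ_state n w, piece_input n w)).
  by apply: eq_integral => w _; rewrite /= stateS.
rewrite (ge0_integral_occ_chain (n := n) (h := h \o @occ_step n)); last 2 first.
- exact: (measurableT_comp mh (@mstep n)).
- by move=> z; exact: h0.
pose F (z : RM * RM) := \int[gam]_x \int[gam]_y h ((z.1 + x)%R, (z.2 + y)%R).
transitivity (\int[law P (measurable_occ_state n)]_z F z).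
  apply: eq_integral => z _.
  rewrite /F -(ge0_integral_gap_split n (h := fun u => h ((z.1 + u.1)%R, (z.2 + u.2)%R)))//.
  exact: madd.
have mF2 : measurable_fun setT (fun u : (RM * RM) * RM => \int[gam]_y h ((u.1.1 + u.2)%R, (u.1.2 + y)%R)).
  apply: (measurable_fun_fubini_tonelli_F (m2 := gam)
    (fun v : ((RM * RM) * RM) * RM => h ((v.1.1.1 + v.1.2)%R, (v.1.1.2 + v.2)%R))) => //.
  apply: (measurableT_comp mh); apply: measurable_fun_pair; apply: measurable_funD => //.
  - by apply: (measurableT_comp (f := fst)) => //; exact: measurableT_comp.
  - exact: measurableT_comp.
  - by apply: (measurableT_comp (f := snd)) => //; exact: measurableT_comp.
have mF : measurable_fun setT F.
  apply: (measurable_fun_fubini_tonelli_F (m2 := gam)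
    (fun u : (RM * RM) * RM => \int[gam]_y h ((u.1.1 + u.2)%R, (u.1.2 + y)%R))) => // u.
  exact: integral_ge0.
rewrite ih//; last by move=> z; apply: integral_ge0 => x _; exact: integral_ge0.
have mG : measurable_fun setT (fun x : RM => \int[gpow n.+1]_y h (x, y)).
  exact: (measurable_fun_fubini_tonelli_F (m2 := gpow n.+1) h).
rewrite [RHS](ge0_integral_conv _ _ mG); last by move=> x; exact: integral_ge0.
apply: eq_integral => a _.
have mF2a : measurable_fun setT (fun u : RM * RM => \int[gam]_y h ((a + u.1)%R, (u.2 + y)%R)).
  apply: (measurable_fun_fubini_tonelli_F (m2 := gam)
    (fun v : (RM * RM) * RM => h ((a + v.1.1)%R, (v.1.2 + v.2)%R))) => //.
  apply: (measurableT_comp mh); apply: measurable_fun_pair; apply: measurable_funD => //.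
  - exact: measurableT_comp.
  - exact: measurableT_comp.
transitivity (\int[gam]_x \int[gpow n]_b \int[gam]_y h ((a + x)%R, (b + y)%R)).
  rewrite (fubini_tonelli (m1 := gam) (m2 := gpow n) (fun u : RM * RM =>
    \int[gam]_y h ((a + u.1)%R, (u.2 + y)%R)))// => u.
  exact: integral_ge0.
apply: eq_integral => x _.
rewrite [RHS](ge0_integral_conv _ _ (h := fun y => h ((a + x)%R, y)))//.
exact: mpair_l.
Qed.

(** The state before the n-th reset has the product law of the convolution powers;
    given the remaining time tau, the current piece has length at least tau with
    probability exp (- r tau), and r exp (- r tau) times the arcsine density is
    again a product by [half_gamma0M].  Integrating the state out turns each
    factor into half_gamma n by [half_gamma_pow_conv]. *)
Lemma occ_law_at_reset_count n (T : R) (Y : set RM) : measurable Y ->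
  r%:E * P [set w | (S n w < T <= S n.+1 w)%R /\
      Y ((occ_state n w).1 + piece_occ (n := n) ((T - S n w)%R, w))%R] =
  \int[mu]_(c in Y) (hg n c * hg n (T - c))%:E.
Proof.
move=> mY.
pose tau (z : RM * RM) : RM := (T - (z.1 + z.2))%R.
pose E := [set z : (RM * RM) * (RM * piece_space n) | (0 < tau z.1 <= z.2.1)%R /\
   Y (z.1.1 + piece_occ (tau z.1, z.2.2))%R].
have mtau : measurable_fun setT tau by apply: measurable_funB => //; exact: measurable_funD.
have mtau1 : measurable_fun setT (fun z : (RM * RM) * (RM * piece_space n) => tau z.1 : RM).
  exact: measurableT_comp.
have mpo : measurable_fun setT (fun z : (RM * RM) * (RM * piece_space n) =>
    z.1.1 + piece_occ (tau z.1, z.2.2) : RM)%R.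
  apply: measurable_funD; first exact: measurableT_comp.
  apply: (measurableT_comp (@measurable_piece_occ n)).
  by apply: measurable_fun_pair => //; exact: measurableT_comp.
have mE : measurable E.
  rewrite (_ : E = [set z | 0 < tau z.1]%R `&` [set z | 0 <= z.2.1 - tau z.1]%R `&`
     (fun z => z.1.1 + piece_occ (tau z.1, z.2.2))%R @^-1` Y).
    apply: measurableI; last by rewrite -[X in measurable X]setTI; exact: mpo.
    apply: measurableI.
      rewrite (_ : [set z | _] = (fun z => tau z.1) @^-1` `]0%R, +oo[%classic).
        by rewrite -[X in measurable X]setTI; apply: mtau1 => //; exact: measurable_itv.
      by apply/seteqP; split => z /=; rewrite in_itv/= andbT.
    have md : measurable_fun setT (fun z : (RM * RM) * (RM * piece_space n) => z.2.1 - tau z.1 : RM)%R.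
      by apply: measurable_funB => //; exact: measurableT_comp.
    rewrite (_ : [set z | _] = (fun z => z.2.1 - tau z.1)%R @^-1` `[0%R, +oo[%classic).
      by rewrite -[X in measurable X]setTI; apply: md => //; exact: measurable_itv.
    by apply/seteqP; split => z /=; rewrite in_itv/= andbT.
  apply/seteqP; split => z; rewrite /E/= subr_ge0.
    by move=> [/andP[-> ->]].
  by move=> [[-> ->]].
have mhg k (f : (RM * RM) * RM -> RM) : measurable_fun setT f -> measurable_fun setT (fun z => hg k (f z) : RM).
  by move=> mf; apply: (measurableT_comp (@measurable_half_gamma _ r k)).
have g0 k x : (0 <= hg k x)%R by exact: half_gamma_ge0.
pose j (z : (RM * RM) * RM) : R := (\1_Y z.2 * (hg 0 (z.2 - z.1.1) * hg 0 (T - z.2 - z.1.2)))%R.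
have j0 z : (0 <= j z)%R by rewrite !mulr_ge0.
have mj : measurable_fun setT (j : (RM * RM) * RM -> RM).
  apply: measurable_funM.
    by apply: (measurableT_comp (f := \1_Y : RM -> R)) => //; exact: measurable_indic.
  apply: measurable_funM; apply: mhg.
    by apply: measurable_funB => //; exact: measurableT_comp.
  apply: measurable_funB; last exact: measurableT_comp.
  exact: measurable_funB.
pose J (z : RM * RM) := \int[mu]_c (j (z, c))%:E.
have J0 z : 0 <= J z by apply: integral_ge0 => c _; rewrite lee_fin.
have mJ : measurable_fun setT J.
  apply: (measurable_fun_fubini_tonelli_F (m2 := mu) (fun z => (j z)%:E)) => //.
    exact/measurable_EFinP.
have m1E : measurable_fun setT (fun z => (\1_E z : R)%:E).
  by apply/measurable_EFinP; exact: measurable_indic.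
pose H z := \int[gap_measure n]_l \int[piece_law n]_w (\1_E (z, (l, w)) : R)%:E.
have HJ z : r%:E * H z = J z.
  have [t0|t0] := ltP 0%R (tau z); last first.
    rewrite /H [X in _ * X]integral0_eq; last first.
      move=> l _; apply: integral0_eq => w _; rewrite indicE memNset//.
      by rewrite /E/= ltNge t0 => -[].
    rewrite mule0 /J integral0_eq// => c _; rewrite /j/=.
    have [c1|c1] := leP (c - z.1)%R 0%R; first by rewrite half_gamma_le0// mul0r mulr0.
    rewrite [X in (_ * (_ * X))%R]half_gamma_le0 ?mulr0//.
    apply: le_trans t0; rewrite /tau opprD addrA lerD2r lerD2l lerN2.
    by rewrite -subr_ge0 ltW.
  pose K := \int[piece_law n]_w (\1_Y (z.1 + piece_occ (tau z, w))%R : R)%:E.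
  have mYz : measurable_fun setT (fun x : RM => (\1_Y (z.1 + x)%R : R)%:E).
    apply/measurable_EFinP; apply: (measurableT_comp (f := \1_Y : RM -> R)).
      exact: measurable_indic.
    exact: measurable_funD.
  have KE' : K = \int[mu]_x ((\1_Y (z.1 + x)%R : R)%:E * (arcsine_pdf (tau z) x)%:E).
    exact: (ge0_integral_piece_occ n (f := fun x => (\1_Y (z.1 + x)%R : R)%:E) t0 mYz).
  have K0 : 0 <= K by apply: integral_ge0 => w _; rewrite lee_fin.
  have mt : @measurable _ RM (`[tau z : R, +oo[%classic) by exact: measurable_itv.
  have HE : H z = (expR (- (r * tau z)))%:E * K.
    transitivity (\int[gap_measure n]_l ((\1_(`[tau z : R, +oo[%classic : set RM) l : R)%:E * K)).
      apply: eq_integral => l _; rewrite /K -ge0_integralZl//; last first.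
        by apply/measurable_EFinP; apply: (measurableT_comp (f := \1_Y : RM -> R));
          [exact: measurable_indic|apply: measurable_funD => //; exact: mocc_at].
      apply: eq_integral => w _; rewrite -EFinM; congr (_%:E); rewrite !indicE -natrM mulnb.
      congr ((_ : bool)%:R); apply/idP/andP; rewrite !inE /E/= t0 in_itv/= andbT.
        by move=> [].
      by move=> [].
    rewrite ge0_integralZr//; last by apply/measurable_EFinP; exact: measurable_indic.
    congr (_ * _); rewrite integral_indic// setIT -(exponential_prob_tail r0 (ltW t0)).
    exact: gap_law.
  have hE : (hg 1 (tau z) = r * expR (- (r * tau z)))%R.
    rewrite /half_gamma t0 expr1 divff; last by rewrite sqrtr_eq0 -ltNge.
    by rewrite sqr_sqrtr ?ltW// /= mul1r mulr1.
  rewrite HE muleA -EFinM -hE KE' -ge0_integralZl//; last 3 first.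
  - by apply: emeasurable_funM => //; apply/measurable_EFinP; exact: measurable_arcsine_pdf.
  - by move=> x _; rewrite -EFinM lee_fin mulr_ge0// arcsine_pdf_ge0.
  - by rewrite lee_fin.
  rewrite /J -(ge0_integral_translation z.1 (f := fun c => (j (z, c))%:E)).
  - apply: eq_integral => x _; rewrite -!EFinM mulrCA -half_gamma0M// /j/=.
    have -> : (z.1 + x - z.1 = x)%R by rewrite addrAC subrr add0r.
    have -> : (T - (z.1 + x) - z.2 = tau z - x)%R; last by [].
    by rewrite /tau; ring.
  - have ms : measurable_fun setT (fun c : RM => (z, c) : (RM * RM) * RM) by exact: measurable_fun_pair.
    by apply/measurable_EFinP; exact: (measurableT_comp mj ms).
  - by move=> c; rewrite lee_fin.
transitivity (r%:E * \int[P]_w (\1_E (occ_state n w, piece_input n w) : R)%:E).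
  have mO : measurable_fun setT (fun w => (occ_state n w, piece_input n w)).
    by apply: measurable_fun_pair; [exact: measurable_occ_state|exact: measurable_piece_input].
  congr (_ * _); rewrite -[RHS](ge0_integral_law P mO (h := fun u => (\1_E u : R)%:E))//.
  rewrite integral_indic// setIT; congr (P _).
  apply/seteqP; split => w; rewrite /E /tau/= occ_state_sum /gap subr_gt0 lerD2r.
    by [].
  by [].
rewrite (ge0_integral_occ_chain (h := fun u => (\1_E u : R)%:E))//.
rewrite -[X in _ * X]/(\int[law P (measurable_occ_state n)]_z H z).
rewrite -ge0_integralZl//; last 3 first.
- have ma : measurable_fun setT (fun v : ((RM * RM) * RM) * piece_space n => (v.1.1, (v.1.2, v.2))).
    apply: measurable_fun_pair; first exact: measurableT_comp.
    by apply: measurable_fun_pair => //; exact: measurableT_comp.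
  apply: (measurable_fun_fubini_tonelli_F (m2 := gap_measure n)
    (fun u : (RM * RM) * RM => \int[piece_law n]_w (\1_E (u.1, (u.2, w)) : R)%:E)); last first.
    by move=> u; apply: integral_ge0 => w _; rewrite lee_fin.
  apply: (measurable_fun_fubini_tonelli_F (m2 := piece_law n)
    (fun v : ((RM * RM) * RM) * piece_space n => (\1_E (v.1.1, (v.1.2, v.2)) : R)%:E)); last first.
    by move=> v; rewrite lee_fin.
  exact: (measurableT_comp m1E ma).
- by move=> z _; apply: integral_ge0 => l _; apply: integral_ge0 => w _; rewrite lee_fin.
- by rewrite lee_fin ltW.
under eq_integral do rewrite HJ.
rewrite ge0_integral_occ_state//.
transitivity (\int[gpow n]_a \int[mu]_c (\1_Y c * (hg 0 (c - a) * hg n (T - c)))%:E).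
  apply: eq_integral => a _; rewrite /J.
  rewrite (fubini_tonelli (m1 := gpow n) (m2 := mu) (fun u : RM * RM => (j ((a, u.1), u.2))%:E)); last 2 first.
  - have ms : measurable_fun setT (fun u : RM * RM => ((a, u.1), u.2) : (RM * RM) * RM).
      by apply: measurable_fun_pair => //; exact: measurable_fun_pair.
    by apply/measurable_EFinP; exact: (measurableT_comp mj ms).
  - by move=> u; rewrite lee_fin.
  apply: eq_integral => c _; rewrite /j/= mulrA EFinM -half_gamma_pow_conv -ge0_integralZl//.
  - by apply: eq_integral => b _; rewrite -EFinM -mulrA.
  - apply/measurable_EFinP; apply: (measurableT_comp (@measurable_half_gamma _ r 0)).
    exact: measurable_funB.
  - by move=> b _; rewrite lee_fin.
  - by rewrite lee_fin mulr_ge0.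
rewrite (fubini_tonelli (m1 := gpow n) (m2 := mu)
   (fun u : RM * RM => (\1_Y u.2 * (hg 0 (u.2 - u.1) * hg n (T - u.2)))%:E)); last 2 first.
- apply/measurable_EFinP; apply: measurable_funM.
    by apply: (measurableT_comp (f := \1_Y : RM -> R)) => //; exact: measurable_indic.
  apply: measurable_funM.
    by apply: (measurableT_comp (@measurable_half_gamma _ r 0)); exact: measurable_funB.
  by apply: (measurableT_comp (@measurable_half_gamma _ r n)); exact: measurable_funB.
- by move=> u; rewrite lee_fin !mulr_ge0.
rewrite [RHS]integral_mkcond; apply: eq_integral => c _.
rewrite patchE; case: ifPn => cY /=; last first.
  by apply: integral0_eq => a _; rewrite indicE (negbTE cY) mul0r.
under eq_integral do rewrite indicE cY mul1r EFinM.
rewrite ge0_integralZr//; first by rewrite half_gamma_pow_conv -EFinM.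
- apply/measurable_EFinP; apply: (measurableT_comp (@measurable_half_gamma _ r 0)).
  exact: measurable_funB.
- by move=> b _; rewrite lee_fin.
- by rewrite lee_fin.
Qed.

Lemma gap_tail n (s : R) : (0 <= s)%R -> P [set w | (s <= gap n w)%R] = (expR (- (r * s)))%:E.
Proof.
move=> s0; rewrite -(exponential_prob_tail r0 s0).
have mt : @measurable _ RM (`[s, +oo[%classic) by exact: measurable_itv.
rewrite -(gap_law n mt); congr (P _).
by apply/seteqP; split => w /=; rewrite in_itv/= andbT.
Qed.

Lemma ae_gap_ge0 : \forall w \ae P, forall n, (0 <= gap n w)%R.
Proof.
apply: ae_foralln => n.
exists [set w | (gap n w < 0)%R]; split; last first.
- by move=> w /= /negP; rewrite -ltNge.
- have mt : @measurable _ RM (`]-oo, 0%R[%classic) by exact: measurable_itv.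
  rewrite (_ : [set w | _] = gap n @^-1` `]-oo, 0%R[%classic).
    rewrite [LHS](gap_law n mt) /exponential_prob integral0_eq// => x; rewrite /= in_itv/= => x0.
    by rewrite lt0_exponential_pdf.
  by apply/seteqP; split => w /=; rewrite in_itv.
rewrite (_ : [set w | _] = gap n @^-1` `]-oo, 0%R[%classic).
  by rewrite -[X in measurable X]setTI; apply: measurable_gap => //; exact: measurable_itv.
by apply/seteqP; split => w /=; rewrite in_itv.
Qed.

(** All N first gaps are shorter than T with probability q^N, where
    q = 1 - exp (- r T) < 1. *)
Lemma ae_reset_after (T : R) : (0 < T)%R -> \forall w \ae P, exists n, (T <= gap n w)%R.
Proof.
move=> T0.
have mA : @measurable _ RM (`]-oo, T[%classic) by exact: measurable_itv.
pose q : R := (1 - expR (- (r * T)))%R.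
have qE n : P (gap n @^-1` `]-oo, T[%classic) = q%:E.
  rewrite (_ : gap n @^-1` _ = ~` [set w | (T <= gap n w)%R]).
    rewrite probability_setC; first by rewrite gap_tail ?ltW// -EFinB.
    rewrite (_ : [set w | _] = gap n @^-1` `[T, +oo[%classic).
      by rewrite -[X in measurable X]setTI; apply: measurable_gap => //; exact: measurable_itv.
    by apply/seteqP; split => w /=; rewrite in_itv/= andbT.
  by apply/seteqP; split => w /=; rewrite in_itv/= ltNge => /negP.
pose E N := [set w | forall i, (i < N)%N -> `]-oo, T[%classic (gap i w)].
have PE N : P (E N) = (q ^+ N)%:E.
  rewrite (gap_indep N (A := fun _ => `]-oo, T[%classic))//.
  under eq_bigr do rewrite qE.
  by rewrite prodEFin prodr_const_nat subn0.
have mE N : measurable (E N).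
  rewrite (_ : E N = \bigcap_(i in [set i | (i < N)%N]) (gap i @^-1` `]-oo, T[%classic))//.
  apply: bigcap_measurableType => i _.
  by rewrite -[X in measurable X]setTI; apply: measurable_gap.
have mEE : measurable (\bigcap_N E N) by exact: bigcapT_measurable.
exists (\bigcap_N E N); split => //; last first.
- by move=> w /= /forallNP h N _ i _ /=; rewrite in_itv/= ltNge; apply/negP.
- have q1 : (`|q| < 1)%R.
    rewrite ger0_norm; first by rewrite /q ltrBlDr ltrDl expR_gt0.
    by rewrite subr_ge0 -expR0 ler_expR oppr_le0 mulr_ge0// ltW.
  have le_q N : P (\bigcap_N E N) <= (q ^+ N)%:E.
    by rewrite -PE; apply: le_measure; rewrite ?inE//; exact: bigcap_inf.
  have : lim ((fun N => (q ^+ N)%:E) @ \oo) = 0.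
    apply/cvg_lim => //; apply: cvg_EFin; first exact: nearW.
    exact: cvg_expr.
  move=> lim0; apply/eqP; rewrite eq_le measure_ge0 andbT -lim0; apply: lime_ge.
    apply/cvg_ex; exists 0; apply: cvg_EFin; first exact: nearW.
    exact: cvg_expr.
  exact: nearW.
Qed.

End reset_chain.

(** * Path decomposition at the resets *)

Section reset_path.
Context {R : realType} d (Omega : measurableType d) (P : probability Omega R).
Notation RM := (measurableTypeR R).
Notation mu := (@lebesgue_measure R).
Variables (r : R) (W : R -> Omega -> R) (S : nat -> {RV P >-> R}) (B : nat -> R -> {RV P >-> R}).
Hypothesis hS : poisson_process r S.
Hypothesis hB : forall k, standard_brownian_motion (B k).
Hypothesis hW : forall t w, 0 <= t -> W t w = B (resets S t w) (t - S (resets S t w) w) w.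

Let S0 w : S 0%N w = 0. Proof. by have [] := hS. Qed.

Lemma resetsP t w : (exists k, t < S k.+1 w) -> t < S (resets S t w).+1 w /\
  forall k, t < S k.+1 w -> (resets S t w <= k)%N.
Proof.
rewrite /resets; case: pselect => // h _.
by case: ex_minnP => m tm mm; split.
Qed.

Lemma resets_le t w : 0 <= t -> S (resets S t w) w <= t.
Proof.
move=> t0; have [h|h] := pselect (exists k, t < S k.+1 w); last first.
  by rewrite /resets; case: pselect => // _; rewrite S0.
have [tm mm] := resetsP h; case: (resets S t w) mm => [|m] mm; first by rewrite S0.
by rewrite leNgt; apply/negP => /mm; rewrite ltnn.
Qed.

Let mS k : measurable_fun setT (fun z : RM * Omega => S k z.2 : RM).
Proof.
have mSk : measurable_fun setT (S k : Omega -> RM) by exact: (measurable_funP (S k)).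
exact: (measurableT_comp mSk measurable_snd).
Qed.

Lemma measurable_resets k : measurable [set z : RM * Omega | resets S (Num.max 0 z.1) z.2 = k].
Proof.
pose L j := [set z : RM * Omega | Num.max 0 z.1 < S j.+1 z.2].
have mL j : measurable (L j).
  have md : measurable_fun setT (fun z : RM * Omega => S j.+1 z.2 - Num.max 0 z.1 : RM).
    apply: measurable_funB; first exact: mS.
    by apply: measurable_maxr.
  rewrite (_ : L j = (fun z : RM * Omega => S j.+1 z.2 - Num.max 0 z.1) @^-1` `]0, +oo[%classic).
    by rewrite -[X in measurable X]setTI; apply: md => //; exact: measurable_itv.
  by apply/seteqP; split => z; rewrite /L /= in_itv/= andbT subr_gt0.
have mN : measurable (\bigcap_j ~` L j) by apply: bigcapT_measurable => j; exact: measurableC.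
rewrite (_ : [set z | _] = (L k `&` \bigcap_j (if (j < k)%N then ~` L j else setT)) `|`
    (if k == 0%N then \bigcap_j ~` L j else set0)).
  apply: measurableU; last by case: ifP.
  apply: measurableI => //; apply: bigcapT_measurable => j; case: ifP => // _.
  exact: measurableC.
apply/seteqP; split => z /=.
  have [h|h] := pselect (exists k, Num.max 0 z.1 < S k.+1 z.2).
    have [tm mm] := resetsP h => <-; left; split => // j _.
    by case: ifP => // jm /mm; rewrite leqNgt jm.
  rewrite {1}/resets; case: pselect => // _ <-; right => /= j _.
  by move=> jL; apply: h; exists j.
move=> [[kL hk]|].
  have [tm mm] := resetsP (ex_intro _ k kL).
  apply/eqP; rewrite eqn_leq mm//= leqNgt; apply/negP => mk.
  by have := hk (resets S (Num.max 0 z.1) z.2) I; rewrite /= mk; apply.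
case: eqP => // -> h; rewrite /resets; case: pselect => // -[j jL].
by have := h j I.
Qed.

(** The process picks the piece of index [resets] and shifts it in time; when no
    Poisson point exceeds t the piece of index 0 is run, which keeps the process
    measurable on all of Omega. *)
Lemma measurable_reset_process :
  measurable_fun setT (fun z : RM * Omega => W (Num.max 0 z.1) z.2).
Proof.
pose F k (z : RM * Omega) : RM := B k (Num.max 0 (Num.max 0 z.1 - S k z.2)) z.2.
rewrite (_ : (fun z => _) = fun z => F (resets S (Num.max 0 z.1) z.2) z); last first.
  apply/funext => z; have m0 : 0 <= Num.max 0 z.1 by rewrite le_max lexx.
  have d0 : 0 <= Num.max 0 z.1 - S (resets S (Num.max 0 z.1) z.2) z.2 by rewrite subr_ge0 resets_le.
  by rewrite hW// /F (max_idPr d0).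
apply: measurable_fun_pick; first exact: measurable_resets.
move=> k; have mg : measurable_fun setT (fun z : RM * Omega => (Num.max 0 z.1 - S k z.2, z.2) : RM * Omega).
  apply: measurable_fun_pair => //; apply: measurable_funB; first exact: measurable_maxr.
  exact: mS.
exact: (measurableT_comp (measurable_brownian (hB k)) mg).
Qed.

Lemma points_nondecreasing w : (forall n, 0 <= gap S n w) -> forall m n, (m <= n)%N -> S m w <= S n w.
Proof.
move=> g0 m; elim=> [|n ih]; first by rewrite leqn0 => /eqP ->.
rewrite leq_eqVlt => /orP[/eqP ->//|mn]; apply: (le_trans (ih mn)).
by rewrite -subr_ge0; exact: g0.
Qed.

Let Sjourn k := sojourn (fun t => (B k t : Omega -> R)).

(** A time t in [0, T[ lies in exactly one interval [S_m, S_(m+1)[ with m <= n,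
    where the process is the m-th piece shifted by S_m; all other terms vanish. *)
Let sojourn_decomposition w n (T t : R) : (forall n, 0 <= gap S n w) -> S n w < T <= S n.+1 w ->
  sojourn W w T t = \sum_(k < n) Sjourn k w (gap S k w) (t - S k w) + Sjourn n w (T - S n w) (t - S n w).
Proof.
move=> g0 /andP[SnT TSn].
have mono := points_nondecreasing g0.
have z k l : t < S k w \/ l <= t - S k w -> Sjourn k w l (t - S k w) = 0.
  rewrite /Sjourn /sojourn subr_ge0 => -[h|h]; first by rewrite leNgt h.
  by rewrite [_ < l]ltNge h andbF.
have zg k : t < S k w \/ S k.+1 w <= t -> Sjourn k w (gap S k w) (t - S k w) = 0.
  move=> [h|h]; first by apply: z; left.
  by apply: z; right; rewrite lerD2r.
have [t0|t0] := ltP t 0.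
  rewrite /sojourn leNgt t0/= big1 ?add0r => [|k _]; [apply/esym/z|apply: zg]; left;
  by rewrite (lt_le_trans t0)// -(S0 w) mono.
have [tT|tT] := ltP t T; last first.
  rewrite /sojourn [t < T]ltNge tT andbF/= big1 ?add0r => [|k _].
    by apply/esym/z; right; rewrite lerD2r.
  by apply: zg; right; rewrite (le_trans _ tT)// (le_trans _ (ltW SnT))// mono.
have [tm mm] := resetsP (ex_intro _ n (lt_le_trans tT TSn)).
have ml := resets_le w t0; have WE := hW w t0.
have mn := mm _ (lt_le_trans tT TSn).
move: (resets S t w) tm mm ml WE mn => m tm mm ml WE mn.
have Wm l : t - S m w < l -> sojourn W w T t = Sjourn m w l (t - S m w).
  move=> tl; rewrite /Sjourn /sojourn tl t0 tT subr_ge0 ml/=.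
  have d0 : 0 <= t - S m w by rewrite subr_ge0.
  by rewrite (max_idPr t0) WE (max_idPr d0).
move: mn; rewrite leq_eqVlt => /orP[/eqP mn|mn].
  rewrite -mn big1 ?add0r; first by apply: Wm; rewrite ltrD2r.
  by move=> k _; apply: zg; right; rewrite (le_trans _ ml)// mono// mn.
rewrite (bigD1 (Ordinal mn))//= big1 ?addr0 => [|k km].
  rewrite [X in _ + X]z ?addr0; last by left; rewrite (lt_le_trans tm)// mono.
  by apply: Wm; rewrite ltrD2r.
apply: zg; have [km'|km'] := ltnP k m.
  by right; rewrite (le_trans _ ml)// mono.
left; rewrite (lt_le_trans tm)// mono// ltn_neqAle km' andbT.
by move: km; apply: contraNneq => e; apply/eqP/val_inj.
Qed.

Lemma occupation_time_reset w n (T : R) : (forall n, 0 <= gap S n w) -> S n w < T <= S n.+1 w ->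
  occupation_time W T w =
  (occ_state S B n w).1 + piece_occ (B := B) (n := n) (T - S n w, w).
Proof.
move=> g0 ST; apply: EFin_inj.
have mB k := measurable_brownian (hB k).
have mSj k l : measurable_fun setT (fun t : RM => (Sjourn k w l t)%:E).
  by apply/measurable_EFinP; exact: (measurable_sojourn (mB k)).
have mSj' k l : measurable_fun setT (fun t : RM => (Sjourn k w l (t - S k w))%:E).
  apply/measurable_EFinP; apply: (measurableT_comp (measurable_sojourn (mB k) w l)).
  exact: measurable_funB.
have Sj0 k l t : (0 <= (Sjourn k w l t)%:E)%E by rewrite lee_fin sojourn_ge0.
have shift k l : (\int[mu]_t (Sjourn k w l (t - S k w))%:E = (piece_occ (B := B) (n := k) (l, w))%:E)%E.
  rewrite [RHS](occupation_time_sojourn (mB k)).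
  rewrite -[RHS](ge0_integral_translation (- S k w) (f := fun t => (Sjourn k w l t)%:E))//.
    by apply: eq_integral => t _; rewrite addrC.
  exact: (mSj k l).
rewrite (occupation_time_sojourn measurable_reset_process).
under eq_integral do rewrite (sojourn_decomposition _ g0 ST) EFinD -sumEFin.
rewrite ge0_integralD//; last 2 first.
- by move=> t _; apply: sume_ge0.
- exact: emeasurable_sum.
by rewrite ge0_integral_sum// EFinD -sumEFin; congr (_ + _)%E; [apply: eq_bigr|].
Qed.

End reset_path.

(** * The arcsine constant and the function W *)

Section arcsine_constant_value.
Context {R : realType}.
Notation RM := (measurableTypeR R).
Notation mu := (@lebesgue_measure R).
Notation hg := (@half_gamma R 1).

(** exp (- x^2) is the integral of exp (- t) over t >= x^2; exchanging the order
    of integration leaves the integral of sqrt t exp (- t), proportional to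
    half_gamma 2. *)
Lemma integral_gauss_half_gamma :
  ((half_gamma_coef 2)%:E * \int[mu]_(x in `[0%R, +oo[) (gauss_fun x)%:E = 1 :> \bar R)%E.
Proof.
pose D := [set z : RM * RM | 0 <= z.1 /\ 0 <= z.2 - z.1 ^+ 2].
have mD : measurable D.
  rewrite (_ : D = (fst : RM * RM -> RM) @^-1` `[0, +oo[%classic `&`
      (fun z : RM * RM => z.2 - z.1 ^+ 2 : RM) @^-1` `[0, +oo[%classic).
    apply: measurableI; rewrite -[X in measurable X]setTI.
      by apply: measurable_fst => //; exact: measurable_itv.
    have md : measurable_fun setT (fun z : RM * RM => z.2 - z.1 ^+ 2 : RM).
      by apply: measurable_funB => //; apply: measurable_funX.
    by apply: md => //; exact: measurable_itv.
  by apply/seteqP; split => z; rewrite /D /= !in_itv/= !andbT.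
have m1 := @measurable_half_gamma R 1 1; have g0 k x : 0 <= hg k x by exact: half_gamma_ge0.
have mh : measurable_fun setT (fun z : RM * RM => (\1_D z * hg 1 z.2 : R)%:E).
  apply/measurable_EFinP; apply: measurable_funM; first exact: measurable_indic.
  exact: measurableT_comp.
have h0 z : (0 <= (\1_D z * hg 1 z.2 : R)%:E)%E by rewrite lee_fin mulr_ge0.
have -> : (\int[mu]_(x in `[0%R, +oo[) (gauss_fun x)%:E =
    \int[mu]_x \int[mu]_t (\1_D (x, t) * hg 1 t)%:E)%E.
  rewrite integral_mkcond; apply: eq_integral => x _.
  rewrite patchE mem_setE in_itv/= andbT.
  have [x0|x0] := leP 0 x; last first.
    by rewrite integral0_eq// => t _; rewrite indicE memNset ?mul0r// /D/= leNgt x0 => -[].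
  have mi : @measurable _ RM `[x ^+ 2, +oo[%classic by exact: measurable_itv.
  transitivity (exponential_prob 1 `[x ^+ 2, +oo[).
    by rewrite (exponential_prob_tail ltr01) ?sqr_ge0// mul1r.
  rewrite (exponential_probE ltr01 mi) integral_mkcond; apply: eq_integral => t _.
  rewrite patchE mem_setE in_itv/= andbT indicE.
  have -> : ((x, t) \in D) = (x ^+ 2 <= t).
    by apply/idP/idP; rewrite inE /D/= subr_ge0; [move=> []|].
  by case: ifP; rewrite ?mul1r ?mul0r.
rewrite (fubini_tonelli (m1 := mu) (m2 := mu) (fun z : RM * RM => (\1_D z * hg 1 z.2 : R)%:E))//.
rewrite -ge0_integralZl//; last 3 first.
- exact: (measurable_fun_fubini_tonelli_G (m1 := mu) (fun z : RM * RM => (\1_D z * hg 1 z.2 : R)%:E)).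
- by move=> t _; apply: integral_ge0 => x _; exact: (h0 (x, t)).
- by rewrite lee_fin half_gamma_coef_ge0.
rewrite -[RHS](integral_half_gamma (@ltr01 R) 2); apply: eq_integral => t _ /=.
have [t0|t0] := ltP 0 t; last first.
  by rewrite !half_gamma_le0// integral0_eq ?mule0// => x _; rewrite mulr0.
under eq_integral do rewrite EFinM.
rewrite ge0_integralZr//; last 2 first.
- apply/measurable_EFinP.
  have mp : measurable_fun setT (fun x : RM => (x, t) : RM * RM) by exact: measurable_fun_pair.
  have mi : measurable_fun setT ((\1_D : RM * RM -> R) : RM * RM -> RM) by exact: measurable_indic.
  exact: (measurableT_comp mi mp).
- by rewrite lee_fin.
have -> : (\int[mu]_x (\1_D (x, t) : R)%:E = (Num.sqrt t)%:E)%E.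
  transitivity (\int[mu]_x ((\1_(`[0, Num.sqrt t]%classic : set RM) x : R)%:E))%E.
    apply: eq_integral => x _; rewrite !indicE; congr ((_ : bool)%:R%:E).
    rewrite mem_setE in_itv/=; apply/idP/idP; rewrite inE /D/= subr_ge0.
      by move=> [x0 xt]; rewrite x0 -(ger0_norm x0) -sqrtr_sqr ler_wsqrtr.
    by move=> /andP[x0 xt]; split => //; rewrite -(sqr_sqrtr (ltW t0)) lerXn2r ?nnegrE ?sqrtr_ge0.
  rewrite integral_indic//.
  rewrite setIT [LHS](_ : _ = mu [set` `[0, Num.sqrt t]])// lebesgue_measure_itv/= lte_fin sqrtr_gt0 t0.
  by rewrite oppr0 adde0.
rewrite -!EFinM; congr (_%:E); rewrite /half_gamma t0 sqrtr1 !expr1n expr1 divff; last by rewrite sqrtr_eq0 -ltNge.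
have s0 : Num.sqrt t != 0 by rewrite sqrtr_eq0 -ltNge.
by rewrite !mul1r expr2 /=; field.
Qed.

Lemma arcsine_constE : @arcsine_const R = pi^-1.
Proof.
have := integral_gauss_half_gamma; rewrite integral0y_gauss -EFinM => -[] /= h.
have p0 := @pi_gt0 R.
have h' : Num.sqrt (@arcsine_const R) * Num.sqrt pi = 1.
  by rewrite -[RHS]h; field.
have k0 := ltW (@arcsine_const_gt0 R).
have : @arcsine_const R * pi = 1.
  by rewrite -[in LHS](sqr_sqrtr k0) -[in LHS](sqr_sqrtr (ltW p0)) -exprMn h' expr1n.
by move=> kp; rewrite -[RHS]mul1r -[in RHS]kp mulfK// gt_eqF.
Qed.

End arcsine_constant_value.

Section half_gamma_coef_values.
Context {R : realType}.
Notation coef := (@half_gamma_coef R).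

(** The even coefficients carry the hypergeometric series. *)
Lemma half_gamma_coef_even m :
  coef m.*2 = Num.sqrt arcsine_const / rising_factorial (1 / 2) m.
Proof.
elim: m => [|m ih]; first by rewrite /rising_factorial big_ord0 divr1.
rewrite doubleS /= ih /rising_factorial big_ord_recr/= invfM -mulrA; congr (_ * (_ * _)).
have -> : m.*2.+1%:R = 2 * (1 / 2 + m%:R) :> R by rewrite -natr1 -muln2 natrM; field.
by rewrite invfM mulrA divff ?mul1r.
Qed.

(** The odd coefficients carry the Bessel series. *)
Lemma half_gamma_coef_odd m : coef m.*2.+1 = (m`!%:R)^-1.
Proof.
elim: m => [|m ih]; first by rewrite fact0 invr1.
rewrite doubleS -[LHS]/(coef m.*2.+1 * (2 / m.*2.+2%:R)) ih factS natrM invfM mulrC; congr (_ * _).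
by rewrite -doubleS -muln2 natrM invfM mulrCA divff ?mulr1.
Qed.

Lemma W_coeffE (x : R) j : W_coeff x j = x ^+ j * coef j ^+ 2.
Proof.
rewrite /W_coeff -exprVn; congr (_ * _ ^+ 2); have G := @Gamma_half R j.
have g0 : Gamma (j.+1%:R / 2 : R) != 0.
  by apply/eqP => g0; move: G; rewrite g0 mulr0 => /esym/eqP; rewrite oner_eq0.
by apply: (mulIf g0); rewrite mulVf// G.
Qed.

(** Makes the even series converge, by comparison with an exponential series. *)
Lemma rising_factorial_half_ge m : m`!%:R / 2 ^+ m <= rising_factorial (1 / 2 : R) m.
Proof.
elim: m => [|m ih]; first by rewrite fact0 /rising_factorial big_ord0 divr1.
rewrite /rising_factorial big_ord_recr/= -/(rising_factorial _ _) factS mulnC natrM exprSr invfM mulrACA.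
apply: ler_pM => //; rewrite ?divr_ge0 ?exprn_ge0//.
by rewrite -natr1 mulrDl addrC lerD2l ler_pdivrMr// ler_peMr// ler1n.
Qed.

Lemma rising_factorial_gt0 (a : R) m : 0 < a -> 0 < rising_factorial a m.
Proof. by move=> a0; apply: prodr_gt0 => i _; rewrite ltr_wpDr. Qed.

Lemma rising_factorial1 m : rising_factorial (1 : R) m = m`!%:R.
Proof.
elim: m => [|m ih]; first by rewrite /rising_factorial big_ord0 fact0.
by rewrite /rising_factorial big_ord_recr/= -/(rising_factorial _ _) ih factS mulnC natrM nat1r.
Qed.

Variable x : R.
Hypothesis x0 : 0 < x.

Let even_term m : R := x ^+ m.*2 / rising_factorial (1 / 2) m ^+ 2.
Let odd_term m : R := x ^+ m.*2 / m`!%:R ^+ 2.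

Let x2n m : x ^+ m.*2 = (x ^+ 2) ^+ m.
Proof. by rewrite -exprM mul2n. Qed.

Let fact1 m : 1 <= m`!%:R :> R. Proof. by rewrite ler1n fact_gt0. Qed.

Let even0 m : 0 <= even_term m.
Proof. by rewrite divr_ge0// exprn_ge0 ?ltW// rising_factorial_gt0. Qed.

Let odd0 m : 0 <= odd_term m.
Proof. by rewrite divr_ge0// exprn_ge0 ?ltW. Qed.

Let odd_cvg : cvgn (series odd_term).
Proof.
apply: (@series_le_cvg _ _ (exp_coeff (x ^+ 2))) => //.
- by move=> n; rewrite exp_coeff_ge0// sqr_ge0.
- move=> n; rewrite /odd_term /exp_coeff x2n; apply: ler_wpM2l; first by rewrite exprn_ge0// sqr_ge0.
  by rewrite lef_pV2 ?posrE ?exprn_gt0 ?ltr0n ?fact_gt0// expr2 ler_peMl.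
- exact: is_cvg_series_exp_coeff.
Qed.

Let even_cvg : cvgn (series even_term).
Proof.
apply: (@series_le_cvg _ _ (exp_coeff (4 * x ^+ 2))) => //.
- by move=> n; rewrite exp_coeff_ge0// mulr_ge0// sqr_ge0.
- move=> n; rewrite /even_term /exp_coeff/= x2n.
  have y0 : 0 <= (x ^+ 2) ^+ n by rewrite exprn_ge0// sqr_ge0.
  have F0 : 0 < n`!%:R :> R by rewrite ltr0n fact_gt0.
  have t0 : 0 < 2 ^+ n :> R by rewrite exprn_gt0.
  have q0 : 0 < n`!%:R / 2 ^+ n :> R by rewrite divr_gt0.
  have rf0 : 0 < rising_factorial (1 / 2 : R) n by rewrite rising_factorial_gt0.
  apply: (@le_trans _ _ ((x ^+ 2) ^+ n / (n`!%:R / 2 ^+ n) ^+ 2)).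
    apply: ler_wpM2l => //; rewrite lef_pV2 ?posrE ?exprn_gt0//.
    by apply: lerXn2r; rewrite ?nnegrE; [exact: ltW|exact: ltW|exact: rising_factorial_half_ge].
  have -> : (4 * x ^+ 2) ^+ n = (x ^+ 2) ^+ n * (2 ^+ n) ^+ 2.
    have -> : 4 = 2 ^+ 2 :> R by rewrite -natrX.
    by rewrite exprMn mulrC; congr (_ * _); rewrite -!exprM mulnC.
  rewrite -[leRHS]mulrA; apply: ler_wpM2l => //.
  rewrite exprMn exprVn invfM invrK mulrC ler_wpM2l ?sqr_ge0//.
  by rewrite lef_pV2 ?posrE ?exprn_gt0// expr2 ler_peMl// (ltW F0).
- exact: is_cvg_series_exp_coeff.
Qed.

Lemma W_coeff_ge0 j : 0 <= W_coeff x j.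
Proof. by rewrite W_coeffE mulr_ge0// ?sqr_ge0// exprn_ge0// ltW. Qed.

Let series_double N : series (W_coeff x) N.*2 =
  pi^-1 * series even_term N + x * series odd_term N.
Proof.
elim: N => [|N ih]; first by rewrite /series/= !big_geq// !mulr0 addr0.
have sS (u : nat -> R) n : series u n.+1 = series u n + u n by rewrite /series/= big_nat_recr.
rewrite doubleS !sS ih !W_coeffE half_gamma_coef_even half_gamma_coef_odd.
have -> : x ^+ N.*2 * (Num.sqrt arcsine_const / rising_factorial (1 / 2) N) ^+ 2 = pi^-1 * even_term N.
  by rewrite exprMn sqr_sqrtr ?ltW ?arcsine_const_gt0// arcsine_constE exprVn mulrCA.
have -> : x ^+ N.*2.+1 * N`!%:R^-1 ^+ 2 = x * odd_term N by rewrite exprVn exprS -mulrA.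
by ring.
Qed.

Let L := pi^-1 * limn (series even_term) + x * limn (series odd_term).

Let double_cvg : (fun N => series (W_coeff x) N.*2) @ \oo --> L.
Proof.
rewrite (_ : (fun _ => _) = fun N => pi^-1 * series even_term N + x * series odd_term N); last first.
  by apply/funext => N; rewrite series_double.
by apply: cvgD; (apply: cvgM; first exact: cvg_cst).
Qed.

Let W_nd : {homo series (W_coeff x) : n m / (n <= m)%N >-> n <= m}.
Proof. by apply: nondecreasing_series => n _ _; exact: W_coeff_ge0. Qed.

Lemma is_cvg_W_series : cvgn (series (W_coeff x)).
Proof.
apply: nondecreasing_is_cvgn; first exact: W_nd.
exists L => _ [n _ <-]; apply: (@le_trans _ _ (series (W_coeff x) n.*2)).
  by apply: W_nd; rewrite -addnn leq_addr.
have nd2 : {homo (fun N => series (W_coeff x) N.*2) : n m / (n <= m)%N >-> n <= m}.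
  by move=> a b ab; apply: W_nd; rewrite leq_double.
have cv : cvgn (fun N => series (W_coeff x) N.*2) by apply/cvg_ex; exists L.
by rewrite -(cvg_lim _ double_cvg)//; exact: (nondecreasing_cvgn_le nd2 cv n).
Qed.

(** The partial sums of even length split into partial sums of the two series. *)
Lemma W_funE : W_fun x = besselI 0 (2 * x)
    + 1 / (x * pi) * hypergeometric_1F2 1 (1 / 2) (1 / 2) (x ^+ 2).
Proof.
have lE : limn (series (W_coeff x)) = L.
  apply: (cvg_unique _ _ double_cvg) => //.
  apply: (cvg_comp _ _ _ is_cvg_W_series).
  by apply/cvgnyPge => A; near=> n; rewrite (@leq_trans n)//; [near: n; exact: nbhs_infty_ge|rewrite -addnn leq_addr].
have -> : besselI 0 (2 * x) = limn (series odd_term).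
  rewrite /besselI; congr (limn (series _)); apply/funext => m.
  by rewrite !addn0 /odd_term expr2 mulrAC divff ?mul1r.
have -> : hypergeometric_1F2 1 (1 / 2) (1 / 2) (x ^+ 2) = limn (series even_term).
  rewrite /hypergeometric_1F2; congr (limn (series _)); apply/funext => m.
  rewrite rising_factorial1 /even_term x2n expr2 mulrAC mulrCA divff ?mulr1 ?gt_eqF ?ltr0n ?fact_gt0//.
have xn : x != 0 by rewrite gt_eqF.
by rewrite /W_fun lE /L mulrDr mulKf// addrC mulrA div1r invfM.
Unshelve. all: by end_near. Qed.

End half_gamma_coef_values.

(** * The law of the occupation time *)

Section occupation_law.
Context {R : realType} d (Omega : measurableType d) (P : probability Omega R).
Notation RM := (measurableTypeR R).
Notation mu := (@lebesgue_measure R).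
Variables (r T : R) (W : R -> Omega -> R) (S : nat -> {RV P >-> R}) (B : nat -> R -> {RV P >-> R}).
Hypothesis r0 : 0 < r.
Hypothesis T0 : 0 < T.
Hypothesis hS : poisson_process r S.
Hypothesis hB : forall k, standard_brownian_motion (B k).
Hypothesis hI : mutually_independent P (fun i : option nat =>
          match i with
          | None => sigma_of setT (fun k => S k : Omega -> R)
          | Some k => sigma_of `[0, +oo[ (fun t => B k t : Omega -> R)
          end).
Hypothesis hW : forall t w, 0 <= t -> W t w = B (resets S t w) (t - S (resets S t w) w) w.
Notation hg := (half_gamma r).

Let density (a : R) : R := r * expR (- (r * T)) * W_fun (r * Num.sqrt (a * (T - a))).

Let measurable_occ : measurable_fun setT (occupation_time W T).
Proof.
have mg : measurable_fun setT (fun w => (T, w) : RM * Omega) by exact: measurable_fun_pair.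
exact: (measurableT_comp (measurable_occupation_time (measurable_reset_process hS hB hW)) mg).
Qed.

(** S_n < T <= S_(n+1) rather than S_n <= T < S_(n+1): since S_0 = 0 < T, these
    events cover everything as soon as some S_n reaches T, whereas {S_n = T} would
    have to be discarded as a null event. *)
Let reset_event (Y : set RM) n := [set w | (S n w < T <= S n.+1 w)%R /\
      Y ((occ_state S B n w).1 + piece_occ (B := B) (n := n) ((T - S n w)%R, w))%R].

Let measurable_reset_event Y n : measurable Y -> measurable (reset_event Y n).
Proof.
move=> mY.
have mS k : measurable_fun setT (S k : Omega -> RM) by exact: (measurable_funP (S k)).
have md k : measurable_fun setT (fun w => T - S k w : RM) by exact: measurable_funB.
have ms := measurable_occ_state S hB n.
have m2 : measurable_fun setT (fun w => (occ_state S B n w).1 +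
    piece_occ (B := B) (n := n) (T - S n w, w) : RM).
  apply: measurable_funD; first exact: (measurableT_comp measurable_fst ms).
  apply: (measurableT_comp (@measurable_piece_occ _ _ _ _ _ hB n)).
  by apply: measurable_fun_pair; [exact: md|exact: measurable_piece_id].
rewrite (_ : reset_event Y n = (fun w => T - S n w) @^-1` `]0, +oo[%classic `&`
   (fun w => T - S n.+1 w) @^-1` `]-oo, 0]%classic `&`
   (fun w => (occ_state S B n w).1 + piece_occ (B := B) (n := n) (T - S n w, w)) @^-1` Y).
  apply: measurableI; last by rewrite -[X in measurable X]setTI; exact: m2.
  by apply: measurableI; rewrite -[X in measurable X]setTI; apply: md => //; exact: measurable_itv.
apply/seteqP; split => w; rewrite /reset_event /= !in_itv/= andbT subr_gt0 subr_le0.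
  by move=> [/andP[-> ->]].
by move=> [[-> ->]].
Qed.

(** The n-th term is r^2 exp (- r T) / x times x^n / Gamma((n+1)/2)^2, for
    x = r sqrt (a (T - a)). *)
Let density_series (a : R) : 0 < a < T ->
  (fun n => \sum_(0 <= k < n) r^-1 * (hg k a * hg k (T - a))) @ \oo --> density a.
Proof.
move=> /andP[a0 aT]; have Ta : 0 < T - a by rewrite subr_gt0.
pose s := Num.sqrt (a * (T - a)); have s0 : 0 < s by rewrite sqrtr_gt0 mulr_gt0.
have x0 : 0 < r * s by rewrite mulr_gt0.
have -> : (fun n => \sum_(0 <= k < n) r^-1 * (hg k a * hg k (T - a))) =
    (fun n => r * expR (- (r * T)) * (r * s)^-1 * series (W_coeff (r * s)) n).
  apply/funext => n; rewrite /series/= mulr_sumr; apply: eq_bigr => k _.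
  rewrite W_coeffE /half_gamma a0 Ta.
  have sr : Num.sqrt r * Num.sqrt r = r by rewrite -expr2 sqr_sqrtr// ltW.
  have sE : s = Num.sqrt a * Num.sqrt (T - a) by rewrite /s sqrtrM// ltW.
  have -> : expR (- (r * T)) = expR (- (r * a)) * expR (- (r * (T - a))) :> R.
    by rewrite -expRD; congr expR; ring.
  have sa : Num.sqrt a != 0 by rewrite sqrtr_eq0 -ltNge.
  have sb : Num.sqrt (T - a) != 0 by rewrite sqrtr_eq0 -ltNge.
  have rn : r != 0 by rewrite gt_eqF.
  have -> : (r * s) ^+ k = Num.sqrt r ^+ k * Num.sqrt r ^+ k * (Num.sqrt a ^+ k * Num.sqrt (T - a) ^+ k).
    by rewrite -!exprMn sr sE.
  rewrite sE; move: (expR _) (expR _) (Num.sqrt a) (Num.sqrt (T - a)) sa sb => e1 e2 qa qb sa sb.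
  move: (Num.sqrt r) sr rn => q sr rn; rewrite !exprS -sr; field.
  by rewrite sa sb /=; apply: contraNneq rn => q0; rewrite -sr q0 mul0r.
rewrite /density /W_fun mulrA; apply: cvgM; first exact: cvg_cst.
exact: (is_cvg_W_series x0).
Qed.

Let hg0 n c : 0 <= hg n c. Proof. exact: half_gamma_ge0. Qed.

Let density_nneseries (a : R) : 0 < a < T ->
  (\sum_(0 <= n <oo) (r^-1 * (hg n a * hg n (T - a)))%:E = (density a)%:E)%E.
Proof.
move=> aT; apply/cvg_lim => //.
rewrite (_ : (fun n => _) = EFin \o (fun n => \sum_(0 <= k < n) r^-1 * (hg k a * hg k (T - a)))).
  by apply: cvg_EFin; [exact: nearW|exact: density_series].
by apply/funext => n; rewrite /= sumEFin.
Qed.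

(** Almost surely exactly one of the events {S_n < T <= S_(n+1)} occurs, and there
    the occupation time is given by [occupation_time_reset]. *)
Let indicator_series (Y : set RM) : \forall w \ae P,
  ((\1_(occupation_time W T @^-1` Y) w : R)%:E = \sum_(0 <= n <oo) (\1_(reset_event Y n) w : R)%:E)%E.
Proof.
move: (ae_gap_ge0 hS) (ae_reset_after r0 hS T0).
apply: filterS2 => w g0 [j gj].
have mono := points_nondecreasing g0.
have [S0 _ _] := hS.
have ex : exists n, T <= S n.+1 w.
  exists j; rewrite -[S j.+1 w](subrK (S j w)); apply: (le_trans gj).
  by rewrite lerDl -(S0 w) mono.
pose n := ex_minn ex; have [Tn mn] : T <= S n.+1 w /\ forall m, T <= S m.+1 w -> (n <= m)%N.
  by rewrite /n; case: ex_minnP.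
have nT : S n w < T.
  case: (n) mn => [|k] mn; first by rewrite S0.
  by rewrite ltNge; apply/negP => /mn; rewrite ltnn.
rewrite (nneseriesD1 (n := n))//.
rewrite [X in (_ + X)%E]eseries0 ?adde0; last first.
  move=> m _ /andP[_ mn']; rewrite indicE memNset// => -[/andP[mT Tm] _].
  move: mn'; rewrite neq_ltn => /orP[lt_mn|lt_nm].
    by have := lt_le_trans nT (le_trans Tm (mono _ _ lt_mn)); rewrite ltxx.
  by have := lt_le_trans mT (le_trans Tn (mono _ _ lt_nm)); rewrite ltxx.
rewrite !indicE; congr ((_ : bool)%:R%:E).
have ST : S n w < T <= S n.+1 w by rewrite nT Tn.
have -> : (w \in occupation_time W T @^-1` Y) = (occupation_time W T w \in Y).
  by apply/idP/idP; rewrite !inE.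
rewrite (occupation_time_reset hS hB hW g0 ST).
by apply/idP/idP; rewrite !inE; [split|move=> []].
Qed.

Local Open Scope ereal_scope.

Let reset_event_law (Y : set RM) n : measurable Y ->
  P (reset_event Y n) = \int[mu]_(c in Y) (r^-1 * (hg n c * hg n (T - c)))%:E.
Proof.
move=> mY; have := occ_law_at_reset_count r0 hS hB hI n T mY.
under [X in _ -> _ = X]eq_integral do rewrite EFinM.
rewrite ge0_integralZl//; last 3 first.
- apply/measurable_EFinP/measurable_funTS; apply: measurable_funM; first exact: measurable_half_gamma.
  by apply: (measurableT_comp (@measurable_half_gamma _ r n)); exact: measurable_funB.
- by move=> c _; rewrite lee_fin mulr_ge0.
- by rewrite lee_fin invr_ge0 ltW.
by move=> <-; rewrite muleA -EFinM mulVf ?mul1e// gt_eqF.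
Qed.

Lemma occupation_time_density :
  has_density_on P (occupation_time W T) `]0%R, T[ density.
Proof.
split.
- exact: measurable_occ.
- apply: (measurable_fun_cvg (h := fun n a => \sum_(0 <= k < n) r^-1 * (hg k a * hg k (T - a)))%R).
    move=> n; apply: measurable_sum => k; apply: measurable_funTS.
    apply: measurable_funM => //; apply: measurable_funM; first exact: measurable_half_gamma.
    by apply: (measurableT_comp (@measurable_half_gamma _ r k)); exact: measurable_funB.
  by move=> a; rewrite /= in_itv/= => aT; exact: density_series.
- move=> a; rewrite /= in_itv/= => aT.
  rewrite -lee_fin -density_nneseries//; apply: nneseries_ge0 => n _ _.
  by rewrite lee_fin mulr_ge0 ?invr_ge0 ?(ltW r0)// mulr_ge0.
move=> Y mY.
have mYA : measurable (occupation_time W T @^-1` Y).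
  by rewrite -[X in measurable X]setTI; exact: measurable_occ.
transitivity (\int[P]_w \sum_(0 <= n <oo) (\1_(reset_event Y n) w : R)%:E).
  transitivity (\int[P]_w (\1_(occupation_time W T @^-1` Y) w : R)%:E).
    by rewrite integral_indic// setIT.
  apply: ge0_ae_eq_integral => //.
  - by apply/measurable_EFinP; exact: measurable_indic.
  - apply: ge0_emeasurable_sum => // n _.
    by apply/measurable_EFinP; apply: measurable_indic; exact: measurable_reset_event.
  - by move=> w _; apply: nneseries_ge0 => n _ _; rewrite lee_fin.
  by move: (indicator_series Y); apply: filterS => w h _.
rewrite integral_nneseries//; last first.
  by move=> n; apply/measurable_EFinP; apply: measurable_indic; exact: measurable_reset_event.
transitivity (\sum_(0 <= n <oo) \int[mu]_(c in Y) (r^-1 * (hg n c * hg n (T - c)))%:E).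
  apply: eq_eseriesr => n _; rewrite integral_indic//; last exact: measurable_reset_event.
  by rewrite setIT; exact: reset_event_law.
rewrite -integral_nneseries//; last 2 first.
- move=> n; apply/measurable_EFinP/measurable_funTS; apply: measurable_funM => //.
  apply: measurable_funM; first exact: measurable_half_gamma.
  by apply: (measurableT_comp (@measurable_half_gamma _ r n)); exact: measurable_funB.
- by move=> n c _; rewrite lee_fin mulr_ge0 ?invr_ge0 ?(ltW r0)// mulr_ge0.
rewrite integral_mkcond [RHS]integral_mkcond; apply: eq_integral => c _.
rewrite !patchE in_setI; case: (c \in Y) => //=; rewrite mem_setE in_itv/=.
case: ifPn => [cT|cT]; first exact: density_nneseries.
apply: eseries0 => n _ _; move: cT; rewrite negb_and -!leNgt => /orP[c0|Tc].
  by rewrite half_gamma_le0// mul0r mulr0.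
by rewrite [X in (_ * (_ * X))%R]half_gamma_le0 ?mulr0// subr_le0.
Qed.

End occupation_law.

Theorem theorem4p1 (R : realType) (d : measure_display)
    (Omega : measurableType d) (P : probability Omega R) (r T : R)
    (W : R -> Omega -> R) (r_gt0 : 0 < r) (T_gt0 : 0 < T)
    (rBM : reset_brownian_motion P r W) :
  has_density_on P (occupation_time W T) `]0, T[
    (fun a => r * expR (- (r * T)) * W_fun (r * Num.sqrt (a * (T - a)))) /\
  forall x : R, 0 < x ->
    cvgn (series (W_coeff x)) /\
    W_fun x = besselI 0 (2 * x)
              + 1 / (x * pi) * hypergeometric_1F2 1 (1 / 2) (1 / 2) (x ^+ 2).
Proof.
split; last by move=> x x0; split; [exact: is_cvg_W_series|exact: W_funE].
have [S [B [hS hB hI hW]]] := rBM.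
exact: (occupation_time_density r_gt0 T_gt0 hS hB hI hW).
Qed.
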